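(* For every $C>0$ and every $p$ with $0<p<3$ there is a finite constant $K(p,C)$ such that the following holds. Let $(\mu_n)_{n\ge 1}$ be any sequence of dominant weights $\mu_n\in\Lambda^+$ of $G=\mathrm{SU}(3)$ with $\overline{\mu_n}\to\infty$ as $n\to\infty$ and $\underline{\mu_n}\leq C$ for all $n$. Then $d_{\mu_n}\to\infty$ as $n\to\infty$, while for every $0<p<3$, $$\|\chi_{\mu_n}\|_{L^p(G)}\leq K(p,C)<\infty\qquad\text{for all } n.$$
   Context: $G=\mathrm{SU}(3)$, $T$ is a maximal torus of $G$ with Lie algebra $\mathfrak{t}$, and roots and weights are regarded as elements of $i\mathfrak{t}^*$, where $\mathfrak{t}^*$ is the real dual of $\mathfrak{t}$. $\Phi^+\subset i\mathfrak{t}^*$ is a fixed positive root system (it has three elements), $\rho$ is the half sum of the positive roots, $\langle\cdot,\cdot\rangle$ is a fixed Weyl-group-invariant inner product on $i\mathfrak{t}^*$, and $\Lambda^+\subset i\mathfrak{t}^*$ is the set of dominant weights. For $\mu\in\Lambda^+$, $\chi_\mu:G\to\mathbb{C}$ is the character of the irreducible representation of $G$ with highest weight $\mu$, and $d_\mu$ is the dimension of that representation. $\overline{\mu}$ and $\underline{\mu}$ denote the maximum and the minimum of $\{\langle\mu+\rho,\alpha\rangle:\alpha\in\Phi^+\}$, respectively. $\|f\|_{L^p(G)}=\left(\int_G|f|^p\,dg\right)^{1/p}$ with respect to Haar measure on $G$ (also for $0<p<1$). *)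

(* Defs.v *)
From HB Require Import structures.
From mathcomp Require Import all_boot all_order all_algebra.
From mathcomp Require Import complex.
From mathcomp Require Import all_classical all_reals all_analysis.

Set Implicit Arguments.
Unset Strict Implicit.
Unset Printing Implicit Defensive.

Import Order.TTheory GRing.Theory Num.Theory.
Import numFieldNormedType.Exports.

Local Open Scope classical_set_scope.
Local Open Scope ring_scope.

(* The complex numbers.  The type ascription is what makes the topological
   and normed structures of the analysis library available on R[i]. *)
Definition CC (R : realType) : numClosedFieldType := R[i].

Section SU3.
Variable R : realType.
Local Notation C := (CC R).
Local Notation M3 := 'M[C]_3.

Implicit Types (g h n X Y A : M3) (T : set M3).

Definition ofreal (r : R) : C := (r%:C)%C.

Definition expC (z : C) : C :=
  let: (x +i* y)%C := z in ofreal (expR x) * (cos y +i* sin y)%C.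

Definition expmx (A : M3) : M3 :=
  lim (series (fun k : nat => (k`!%:R : C)^-1 *: A ^+ k) @ \oo).

Definition SU3 : set M3 := [set g | g \is unitarymx /\ \det g = 1].

(* A torus of SU(3): a closed connected abelian subgroup. *)
Definition torus (T : set M3) : Prop :=
  [/\ T `<=` SU3,
      T 1%:M,
      forall g h, T g -> T h -> T (g *m invmx h),
      forall g h, T g -> T h -> g *m h = h *m g &
      closed T /\ connected T].

Definition maximal_torus (T : set M3) : Prop :=
  torus T /\ forall T' : set M3, torus T' -> T `<=` T' -> T' = T.

Definition Lie (T : set M3) : set M3 :=
  [set X | forall s : R, T (expmx (ofreal s *: X))].

(* i t^*.  Functionals on t are encoded as functions on all 3 x 3 matrices
   that vanish outside t, so that equality of functionals is Leibniz equality
   of functions. *)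
Definition idual (T : set M3) : set (M3 -> C) :=
  [set l | [/\ forall X, Lie T X -> complex.Re (l X) = 0,
               forall X Y, Lie T X -> Lie T Y -> l (X + Y) = l X + l Y,
               forall (s : R) X, Lie T X -> l (ofreal s *: X) = ofreal s * l X &
               forall X, ~ Lie T X -> l X = 0]].

(* The complexified Lie algebra of SU(3) is sl(3,C), the trace zero matrices. *)
Definition roots (T : set M3) : set (M3 -> C) :=
  [set a | [/\ idual T a, a <> 0 &
     exists Y : M3, [/\ \tr Y = 0, Y <> 0 &
       forall X, Lie T X -> X *m Y - Y *m X = a X *: Y]]].

Definition positive_system (T : set M3) (P : set (M3 -> C)) : Prop :=
  [/\ P `<=` roots T,
      forall a, roots T a -> P a \/ P (- a),
      forall a, ~ (P a /\ P (- a)) &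
      forall a b, P a -> P b -> roots T (a + b) -> P (a + b)].

Definition half_sum (P : set (M3 -> C)) : M3 -> C :=
  ofreal 2^-1 \*o (\sum_(a \in P) a).

(* The Weyl group N(T)/T acts on i t^* by (n l)(X) = l (n^-1 X n). *)
Definition weyl_act (n : M3) (l : M3 -> C) : M3 -> C :=
  fun X => l (invmx n *m X *m n).

Definition weyl_invariant_inner_product (T : set M3)
    (ip : (M3 -> C) -> (M3 -> C) -> R) : Prop :=
  [/\ forall l m, idual T l -> idual T m -> ip l m = ip m l,
      forall l l' m, idual T l -> idual T l' -> idual T m ->
        ip (l + l') m = ip l m + ip l' m,
      forall (s : R) l m, idual T l -> idual T m ->
        ip (ofreal s \*o l) m = s * ip l m,
      forall l, idual T l -> l <> 0 -> 0 < ip l l &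
      forall n, SU3 n -> [set n *m g *m invmx n | g in T] = T ->
        forall l m, idual T l -> idual T m ->
          ip (weyl_act n l) (weyl_act n m) = ip l m].

Definition weight_lattice (T : set M3) : set (M3 -> C) :=
  [set l | idual T l /\
     forall X, Lie T X -> expmx X = 1%:M ->
       exists k : int, l X = (0 +i* (2 * pi * k%:~R))%C].

Definition dominant (T : set M3) (P : set (M3 -> C))
    (ip : (M3 -> C) -> (M3 -> C) -> R) : set (M3 -> C) :=
  [set l | weight_lattice T l /\ forall a, P a -> 0 <= ip l a].

(* Maximum and minimum of <mu + rho, alpha> over the (finite) set P. *)
Definition max_pairing (P : set (M3 -> C))
    (ip : (M3 -> C) -> (M3 -> C) -> R) (mu : M3 -> C) : R :=
  sup [set ip (mu + half_sum P) a | a in P].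

Definition min_pairing (P : set (M3 -> C))
    (ip : (M3 -> C) -> (M3 -> C) -> R) (mu : M3 -> C) : R :=
  inf [set ip (mu + half_sum P) a | a in P].

(* Irreducible continuous finite-dimensional complex representations of SU(3),
   acting on column vectors.  The values of [rep] outside SU(3) are junk. *)
Record irrep := Irrep {
  repdim : nat;
  rep : M3 -> 'M[C]_repdim;
  rep_continuous : {within SU3, continuous rep};
  rep1 : rep 1%:M = 1%:M;
  repM : forall g h, SU3 g -> SU3 h -> rep (g *m h) = rep g *m rep h;
  repdim_gt0 : (0 < repdim)%N;
  rep_irr : forall U : {vspace 'cV[C]_repdim},
    (forall g, SU3 g -> forall v, v \in U -> rep g *m v \in U) ->
    U = 0%VS \/ U = fullv }.

Definition character (V : irrep) (g : M3) : C := \tr (rep V g).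

Definition weights (T : set M3) (V : irrep) : set (M3 -> C) :=
  [set l | idual T l /\
     exists v : 'cV[C]_(repdim V), v <> 0 /\
       forall X, Lie T X ->
         rep V (expmx X) *m v = expC (l X) *: v].

(* mu is the highest weight of V: a weight from which every weight of V is
   obtained by subtracting a sum of positive roots. *)
Definition highest_weight (T : set M3) (P : set (M3 -> C)) (V : irrep)
    (mu : M3 -> C) : Prop :=
  weights T V mu /\
  forall l, weights T V l ->
    exists k : (M3 -> C) -> nat, mu - l = \sum_(a \in P) a *+ k a.

End SU3.

Notation borelM3 R := (g_sigma_algebraType (@open 'M[CC R]_3)).

(* Haar measures of SU(3), as Borel measures on M_3(C) of which only the
   restriction to the compact set SU(3) is used. *)
Definition haar (R : realType) (m : {measure set (borelM3 R) -> \bar R}) : Prop :=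
  (0 < m (@SU3 R) < +oo)%E /\
  forall (g : 'M[CC R]_3) (A : set (borelM3 R)),
    SU3 g -> measurable A -> A `<=` @SU3 R ->
    m [set g *m a | a in (A : set 'M[CC R]_3)] = m A.

Definition Lpnorm (R : realType) (m : {measure set (borelM3 R) -> \bar R})
    (p : R) (f : 'M[CC R]_3 -> CC R) : \bar R :=
  ((\int[m]_(g in (@SU3 R : set (borelM3 R))) ((complex.Re `|f g|) `^ p)%:E)
     `^ p^-1)%E.

(* Main.v *)
(* Up to conjugation the torus is diagonal and the positive roots are e_0 - e_1,
   e_1 - e_2, e_0 - e_2.  In the coordinates (k0, k1, 0) of the highest weight put
   P = k0 + 2 and Q = k1 + 1, so that the weight plus rho is (P, Q, 0); the largest
   and smallest pairings are proportional to P and to min(Q, P - Q).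

   Weyl's integration formula is used in a discrete form: if the restriction of a
   continuous class function f to the diagonal torus is a trigonometric polynomial,
   its Haar integral is one sixth of the average of f |Delta|^2 over the N-torsion
   points, for all large N, where Delta is the Vandermonde product.  It suffices to
   check this for h_a h_b, with h_a the complete symmetric functions: these generate
   all the quotients of alternants by Delta, and translating by elements which act as
   a scalar on two given row vectors shows that h_a h_b integrates to 0 unless
   a = b = 0.  Applied to |chi|^2, whose integral is 1 by Schur orthogonality, the
   formula yields Weyl's character formula chi Delta = A at the torsion points, with A
   the alternant of exponents (P, Q, 0).

   Expanding A along a column gives |A| <= min(Q, P - Q) (d_01 + d_02 + d_12), where
   d_jk are the distances between the eigenvalues.  For 2 < p < 3 the integrand
   |chi|^p |Delta|^2 = |A|^p |Delta|^(2 - p) is therefore at most a constant times the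
   sum of the d_jk^(2 - p), whose averages over torsion points stay bounded since
   p - 2 < 1.  As the integration formula only applies to polynomials in |chi|^2, the
   function t^(p/2) is replaced by a Bernstein polynomial.  Finally
   |chi| <= dim V at diag(s, 1, s^-1) with s = e^(i pi / P), where |A / Delta| is at
   least 2 / |1 - s|^2, makes the dimensions tend to infinity. *)
Require Import Defs.
From HB Require Import structures.
From mathcomp Require Import all_boot all_order all_fingroup all_algebra.
From mathcomp Require Import complex.
From mathcomp Require Import all_classical all_reals all_analysis.
From mathcomp Require Import measurable_realfun.
From mathcomp Require Import ring lra zify.

Set Implicit Arguments.
Unset Strict Implicit.
Unset Printing Implicit Defensive.

Import Order.TTheory GRing.Theory Num.Theory.
Import numFieldNormedType.Exports.

Local Open Scope classical_set_scope.
Local Open Scope ring_scope.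

(** * Complex numbers and limits *)

Section ComplexNumbers.
Variable R : realType.
Local Notation C := (CC R).
Implicit Types (z w : C) (s t : R).

(** The vanishing argument rests on having exactly two rows. The discrete Fourier inversion in
    [hsym_rows] writes h_a as a combination of products of entries of one row vector times g, so h_a
    h_b involves two rows. In C^3 a direction orthogonal to both remains, and the determinant can be
    corrected along it; three rows could leave none. Two factors suffice because determinant 1
    allows every exponent triple to be shifted so that it ends in 0, and the two-row Jacobi-Trudi
    expression h_{p-2} h_{q-1} - h_{p-1} h_{q-2} has the alternant of (p, q, 0) as numerator.

    Averages over N-torsion points see exponents only modulo N. Hence the integration formula holds
    beyond a threshold that depends on the function, and the character formula is obtained at
    torsion points of large order. It is used only there: in averages, and at one torsion point for
    the dimension.

    The Bernstein degree and these thresholds depend on the representation, but the final constant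
    does not: the approximation is only required to be within 1, and the bound |Delta|^2 <= 64 turns
    that error into an additive constant. *)

Definition re z : R := complex.Re z.
Definition im z : R := complex.Im z.
Definition abs z : R := re `|z|.
Definition iu : C := (0 +i* 1)%C.

Lemma reD z w : re (z + w) = re z + re w. Proof. by case: z; case: w. Qed.
Lemma imD z w : im (z + w) = im z + im w. Proof. by case: z; case: w. Qed.
Lemma reN z : re (- z) = - re z. Proof. by case: z. Qed.
Lemma imN z : im (- z) = - im z. Proof. by case: z. Qed.
Lemma reM z w : re (z * w) = re z * re w - im z * im w.
Proof. by case: z; case: w. Qed.
Lemma imM z w : im (z * w) = re z * im w + im z * re w.
Proof. by case: z; case: w. Qed.
Lemma re_conj z : re (z^*)%R = re z. Proof. by case: z. Qed.
Lemma im_conj z : im (z^*)%R = - im z. Proof. by case: z. Qed.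
Lemma complex_ext z w : re z = re w -> im z = im w -> z = w.
Proof. by case: z => a b; case: w => c d /= -> ->. Qed.

Lemma ofreal0 : ofreal 0 = 0 :> C. Proof. by []. Qed.
Lemma ofreal1 : ofreal 1 = 1 :> C. Proof. by []. Qed.
Lemma ofrealD s t : ofreal (s + t) = ofreal s + ofreal t.
Proof. exact: rmorphD. Qed.
Lemma ofrealN s : ofreal (- s) = - ofreal s.
Proof. exact: rmorphN. Qed.
Lemma ofrealM s t : ofreal (s * t) = ofreal s * ofreal t.
Proof. exact: rmorphM. Qed.
Lemma ofrealX s n : ofreal (s ^+ n) = ofreal s ^+ n.
Proof. exact: rmorphXn. Qed.
Lemma ofrealV s : ofreal s^-1 = (ofreal s)^-1.
Proof. exact: fmorphV. Qed.
Lemma ofreal_nat n : ofreal n%:R = n%:R :> C.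
Proof. exact: rmorph_nat. Qed.
Lemma ofreal_sum (I : Type) (r : seq I) (P : pred I) (F : I -> R) :
  ofreal (\sum_(i <- r | P i) F i) = \sum_(i <- r | P i) ofreal (F i).
Proof. exact: rmorph_sum. Qed.
Lemma ofreal_inj : injective (@ofreal R). Proof. by move=> s t []. Qed.
Lemma re_ofreal s : re (ofreal s) = s. Proof. by []. Qed.
Lemma im_ofreal s : im (ofreal s) = 0. Proof. by []. Qed.
Lemma conj_ofreal s : ((ofreal s)^*)%R = ofreal s.
Proof. by apply: complex_ext; rewrite ?re_conj ?im_conj //= oppr0. Qed.
Lemma ler_ofreal s t : (ofreal s <= ofreal t) = (s <= t).
Proof. exact: lecR. Qed.
Lemma ltr_ofreal s t : (ofreal s < ofreal t) = (s < t).
Proof. exact: ltcR. Qed.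

Lemma complexE z : z = ofreal (re z) + iu * ofreal (im z).
Proof.
by apply: complex_ext; rewrite ?(reD, imD, reM, imM, re_ofreal, im_ofreal) /=; ring.
Qed.

Lemma re_sum (I : Type) (r : seq I) (P : pred I) (F : I -> C) :
  re (\sum_(i <- r | P i) F i) = \sum_(i <- r | P i) re (F i).
Proof. by apply: (big_morph re reD). Qed.
Lemma im_sum (I : Type) (r : seq I) (P : pred I) (F : I -> C) :
  im (\sum_(i <- r | P i) F i) = \sum_(i <- r | P i) im (F i).
Proof. by apply: (big_morph im imD). Qed.

Lemma ofreal_abs z : ofreal (abs z) = `|z|.
Proof. by rewrite /abs /re normc_def. Qed.
Lemma absM z w : abs (z * w) = abs z * abs w.
Proof. by apply: ofreal_inj; rewrite ofrealM !ofreal_abs normrM. Qed.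
Lemma abs_ge0 z : 0 <= abs z.
Proof. by rewrite -ler_ofreal ofreal_abs ofreal0 normr_ge0. Qed.
Lemma absD z w : abs (z + w) <= abs z + abs w.
Proof. by rewrite -ler_ofreal ofrealD !ofreal_abs ler_normD. Qed.
Lemma absN z : abs (- z) = abs z. Proof. by rewrite /abs normrN. Qed.
Lemma absC z w : abs (z - w) = abs (w - z).
Proof. by rewrite -absN opprB. Qed.
Lemma abs0 : abs 0 = 0. Proof. by rewrite /abs normr0. Qed.
Lemma abs1 : abs 1 = 1. Proof. by rewrite /abs normr1. Qed.
Lemma abs_eq0 z : (abs z == 0) = (z == 0).
Proof. by rewrite -(inj_eq ofreal_inj) ofreal_abs ofreal0 normr_eq0. Qed.
Lemma abs_gt0 z : (0 < abs z) = (z != 0).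
Proof. by rewrite lt_neqAle abs_ge0 andbT eq_sym abs_eq0. Qed.
Lemma absX z n : abs (z ^+ n) = abs z ^+ n.
Proof. by elim: n => [|n IH]; rewrite ?expr0 ?abs1 // !exprS absM IH. Qed.
Lemma absV z : abs z^-1 = (abs z)^-1.
Proof. by apply: ofreal_inj; rewrite ofrealV !ofreal_abs normfV. Qed.
Lemma abs_conj z : abs (z^*)%R = abs z.
Proof. by rewrite /abs norm_conjC. Qed.
Lemma abs_ofreal s : abs (ofreal s) = `|s|.
Proof. by rewrite /abs /re normc_def /= expr0n addr0 sqrtr_sqr. Qed.
Lemma abs_sum (I : Type) (r : seq I) (P : pred I) (F : I -> C) :
  abs (\sum_(i <- r | P i) F i) <= \sum_(i <- r | P i) abs (F i).
Proof.
elim/big_rec2 : _ => [|i x y _ h]; first by rewrite abs0.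
by apply: le_trans (absD _ _) _; rewrite lerD2l.
Qed.
Lemma sqr_abs z : abs z ^+ 2 = re z ^+ 2 + im z ^+ 2.
Proof. by apply: ofreal_inj; rewrite ofrealX ofreal_abs -add_Re2_Im2. Qed.
Lemma mul_conj z : z * (z^*)%R = ofreal (abs z ^+ 2).
Proof. by rewrite ofrealX ofreal_abs normCK. Qed.
Lemma re_le_abs z : `|re z| <= abs z.
Proof. by rewrite -ler_ofreal ofreal_abs normc_ge_Re. Qed.
Lemma abs_iu : abs iu = 1.
Proof.
apply/eqP; rewrite -(eqrXn2 (n := 2)) ?abs_ge0 // sqr_abs /=.
by rewrite expr0n add0r expr1n.
Qed.
Lemma im_le_abs z : `|im z| <= abs z.
Proof.
have : `|re (iu * z)| <= abs (iu * z) by exact: re_le_abs.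
by rewrite absM abs_iu mul1r reM /= mul0r mul1r sub0r normrN.
Qed.
Lemma abs_le_reim z : abs z <= `|re z| + `|im z|.
Proof.
rewrite {1}[z]complexE; apply: le_trans (absD _ _) _.
by rewrite absM abs_iu mul1r !abs_ofreal.
Qed.

Lemma unit_conj z : abs z = 1 -> (z^*)%R = z^-1.
Proof.
move=> h; have z0 : z != 0 by rewrite -abs_gt0 h.
by apply: (mulfI z0); rewrite mul_conj h expr1n mulfV.
Qed.

Definition cis t : C := (cos t +i* sin t)%C.

Lemma cisD s t : cis (s + t) = cis s * cis t.
Proof.
by apply: complex_ext; rewrite ?(reM, imM) /= ?cosD ?sinD; ring.
Qed.
Lemma cis0 : cis 0 = 1.
Proof. by rewrite /cis cos0 sin0. Qed.
Lemma abs_cis t : abs (cis t) = 1.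
Proof.
apply/eqP; rewrite -(eqrXn2 (n := 2)) ?abs_ge0 // sqr_abs /=.
by rewrite cos2Dsin2 expr1n.
Qed.
Lemma cis_neq0 t : cis t != 0.
Proof. by rewrite -abs_gt0 abs_cis. Qed.
Lemma cisN t : cis (- t) = (cis t)^-1.
Proof.
by apply: (mulfI (cis_neq0 t)); rewrite -cisD subrr cis0 mulfV ?cis_neq0.
Qed.
Lemma cisB s t : cis (s - t) = cis s / cis t.
Proof. by rewrite cisD cisN. Qed.
Lemma cisMn t n : cis (t *+ n) = cis t ^+ n.
Proof.
by elim: n => [|n IH]; rewrite ?mulr0n ?cis0 // mulrSr exprSr cisD IH.
Qed.
Lemma cisMz t (k : int) : cis (t *~ k) = cis t ^ k.
Proof. by case: k => n; rewrite ?NegzE ?mulrNz ?cisN -?pmulrn cisMn // exprnN. Qed.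
Lemma cis2pi : cis (pi *+ 2) = 1.
Proof. by rewrite /cis cos2pi sin2pi. Qed.

Lemma cis_surj z : abs z = 1 -> exists2 t, - pi <= t <= pi & z = cis t.
Proof.
move=> h; have h2 : re z ^+ 2 + im z ^+ 2 = 1 by rewrite -sqr_abs h expr1n.
have rez : -1 <= re z <= 1 by rewrite -ler_norml -h re_le_abs.
have ps := pi_ge0 R.
have [a0 api] := (acos_ge0 rez, acos_lepi rez).
have ca : cos (acos (re z)) = re z by rewrite acosK.
have sa : sin (acos (re z)) = `|im z|.
  by rewrite sin_acos // -(sqrtr_sqr (im z)) -h2; congr Num.sqrt; ring.
have [i0|i0] := leP 0 (im z).
  exists (acos (re z)); first by apply/andP; split=> //; lra.
  by apply: complex_ext => //=; rewrite ?ca ?sa // ger0_norm.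
exists (- acos (re z)); first by apply/andP; split; lra.
by apply: complex_ext => //=; rewrite ?cosN ?sinN ?ca ?sa // ltr0_norm ?opprK.
Qed.

(** Since cos |t| = 1 - 2 sin^2(|t| / 2), the hypothesis makes sin(|t| / 2) vanish, and |t| / 2 lies
    in [0, pi), where the sine is zero only at 0. *)
Lemma cis_eq1_small t : `|t| < pi *+ 2 -> cis t = 1 -> t = 0.
Proof.
move=> ht /(f_equal re) /= h1.
have : cos `|t| = 1 by rewrite cos_norm.
have n0 := normr_ge0 t; have p0 := pi_gt0 R.
rewrite mulr2n in ht; have ht' : 0 <= `|t| / 2 < pi by apply/andP; split; lra.
have -> : `|t| = (`|t| / 2) *+ 2 by rewrite mulr2n; lra.
rewrite cos_mulr2n cos2sin2 => hs.
have : sin (`|t| / 2) ^+ 2 = 0 by rewrite mulr2n in hs; lra.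
move/eqP; rewrite sqrf_eq0 => /eqP s0.
case/andP: ht' => a0 ap.
apply/eqP; rewrite -normr_eq0; apply/eqP.
move: a0; rewrite le_eqVlt => /orP[/eqP e|a0]; first lra.
by have := @sin_gt0_pi R (`|t| / 2); rewrite a0 ap s0 ltxx => /(_ isT).
Qed.

Lemma cis_eq1 t : cis t = 1 -> exists k : int, t = pi *+ 2 *~ k.
Proof.
move=> h; have p0 : 0 < pi *+ 2 :> R by rewrite pmulrn_lgt0 ?pi_gt0.
pose k := Num.floor (t / (pi *+ 2)).
have /andP[k1 k2] := floor_itv (t / (pi *+ 2)).
have k2' : t < (k%:~R + 1) * (pi *+ 2).
  by rewrite -ltr_pdivrMr // -[1]/(1%:~R) -intrD.
have k1' : k%:~R * (pi *+ 2) <= t by rewrite -ler_pdivlMr.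
exists k; apply/eqP; rewrite -subr_eq0; apply/eqP; apply: cis_eq1_small.
  rewrite -(mulrzr _ k) ger0_norm; lra.
by rewrite cisB h cisMz cis2pi exp1rz divr1.
Qed.

Lemma expC_iu t : expC (iu * ofreal t) = cis t.
Proof.
have -> : iu * ofreal t = (0 +i* t)%C.
  by apply: complex_ext; rewrite ?(reM, imM) /=; ring.
by rewrite /expC expR0 ofreal1 mul1r.
Qed.

End ComplexNumbers.

Section Limits.
Variable R : realType.
Local Notation C := (CC R).

Lemma cvg_mxP (T : Type) (F : set_system T) (FF : Filter F) (m n : nat)
    (f : T -> 'M[C]_(m, n)) (A : 'M[C]_(m, n)) :
  (f x @[x --> F] --> A) <-> forall i j, (f x i j) @[x --> F] --> A i j.
Proof.
split=> [h i j|h].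
  move=> U hU; apply: (h [set M : 'M[C]_(m, n) | U (M i j)]).
  exists (fun i' j' => [set z | (i', j') = (i, j) -> U z]) => [i' j'|M hM].
    have [[-> ->]|ne] := pselect ((i', j') = (i, j)).
      by apply: filterS hU => z Uz _.
    by apply: filterS (@filterT _ (nbhs (A i' j')) _) => z _ /ne.
  exact: (hM i j).
move=> U [P hP sPU]; apply: filterS (sPU) _.
rewrite /nbhs /=.
have : \forall x \near F, forall k : 'I_m * 'I_n, P k.1 k.2 (f x k.1 k.2).
  by apply: filter_forall => -[i j] /=; apply: (h i j); apply: hP.
by apply: filterS => x hx i j; apply: (hx (i, j)).
Qed.

Section CvgFilter.
Variables (T : Type) (F : set_system T).
Context {FF : Filter F}.

Lemma cvg_absP (f : T -> C) (a : C) :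
  (f x @[x --> F] --> a) <->
  (forall e : R, 0 < e -> \forall x \near F, abs (f x - a) < e).
Proof.
split=> [/cvgrPdist_lt h e e0|h].
  have /h : 0 < ofreal e :> C by rewrite -ofreal0 ltr_ofreal.
  by apply: filterS => x; rewrite -ofreal_abs ltr_ofreal absC.
apply/cvgrPdist_lt => e e0.
have ee : e = ofreal (re e).
  by case: e e0 => a' b'; rewrite ltcE /= => /andP[/eqP -> _].
move: e0; rewrite ee -ofreal0 ltr_ofreal => /h.
by apply: filterS => x; rewrite -ofreal_abs ltr_ofreal absC.
Qed.

Lemma cvg_re (f : T -> C) (a : C) :
  (f x @[x --> F] --> a) -> (re (f x) @[x --> F] --> re a).
Proof.
move=> /cvg_absP h; apply/cvgrPdist_lt => e /h.
apply: filterS => x; apply: le_lt_trans.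
by rewrite distrC -reN -reD re_le_abs.
Qed.

Lemma cvg_im (f : T -> C) (a : C) :
  (f x @[x --> F] --> a) -> (im (f x) @[x --> F] --> im a).
Proof.
move=> /cvg_absP h; apply/cvgrPdist_lt => e /h.
apply: filterS => x; apply: le_lt_trans.
by rewrite distrC -imN -imD im_le_abs.
Qed.

Lemma cvg_abs (f : T -> C) (a : C) :
  (f x @[x --> F] --> a) -> (abs (f x) @[x --> F] --> abs a).
Proof.
move=> /cvg_absP h; apply/cvgrPdist_lt => e /h.
apply: filterS => x; apply: le_lt_trans.
rewrite distrC ler_norml; apply/andP; split.
  have := absD (a - f x) (f x); rewrite subrK absC; lra.
have := absD (f x - a) a; rewrite subrK; lra.
Qed.

Lemma cvg_conj (f : T -> C) (a : C) :
  (f x @[x --> F] --> a) -> ((f x)^*%R @[x --> F] --> (a^*)%R).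
Proof.
move=> /cvg_absP h; apply/cvg_absP => e /h.
by apply: filterS => x; rewrite -rmorphB abs_conj.
Qed.

Lemma cvg_complex (f : T -> C) (a : C) :
  (re (f x) @[x --> F] --> re a) -> (im (f x) @[x --> F] --> im a) ->
  (f x @[x --> F] --> a).
Proof.
move=> /cvgrPdist_lt hr /cvgrPdist_lt hi; apply/cvg_absP => e e0.
have e2 : 0 < e / 2 by lra.
apply: filterS2 (hr _ e2) (hi _ e2) => x h1 h2.
apply: le_lt_trans (abs_le_reim _) _.
rewrite reD imD reN imN distrC [X in _ + X]distrC; lra.
Qed.

Lemma cvg_ofreal (f : T -> R) (a : R) :
  (f x @[x --> F] --> a) -> (ofreal (f x) @[x --> F] --> ofreal a).
Proof.
move=> h; apply: cvg_complex; rewrite ?re_ofreal ?im_ofreal //.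
exact: cvg_cst.
Qed.

Lemma cvg_cis (f : T -> R) (a : R) :
  (f x @[x --> F] --> a) -> (cis (f x) @[x --> F] --> cis a).
Proof.
move=> h; apply: cvg_complex => /=.
  exact: (continuous_cvg _ (@continuous_cos R a) h).
exact: (continuous_cvg _ (@continuous_sin R a) h).
Qed.

Lemma cvgC_add (f g : T -> C) (a b : C) :
  (f x @[x --> F] --> a) -> (g x @[x --> F] --> b) ->
  (f x + g x @[x --> F] --> a + b).
Proof. exact: cvgD. Qed.

Lemma cvgC_mul (f g : T -> C) (a b : C) :
  (f x @[x --> F] --> a) -> (g x @[x --> F] --> b) ->
  (f x * g x @[x --> F] --> a * b).
Proof. exact: cvgM. Qed.

Lemma cvgC_opp (f : T -> C) (a : C) :
  (f x @[x --> F] --> a) -> (- f x @[x --> F] --> - a).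
Proof. exact: cvgN. Qed.

Lemma cvgC_sum (I : Type) (r : seq I) (P : pred I) (f : I -> T -> C) (a : I -> C) :
  (forall i, P i -> f i x @[x --> F] --> a i) ->
  (\sum_(i <- r | P i) f i x) @[x --> F] --> \sum_(i <- r | P i) a i.
Proof.
move=> h; elim: r => [|i r IH].
  under eq_fun do rewrite big_nil.
  by rewrite big_nil; exact: cvg_cst.
case Pi : (P i).
  rewrite big_cons Pi; under eq_fun do rewrite big_cons Pi.
  by apply: cvgC_add IH; exact: h.
by rewrite big_cons Pi; under eq_fun do rewrite big_cons Pi.
Qed.

Lemma cvgC_prod (I : Type) (r : seq I) (P : pred I) (f : I -> T -> C) (a : I -> C) :
  (forall i, P i -> f i x @[x --> F] --> a i) ->
  (\prod_(i <- r | P i) f i x) @[x --> F] --> \prod_(i <- r | P i) a i.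
Proof.
move=> h; elim: r => [|i r IH].
  under eq_fun do rewrite big_nil.
  by rewrite big_nil; exact: cvg_cst.
case Pi : (P i).
  rewrite big_cons Pi; under eq_fun do rewrite big_cons Pi.
  by apply: cvgC_mul IH; exact: h.
by rewrite big_cons Pi; under eq_fun do rewrite big_cons Pi.
Qed.

Lemma cvg_mulmx (m n p : nat) (f : T -> 'M[C]_(m, n)) (g : T -> 'M[C]_(n, p))
    (A : 'M[C]_(m, n)) (B : 'M[C]_(n, p)) :
  (f x @[x --> F] --> A) -> (g x @[x --> F] --> B) ->
  (f x *m g x @[x --> F] --> A *m B).
Proof.
move=> /cvg_mxP hf /cvg_mxP hg; apply/cvg_mxP => i j.
rewrite mxE; under eq_fun do rewrite mxE.
by apply: cvgC_sum => k _; apply: cvgC_mul.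
Qed.

Lemma cvg_trmxC (m n : nat) (f : T -> 'M[C]_(m, n)) (A : 'M[C]_(m, n)) :
  (f x @[x --> F] --> A) ->
  ((map_mx Num.conj (f x)^T) @[x --> F] --> map_mx Num.conj A^T).
Proof.
move=> /cvg_mxP hf; apply/cvg_mxP => i j.
rewrite !mxE; under eq_fun do rewrite !mxE.
exact: cvg_conj.
Qed.

Lemma cvg_det (n : nat) (f : T -> 'M[C]_n) (A : 'M[C]_n) :
  (f x @[x --> F] --> A) -> (\det (f x) @[x --> F] --> \det A).
Proof.
move=> /cvg_mxP hf; apply: cvgC_sum => s _.
apply: cvgC_mul; first exact: cvg_cst.
by apply: cvgC_prod => i _; exact: hf.
Qed.

End CvgFilter.

Lemma cvgC_unique (T : Type) (F : set_system T) {FF : ProperFilter F}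
    (f : T -> C) (a b : C) :
  (f x @[x --> F] --> a) -> (f x @[x --> F] --> b) -> a = b.
Proof. by move=> ha hb; apply: (cvg_unique _ ha hb). Qed.

End Limits.

(** * Compactness of SU(3) and continuous functions on it *)

Section ContinuityOnSU3.
Variable R : realType.
Local Notation C := (CC R).
Local Notation M3 := 'M[C]_3.

Lemma SU3_unit (g : M3) : SU3 g -> g \in unitmx.
Proof. by case=> h _; exact: unitarymx_unit. Qed.
Lemma SU3_mul (g h : M3) : SU3 g -> SU3 h -> SU3 (g *m h).
Proof.
by move=> [hg dg] [hh dh]; split; rewrite ?mul_unitarymx // det_mulmx dg dh mulr1.
Qed.
Lemma SU3_inv (g : M3) : SU3 g -> SU3 (invmx g).
Proof.
move=> [hg dg]; split; last by rewrite det_inv dg invr1.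
by have -> := invmx_unitary hg; have -> := trmxC_unitary g.
Qed.

Lemma cvg_id_within (A : set M3) (g : M3) : x @[x --> within A (nbhs g)] --> g.
Proof. exact: cvg_within. Qed.

Lemma cvg_nbhs_id (g : M3) : x @[x --> g] --> g.
Proof. by move=> U. Qed.

(** At a point of the closure, the neighbourhood filter restricted to the coincidence set is proper.
    The two functions agree along it, so their limits agree in a Hausdorff space. *)
Lemma closed_eq_fun (V : topologicalType) (f h : M3 -> V) : hausdorff_space V ->
  continuous f -> continuous h -> closed [set g | f g = h g].
Proof.
move=> hV cf ch g hg.
have hp : ProperFilter (within [set g | f g = h g] (nbhs g)) by apply/within_nbhs_proper.
apply: (@cvg_unique _ hV (f x @[x --> within [set g | f g = h g] (nbhs g)])).
  by apply: cvg_trans (cf g); apply: cvg_app; exact: cvg_within.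
apply: cvg_trans (_ : h x @[x --> within [set g | f g = h g] (nbhs g)] --> _).
  by apply: fmap_within_eq => x; rewrite inE /= => ->.
by apply: cvg_trans (ch g); apply: cvg_app; exact: cvg_within.
Qed.

Lemma SU3_closed : closed (@SU3 R).
Proof.
have -> : @SU3 R = [set g | g *m map_mx Num.conj g^T = 1%:M] `&`
   [set g | \det g = 1].
  apply/seteqP; split=> g /=; first by move=> [/unitarymxP h1 h2].
  by move=> [h1 h2]; split=> //; exact/unitarymxP.
apply: closedI; apply: closed_eq_fun => [|g|g].
- exact: (@norm_hausdorff C 'M[C]_3).
- apply: (@cvg_mulmx _ _ _ (nbhs_filter g) 3 3 3 (fun x => x) (fun x => map_mx Num.conj x^T)).
    exact: cvg_nbhs_id.
  apply: (@cvg_trmxC _ _ _ (nbhs_filter g) 3 3 (fun x => x)); exact: cvg_nbhs_id.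
- by apply: cst_continuous.
- exact: (@norm_hausdorff C C).
- by apply: (@cvg_det _ _ _ (nbhs_filter g) 3 (fun x => x)); exact: cvg_nbhs_id.
- by apply: cst_continuous.
Qed.

Lemma unitary_entry_le (n : nat) (g : 'M[C]_n) i j : g \is unitarymx -> abs (g i j) <= 1.
Proof.
move=> /unitarymxP /matrixP/(_ i i); rewrite !mxE eqxx mulr1n => h.
rewrite -(@ler_pXn2r _ 2) ?nnegrE ?abs_ge0 ?ler01 // expr1n.
have : \sum_k abs (g i k) ^+ 2 = 1.
  apply: ofreal_inj; rewrite ofreal_sum ofreal1 -h; apply: eq_bigr => k _.
  by rewrite !mxE mul_conj.
rewrite (bigD1 j) //= => <-; rewrite lerDl sumr_ge0 // => k _.
exact: sqr_ge0.
Qed.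

(** Heine-Borel is applied in R^18: [psi] lists the real and imaginary parts of the entries and
    [phi] is its inverse. Unitarity bounds every coordinate by 1, and SU(3) is the continuous image
    under [phi] of the resulting closed bounded set. *)
Lemma SU3_compact : compact (@SU3 R).
Proof.
pose phi (v : 'rV[R]_(3 * 3 + 3 * 3)) : M3 := \matrix_(i, j)
  (ofreal (v 0 (lshift _ (mxvec_index i j))) + iu R * ofreal (v 0 (rshift _ (mxvec_index i j)))).
pose psi (g : M3) : 'rV[R]_(3 * 3 + 3 * 3) :=
  row_mx (mxvec (\matrix_(i, j) re (g i j))) (mxvec (\matrix_(i, j) im (g i j))).
have phiK g : phi (psi g) = g.
  by apply/matrixP => i j; rewrite mxE row_mxEl row_mxEr !mxvecE !mxE -complexE.
have cphi : continuous phi.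
  move=> v; apply/(@cvg_mxP _ _ _ (nbhs_filter v)) => i j; rewrite !mxE; under eq_fun do rewrite !mxE.
  have cc k : (w 0 k : R) @[w --> v] --> v 0 k by exact: coord_continuous.
  apply: cvgC_add; first by apply: cvg_ofreal; exact: cc.
  by apply: cvgC_mul; [exact: cvg_cst|apply: cvg_ofreal; exact: cc].
have -> : @SU3 R = phi @` (psi @` (@SU3 R)).
  apply/seteqP; split=> g.
    by move=> hg; exists (psi g) => //; exists g.
  by move=> [_ [h hh <-] <-]; rewrite phiK.
apply: continuous_compact; first exact: continuous_subspaceT.
apply: bounded_closed_compact.
  exists 1; split; first exact: num_real.
  move=> x x1 _ [g [hg _] <-] /=; apply: (le_trans _ (ltW x1)).
  rewrite /Num.norm /= mx_normrE; apply/bigmax_leP; split => // -[i j] _ /=.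
  rewrite (ord1 i) mxE; case: split_ordP => k _; case/mxvec_indexP: k => a b;
    rewrite mxvecE mxE.
    by apply: le_trans (re_le_abs _) _; exact: unitary_entry_le.
  by apply: le_trans (im_le_abs _) _; exact: unitary_entry_le.
have -> : psi @` (@SU3 R) = phi @^-1` (@SU3 R).
  apply/seteqP; split=> v /=.
    by move=> [g hg <-]; rewrite phiK.
  move=> hv; exists (phi v) => //.
  apply/rowP => k; rewrite mxE; case: split_ordP => l ->;
   case/mxvec_indexP: l => a b; rewrite mxvecE !mxE.
    by rewrite reD reM /= mul0r mul1r subrr addr0.
  by rewrite imD imM /= mul0r mul1r !add0r.
by apply: preimage_closed => //; exact: SU3_closed.
Qed.

(** Continuity is asked relative to SU(3), because the values of a representation elsewhere are
    arbitrary. *)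
Definition contf (f : M3 -> C) : Prop :=
  forall g, SU3 g -> f x @[x --> within (@SU3 R) (nbhs g)] --> f g.

Global Instance within_filter_SU3 (g : M3) : Filter (within (@SU3 R) (nbhs g)).
Proof. exact: within_filter. Qed.

Lemma contf_cst (a : C) : contf (fun=> a).
Proof. by move=> g _; exact: cvg_cst. Qed.
Lemma contf_add f h : contf f -> contf h -> contf (fun g => f g + h g).
Proof. by move=> cf ch g hg; apply: cvgC_add; [exact: cf|exact: ch]. Qed.
Lemma contf_opp f : contf f -> contf (fun g => - f g).
Proof. by move=> cf g hg; apply: cvgC_opp; exact: cf. Qed.
Lemma contf_mul f h : contf f -> contf h -> contf (fun g => f g * h g).
Proof. by move=> cf ch g hg; apply: cvgC_mul; [exact: cf|exact: ch]. Qed.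
Lemma contf_conj f : contf f -> contf (fun g => (f g)^*%R).
Proof. by move=> cf g hg; apply: cvg_conj; exact: cf. Qed.
Lemma contf_sum (I : Type) (r : seq I) (P : pred I) (f : I -> M3 -> C) :
  (forall i, P i -> contf (f i)) -> contf (fun g => \sum_(i <- r | P i) f i g).
Proof. by move=> cf g hg; apply: cvgC_sum => i Pi; exact: cf. Qed.
Lemma contf_prod (I : Type) (r : seq I) (P : pred I) (f : I -> M3 -> C) :
  (forall i, P i -> contf (f i)) -> contf (fun g => \prod_(i <- r | P i) f i g).
Proof. by move=> cf g hg; apply: cvgC_prod => i Pi; exact: cf. Qed.
Lemma contf_entry i j : contf (fun g => g i j).
Proof.
by move=> g hg; have /cvg_mxP := @cvg_id_within (@SU3 R) g; exact.
Qed.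
Lemma contf_ext f h : (forall g, SU3 g -> f g = h g) -> contf f -> contf h.
Proof.
move=> e cf g hg; rewrite -e //; apply: cvg_trans (cf g hg).
by apply: fmap_within_eq => x; rewrite inE => /e ->.
Qed.
Lemma contf_translate f (h : M3) : SU3 h -> contf f -> contf (fun g => f (h *m g)).
Proof.
move=> hh cf g hg.
have c1 : (h *m x) @[x --> within (@SU3 R) (nbhs g)] --> within (@SU3 R) (nbhs (h *m g)).
  move=> U /= hU.
  have cm : (h *m x) @[x --> within (@SU3 R) (nbhs g)] --> h *m g.
    by apply: cvg_mulmx; [exact: cvg_cst|exact: cvg_id_within].
  have hU' : nbhs (h *m g) [set x | @SU3 R x -> U x] by [].
  have : within (@SU3 R) (nbhs g) [set x | @SU3 R x] by exact: withinT.
  have : within (@SU3 R) (nbhs g) [set x | @SU3 R (h *m x) -> U (h *m x)] by exact: (cm _ hU').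
  apply: filterS2 => x /= h1 h2; apply: h1; exact: SU3_mul.
apply: cvg_comp c1 _; exact: cf (SU3_mul hh hg).
Qed.

Lemma contf_bounded f : contf f -> exists2 M : R, 0 < M & forall g, SU3 g -> abs (f g) <= M.
Proof.
move=> cf.
have c : {within (@SU3 R), continuous (fun g => abs (f g))}.
  by apply/subspace_continuousP => g hg; apply: cvg_abs; exact: cf.
have [M [_ hM]] := compact_bounded (continuous_compact c SU3_compact).
exists (`|M| + 1) => [|g hg]; first by have := normr_ge0 M; lra.
have h1 : M < `|M| + 1 by have := ler_norm M; lra.
have := hM _ h1 (abs (f g)); rewrite /= ger0_norm ?abs_ge0 //; apply.
by exists g.
Qed.

End ContinuityOnSU3.

(** * Integration on SU(3) *)

(** Change of variables through the pushforward measure, which agrees with [mu] on the measurable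
    subsets of [D]. Since [f] is controlled only on [D], it is first extended by 0. *)
Lemma Rintegral_invariant d (T : measurableType d) (R : realType)
    (mu : {measure set T -> \bar R}) (D : set T) (phi : T -> T) (f : T -> R) :
  measurable D -> measurable_fun setT phi -> phi @^-1` D = D ->
  (forall A, measurable A -> A `<=` D -> mu (phi @^-1` A) = mu A) ->
  mu.-integrable D (EFin \o f) -> mu.-integrable D (EFin \o (f \o phi)) ->
  (\int[mu]_(x in D) f (phi x) = \int[mu]_(x in D) f x)%R.
Proof.
move=> mD mphi pre inv intf intfp; rewrite /Rintegral; congr fine.
pose F : T -> \bar R := (EFin \o f) \_ D.
have mF : measurable_fun setT F.
  by apply/(measurable_restrictT _ mD); apply: measurable_int intf.
have FD x : D x -> F x = (f x)%:E by move=> Dx; rewrite /F patchE ifT ?inE.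
have Fphi x : D x -> F (phi x) = (f (phi x))%:E.
  by move=> Dx; apply: FD; move: Dx; rewrite -{1}pre.
have iF : mu.-integrable (phi @^-1` D) (F \o phi).
  rewrite pre; apply: eq_integrable intfp => // x; rewrite inE => Dx.
  by rewrite /= Fphi.
have -> : (\int[mu]_(x in D) (f (phi x))%:E = \int[mu]_(x in phi @^-1` D) (F \o phi) x)%E.
  by rewrite pre; apply: eq_integral => x; rewrite inE => Dx; rewrite /= Fphi.
rewrite -(integral_pushforward mphi mF iF mD).
transitivity (\int[mu]_(x in D) F x)%E.
  by apply: eq_measure_integral => A mA AD; exact: inv.
by apply: eq_integral => x; rewrite inE => Dx; rewrite FD.
Qed.

Section HaarIntegral.
Variable R : realType.
Local Notation C := (CC R).
Local Notation M3 := 'M[C]_3.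
Variable m : {measure set (borelM3 R) -> \bar R}.
Hypothesis haar_m : haar m.
Local Notation G := (@SU3 R : set (borelM3 R)).

Lemma borel_open (A : set M3) : open A -> measurable (A : set (borelM3 R)).
Proof. exact: sub_sigma_algebra. Qed.

Lemma borel_closed (A : set M3) : closed A -> measurable (A : set (borelM3 R)).
Proof.
by move/closed_openC/borel_open/measurableC; rewrite setCK.
Qed.

Lemma measurable_SU3 : measurable G.
Proof. by apply: borel_closed; exact: SU3_closed. Qed.

Lemma continuous_borel_measurable (f : M3 -> R) :
  {within (@SU3 R), continuous f} -> measurable_fun G (f : borelM3 R -> R).
Proof.
move=> /continuousP cf; apply: (measurability _ (RGenOpens.measurableE R)).
move=> _ [_ [a [b ->] <-]].
have /open_subspaceP [V oV VD] := cf _ (@interval_open _ (BRight a) (BLeft b) isT isT).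
rewrite setIC; have -> : f @^-1` `]a, b[%classic `&` (@SU3 R) = V `&` (@SU3 R) by rewrite VD.
by apply: measurableI; [exact: borel_open|exact: measurable_SU3].
Qed.

Definition vol : R := fine (m G).

Lemma vol_gt0 : 0 < vol.
Proof. by rewrite /vol fine_gt0 //; case: haar_m. Qed.

Lemma vol_fin : (m G < +oo)%E.
Proof. by case: haar_m => /andP[]. Qed.

Lemma integrable_continuous (f : M3 -> R) :
  {within (@SU3 R), continuous f} -> m.-integrable G (EFin \o f).
Proof.
move=> cf; apply: measurable_bounded_integrable.
- exact: measurable_SU3.
- exact: vol_fin.
- exact: continuous_borel_measurable.
have /compact_bounded[M [_ mrt]] := continuous_compact cf (@SU3_compact R).
by exists M; split; rewrite ?num_real // => ? ? ? ?; exact: mrt.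
Qed.

Lemma left_mul_measurable (h : M3) :
  measurable_fun [set: borelM3 R] ((fun g => h *m g) : borelM3 R -> borelM3 R).
Proof.
apply: (@measurability _ _ (borelM3 R) (borelM3 R) _ _ (@open M3)) => //.
move=> _ [B oB <-]; rewrite setTI; apply: borel_open.
apply: open_comp => // g _.
by apply: (@cvg_mulmx _ _ _ (nbhs_filter g) 3 3 3 (fun=> h) (fun x => x));
  [exact: cvg_cst|exact: cvg_nbhs_id].
Qed.

(** [haar] speaks of images under translation; it is applied to the preimage B of A, whose image h B
    is A itself because h is invertible. *)
Lemma haar_preimage (h : M3) (A : set (borelM3 R)) : SU3 h -> measurable A ->
  A `<=` G -> m ((fun g => h *m g) @^-1` A) = m A.
Proof.
move=> hh mA AG; have mB : measurable ((fun g => h *m g) @^-1` A : set (borelM3 R)).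
  by rewrite -[X in measurable X]setTI; apply: left_mul_measurable.
have hu := SU3_unit hh.
rewrite -(proj2 haar_m h _ hh mB); first congr (m _).
  apply/seteqP; split=> x.
    by move=> [y /= hy <-].
  by move=> Ax; exists (invmx h *m x) => /=; rewrite ?mulmxA mulmxV ?mul1mx.
move=> x /= /AG hx.
have -> : x = invmx h *m (h *m x) by rewrite mulmxA mulVmx ?mul1mx.
by apply: SU3_mul hx; exact: SU3_inv.
Qed.

Lemma haar_integral_translate (h : M3) (f : M3 -> R) : SU3 h ->
  {within (@SU3 R), continuous f} ->
  (\int[m]_(g in G) f (h *m g))%R = (\int[m]_(g in G) f g)%R.
Proof.
move=> hh cf; have pre : (fun g : borelM3 R => h *m g) @^-1` G = G.
  apply/seteqP; split=> g /= hg; last exact: SU3_mul.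
  have -> : g = invmx h *m (h *m g) by rewrite mulmxA mulVmx ?mul1mx // SU3_unit.
  by apply: SU3_mul hg; exact: SU3_inv.
apply: (Rintegral_invariant measurable_SU3 (left_mul_measurable h) pre).
- by move=> A mA AG; exact: haar_preimage.
- exact: integrable_continuous.
apply: integrable_continuous; apply/subspace_continuousP => g hg.
have : contf (fun g => ofreal (f (h *m g))).
  apply: (@contf_translate _ (fun g => ofreal (f g))) => // x hx.
  by apply: cvg_ofreal; move/subspace_continuousP: cf; apply.
by move=> /(_ g hg) /cvg_re.
Qed.

(** The division by [vol] turns an arbitrary Haar measure into a probability; [EE] is the resulting
    expectation of complex functions. *)
Definition ERe (f : M3 -> R) : R := (\int[m]_(g in G) f g)%R / vol.
Definition EE (f : M3 -> C) : C := (ERe (fun g => re (f g)) +i* ERe (fun g => im (f g)))%C.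

Let contr (f : M3 -> R) := {within (@SU3 R), continuous f}.

Lemma contf_re f : contf f -> contr (fun g => re (f g)).
Proof. by move=> cf; apply/subspace_continuousP => g hg; apply: cvg_re; exact: cf. Qed.
Lemma contf_im f : contf f -> contr (fun g => im (f g)).
Proof. by move=> cf; apply/subspace_continuousP => g hg; apply: cvg_im; exact: cf. Qed.

Lemma EReD f h : contr f -> contr h -> ERe (fun g => f g + h g) = ERe f + ERe h.
Proof.
move=> cf ch; rewrite /ERe RintegralD ?mulrDl //.
- exact: measurable_SU3.
- exact: integrable_continuous.
- exact: integrable_continuous.
Qed.
Lemma EReZ (a : R) f : contr f -> ERe (fun g => a * f g) = a * ERe f.
Proof.
move=> cf; rewrite /ERe RintegralZl ?mulrA //.
- exact: measurable_SU3.
- exact: integrable_continuous.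
Qed.
Lemma ERe_cst (a : R) : ERe (fun=> a) = a.
Proof.
rewrite /ERe Rintegral_cst; first by rewrite mulfK // gt_eqF // vol_gt0.
exact: measurable_SU3.
Qed.
Lemma ERe_le f h : contr f -> contr h -> (forall g, SU3 g -> f g <= h g) ->
  ERe f <= ERe h.
Proof.
move=> cf ch fh; rewrite /ERe ler_pM2r ?invr_gt0 ?vol_gt0 //.
apply: le_Rintegral => //.
- exact: measurable_SU3.
- exact: integrable_continuous.
- exact: integrable_continuous.
Qed.
Lemma ERe_ext f h : (forall g, SU3 g -> f g = h g) -> ERe f = ERe h.
Proof.
by move=> e; rewrite /ERe; congr (_ / _); apply: eq_Rintegral => g; rewrite inE; exact: e.
Qed.

Lemma EE_ext f h : (forall g, SU3 g -> f g = h g) -> EE f = EE h.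
Proof.
by move=> e; rewrite /EE; congr (_ +i* _)%C; apply: ERe_ext => g hg; rewrite e.
Qed.
Lemma EE_cst (a : C) : EE (fun=> a) = a.
Proof. by rewrite /EE !ERe_cst; case: a. Qed.
Lemma EE_add f h : contf f -> contf h -> EE (fun g => f g + h g) = EE f + EE h.
Proof.
move=> cf ch; apply: complex_ext; rewrite ?reD ?imD /= -EReD;
  try exact: contf_re; try exact: contf_im;
  by apply: ERe_ext => g _; rewrite ?reD ?imD.
Qed.
Lemma contr_scale (a : R) f : contr f -> contr (fun g => a * f g).
Proof.
move=> /subspace_continuousP cf; apply/subspace_continuousP => g hg.
by apply: cvgM; [exact: cvg_cst|exact: cf].
Qed.
Lemma EE_scale (a : C) f : contf f -> EE (fun g => a * f g) = a * EE f.
Proof.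
move=> cf; have cr := contf_re cf; have ci := contf_im cf.
apply: complex_ext; rewrite ?reM ?imM /= -?EReZ //.
  rewrite -mulN1r -EReZ ?mulr1; last exact: contr_scale.
  rewrite -EReD; last 2 first.
  - exact: contr_scale.
  - by apply: contr_scale; exact: contr_scale.
  by apply: ERe_ext => g _; rewrite reM mulN1r.
rewrite -EReD; try exact: contr_scale.
by apply: ERe_ext => g _; rewrite imM.
Qed.
Lemma EE_sum (I : Type) (r : seq I) (P : pred I) (f : I -> M3 -> C) :
  (forall i, P i -> contf (f i)) ->
  EE (fun g => \sum_(i <- r | P i) f i g) = \sum_(i <- r | P i) EE (f i).
Proof.
move=> cf; elim: r => [|i r IH].
  rewrite big_nil -[RHS](EE_cst 0); apply: EE_ext => g _; by rewrite big_nil.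
rewrite big_cons -IH; case Pi : (P i).
  rewrite -EE_add; [|exact: cf|exact: contf_sum].
  by apply: EE_ext => g _; rewrite big_cons Pi.
by apply: EE_ext => g _; rewrite big_cons Pi.
Qed.
Lemma EE_translate (h : M3) f : SU3 h -> contf f -> EE (fun g => f (h *m g)) = EE f.
Proof.
move=> hh cf; rewrite /EE; congr (_ +i* _)%C; rewrite /ERe; congr (_ / _).
  exact: (haar_integral_translate hh (contf_re cf)).
exact: (haar_integral_translate hh (contf_im cf)).
Qed.
Lemma re_EE f : re (EE f) = ERe (fun g => re (f g)).
Proof. by []. Qed.
Lemma im_EE f : im (EE f) = ERe (fun g => im (f g)).
Proof. by []. Qed.
Lemma EE_conj f : contf f -> EE (fun g => (f g)^*%R) = ((EE f)^*)%R.
Proof.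
move=> cf; apply: complex_ext; rewrite ?re_conj ?im_conj ?re_EE ?im_EE.
  by apply: ERe_ext => g _; rewrite re_conj.
rewrite -mulN1r -EReZ; last exact: contf_im.
by apply: ERe_ext => g _; rewrite im_conj mulN1r.
Qed.

End HaarIntegral.

(** * Complete symmetric functions on SU(3) *)

Section RootsOfUnity.
Variable R : realType.
Local Notation C := (CC R).

Definition rou (N : nat) : C := cis (pi *+ 2 / N%:R).

Lemma abs_rou N : abs (rou N) = 1. Proof. exact: abs_cis. Qed.
Lemma rou_neq0 N : rou N != 0. Proof. exact: cis_neq0. Qed.

Lemma rou_exp N (k : int) : rou N ^ k = cis (pi *+ 2 * (k%:~R / N%:R)).
Proof. by rewrite /rou -cisMz -mulrzr mulrAC -mulrA. Qed.

Lemma rouN N : (0 < N)%N -> rou N ^+ N = 1.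
Proof.
by move=> N0; rewrite /rou -cisMn -[_ *+ N]mulr_natr divfK ?cis2pi // pnatr_eq0 -lt0n.
Qed.

Lemma rou_exp_eq1 N (k : int) : (0 < N)%N -> (rou N ^ k == 1) = (N%:Z %| k)%Z.
Proof.
move=> N0; apply/eqP/idP => [|/dvdzP[q ->]]; last first.
  by rewrite mulrC -exprz_exp -exprnP rouN // exp1rz.
rewrite rou_exp => /cis_eq1 [q e].
have N0' : N%:R != 0 :> R by rewrite pnatr_eq0 -lt0n.
have p0 : pi *+ 2 != 0 :> R by rewrite mulrn_eq0 /= gt_eqF // pi_gt0.
move: e; rewrite -[_ *~ q]mulrzr => /(mulfI p0) e.
have : k%:~R = (q * N)%:~R :> R by rewrite intrM -e divfK.
by move/intr_inj => ->; rewrite dvdz_mull.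
Qed.

Lemma sum_rou N (k : int) : (0 < N)%N ->
  \sum_(i < N) (rou N ^ k) ^+ i = if (N%:Z %| k)%Z then N%:R else 0.
Proof.
move=> N0; rewrite -rou_exp_eq1 //; case: eqP => [->|/eqP ne].
  by under eq_bigr do rewrite expr1n; rewrite sumr_const card_ord.
have := subrX1 (rou N ^ k) N.
rewrite exprnP exprz_exp mulrC -exprz_exp -exprnP rouN // exp1rz subrr => /esym/eqP.
by rewrite mulf_eq0 subr_eq0 (negbTE ne) /= => /eqP.
Qed.

Lemma sum_rou_ffun N r (e : 'I_r -> int) : (0 < N)%N ->
  \sum_(t : {ffun 'I_r -> 'I_N}) \prod_k (rou N ^ e k) ^+ t k =
  if [forall k, (N%:Z %| e k)%Z] then N%:R ^+ r else 0.
Proof.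
move=> N0; rewrite -(bigA_distr_bigA (fun k (i : 'I_N) => (rou N ^ e k) ^+ i)) /=.
under eq_bigr do rewrite sum_rou //.
case: forallP => [h|/forallP]; first by under eq_bigr do rewrite h; rewrite prodr_const card_ord.
rewrite negb_forall => /existsP[k nk].
by rewrite (bigD1 k) //= (negbTE nk) mul0r.
Qed.

End RootsOfUnity.

Section CompleteSymmetric.
Variable R : realType.
Local Notation C := (CC R).
Local Notation M3 := 'M[C]_3.

Section Words.
Variable a : nat.
Local Notation W := {ffun 'I_a -> 'I_3}.
Implicit Types (i j l : W) (g h : M3).

Definition content j (t : 'I_3) : nat := \sum_(k | j k == t) 1.
Definition anagram i j := [forall t, content i t == content j t].
Definition anagrams j : nat := #|[pred i | anagram i j]|.
(** This is the entry of the [a]-fold tensor power of g at two basis words. Summing it over the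
    anagrams of j, as [wblock] does, gives the entry of the symmetric power of g in the basis of
    monomials. *)
Definition wprod g i j : C := \prod_k g (i k) (j k).
Definition wblock g j l : C := \sum_(i | anagram i j) wprod g i l.
(* The trace of [g] on the symmetric power of degree [a], as a sum over words instead
   of monomials: each class of anagrams is counted once thanks to the weights. *)
Definition hsym g : C := \sum_j (anagrams j)%:R^-1 * wblock g j j.

Lemma anagram_refl i : anagram i i. Proof. by apply/forallP. Qed.
Lemma anagram_sym i j : anagram i j = anagram j i.
Proof. by apply: eq_forallb => t; rewrite eq_sym. Qed.
Lemma anagram_eql i j l : anagram i j -> anagram i l = anagram j l.
Proof. by move=> /forallP h; apply: eq_forallb => t; rewrite (eqP (h t)). Qed.

Lemma anagramP i j : anagram i j -> exists s : {perm 'I_a}, forall k, j k = i (s k).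
Proof.
move=> /forallP h.
have : perm_eq [tuple j k | k < a] [tuple i k | k < a].
  apply/allP => t _ /=; have := h t; rewrite /content.
  suff e (u : W) : count_mem t [tuple u k | k < a] = (\sum_(k | u k == t) 1)%N.
    by rewrite !e eq_sym.
  by rewrite -sum1_count big_map big_enum_cond.
move/tuple_permP => [s /val_inj hs]; exists s => k.
by have := congr1 (fun u => tnth u k) hs; rewrite !tnth_mktuple.
Qed.

Lemma anagrams_eq j l : anagram j l -> anagrams j = anagrams l.
Proof.
move=> h; apply: eq_card => i; rewrite !inE.
by rewrite ![anagram i _]anagram_sym (anagram_eql i h).
Qed.
Lemma anagrams_neq0 j : (anagrams j)%:R != 0 :> C.
Proof.
by rewrite pnatr_eq0 -lt0n; apply/card_gt0P; exists j; rewrite inE anagram_refl.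
Qed.

(** Permuting the positions of both words at once leaves [wprod] unchanged and permutes the anagrams
    of j among themselves. *)
Lemma wblock_anagram g j l l' : anagram l l' -> wblock g j l = wblock g j l'.
Proof.
move=> /anagramP [s hs]; rewrite /wblock.
pose act (u : W) : W := [ffun k => u (s k)].
have act_inj : injective act.
  move=> u v /ffunP e; apply/ffunP => k.
  by have := e (s^-1%g k); rewrite !ffunE permKV.
have anag u : anagram (act u) j = anagram u j.
  apply: anagram_eql; apply/forallP => t; apply/eqP; rewrite /content.
  rewrite [RHS](reindex_inj (@perm_inj _ s)) /=; apply: eq_bigl => k.
  by rewrite ffunE.
rewrite [RHS](reindex_inj act_inj) /=.
apply: eq_big => [u|u _]; first by rewrite anag.
rewrite /wprod [LHS](reindex_inj (@perm_inj _ s)) /=.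
by apply: eq_bigr => k _; rewrite ffunE hs.
Qed.

Lemma wprod_mul g h i j : wprod (g *m h) i j = \sum_l wprod g i l * wprod h l j.
Proof.
rewrite /wprod.
under eq_bigr do rewrite mxE.
rewrite (bigA_distr_bigA (fun (k : 'I_a) (s : 'I_3) => g (i k) s * h s (j k))) /=.
by apply: eq_bigr => l _; rewrite big_split.
Qed.

(** The intermediate word l may be replaced by the average over its anagrams, because [wblock g j l]
    depends only on the class of l; this turns [wprod h l j] into [wblock h l j]. The outcome is
    symmetric in g and h up to exchanging j and l, whence the trace property [hsym_mulC] and
    invariance under conjugation. *)
Lemma hsym_mul g h : hsym (g *m h) =
  \sum_j \sum_l (anagrams j)%:R^-1 * (anagrams l)%:R^-1 * (wblock g j l * wblock h l j).
Proof.
transitivity (\sum_j \sum_l (anagrams j)%:R^-1 * (wblock g j l * wprod h l j)).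
  apply: eq_bigr => j _; rewrite -mulr_sumr; congr (_ * _).
  rewrite /wblock; under eq_bigr do rewrite wprod_mul.
  by rewrite exchange_big /=; apply: eq_bigr => l _; rewrite mulr_suml.
apply: eq_bigr => j _.
transitivity (\sum_l \sum_(l' | anagram l' l)
   (anagrams j)%:R^-1 * (anagrams l)%:R^-1 * (wblock g j l * wprod h l' j)); last first.
  by apply: eq_bigr => l _; rewrite /wblock mulr_sumr mulr_sumr.
rewrite (exchange_big_dep xpredT) //=; apply: eq_bigr => l _.
transitivity (\sum_(l' | anagram l l')
   (anagrams j)%:R^-1 * (anagrams l)%:R^-1 * (wblock g j l * wprod h l j)).
  rewrite sumr_const -mulr_natr.
  have -> : #|[pred l' | anagram l l']| = anagrams l.
    by apply: eq_card => u; rewrite !inE anagram_sym.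
  by field; rewrite !anagrams_neq0.
apply: eq_bigr => l' hl; rewrite (wblock_anagram _ _ hl) (anagrams_eq hl) //.
Qed.

Lemma hsym_mulC g h : hsym (g *m h) = hsym (h *m g).
Proof.
rewrite !hsym_mul exchange_big /=; apply: eq_bigr => j _; apply: eq_bigr => l _.
by rewrite [X in X * _]mulrC [X in _ * X]mulrC.
Qed.

Lemma hsym_contf : contf hsym.
Proof.
apply: contf_sum => j _; apply: contf_mul; first exact: contf_cst.
apply: contf_sum => i _; apply: contf_prod => k _; exact: contf_entry.
Qed.


Lemma hsym_conjugate (u g : M3) : u \in unitmx -> hsym (u *m g *m invmx u) = hsym g.
Proof. by move=> hu; rewrite hsym_mulC mulmxA mulVmx // mul1mx. Qed.

Lemma content_sum j : (\sum_t content j t)%N = a.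
Proof.
rewrite /content -[RHS]card_ord -sum1_card.
rewrite (partition_big j xpredT) //=.
Qed.

Lemma content_ex (e : 'I_3 -> nat) : (\sum_t e t)%N = a ->
  exists j : W, forall t, content j t = e t.
Proof.
move=> he.
pose s := flatten [seq nseq (e t) t | t <- enum 'I_3].
have ss : size s = a.
  rewrite size_flatten /shape -map_comp -he sumnE big_map big_enum /=.
  by apply: eq_bigr => t _; rewrite size_nseq.
exists [ffun k : 'I_a => nth ord0 s k] => t.
rewrite /content.
under eq_bigl do rewrite ffunE.
have -> : (\sum_(k < a | nth ord0 s k == t) 1 = count_mem t s)%N.
  rewrite -sum1_count (big_nth ord0) big_mkord ss; by [].
rewrite count_flatten -map_comp sumnE big_map big_enum /=.
rewrite (bigD1 t) //= big1 ?addn0 => [|t' ne]; first by rewrite count_nseq /= eqxx mul1n.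
by rewrite count_nseq /= (negbTE ne).
Qed.

Lemma wprod_diag (z : 'rV[C]_3) i j :
  wprod (diag_mx z) i j = if i == j then \prod_t z 0 t ^+ content j t else 0.
Proof.
rewrite /wprod; case: eqP => [->|ne].
  under eq_bigr do rewrite mxE eqxx mulr1n.
  rewrite (partition_big j xpredT) //=; apply: eq_bigr => t _.
  rewrite /content sum1_card -prodr_const; apply: eq_big => [k|k /eqP -> //].
  by rewrite unfold_in.
have /existsP[k hk] : [exists k, i k != j k].
  by rewrite -negb_forall; apply/negP => /forallP h; apply: ne; apply/ffunP => k; apply/eqP.
by rewrite (bigD1 k) //= mxE (negbTE hk) mulr0n mul0r.
Qed.

(** Generating function of the complete symmetric functions. The geometric series are truncated
    after degree [a], which does not affect the coefficient of degree [a]. On a diagonal matrix only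
    equal words contribute, and the words with a given content make up one monomial. *)
Lemma hsym_diag_poly (z : 'rV[C]_3) :
  hsym (diag_mx z) = (\prod_t \sum_(i < a.+1) (z 0 t *: 'X) ^+ i)`_a.
Proof.
rewrite (bigA_distr_bigA (fun (t : 'I_3) (i : 'I_a.+1) => (z 0 t *: 'X : {poly C}) ^+ i)) /=.
rewrite coef_sum.
have cf (m : {ffun 'I_3 -> 'I_a.+1}) : (\prod_t (z 0 t *: 'X) ^+ m t)`_a =
    if (\sum_t m t)%N == a then \prod_t z 0 t ^+ m t else 0.
  have -> : \prod_t (z 0 t *: 'X) ^+ m t = (\prod_t z 0 t ^+ m t) *: 'X^(\sum_t m t)%N :> {poly C}.
    rewrite expr_sum -scaler_prod; apply: eq_bigr => t _; by rewrite exprZn.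
  by rewrite coefZ coefXn eq_sym; case: eqP; rewrite ?mulr1 ?mulr0.
under eq_bigr do rewrite cf.
rewrite -big_mkcond /=.
pose ct j : {ffun 'I_3 -> 'I_a.+1} := [ffun t => inord (content j t)].
have ctE j t : ct j t = content j t :> nat.
  rewrite ffunE inordK // ltnS; have := content_sum j; rewrite (bigD1 t) //=; lia.
have ct_an i j : (ct i == ct j) = anagram i j.
  apply/eqP/forallP => [e t|e].
    by rewrite -!ctE e.
  by apply/ffunP => t; apply: val_inj; rewrite /= !ctE; apply/eqP.
rewrite /hsym.
transitivity (\sum_j (anagrams j)%:R^-1 * \prod_t z 0 t ^+ content j t : C).
  apply: eq_bigr => j _; congr (_ * _); rewrite /wblock.
  under [LHS]eq_bigr do rewrite wprod_diag.
  by rewrite (bigD1 j) ?anagram_refl //= eqxx [X in _ + X]big1 ?addr0 // => i /andP[_ /negbTE ->].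
rewrite (partition_big ct (fun m : {ffun 'I_3 -> 'I_a.+1} => (\sum_t m t)%N == a)) /=; last first.
  by move=> j _; under eq_bigr do rewrite ctE; rewrite content_sum.
apply: eq_bigr => m /eqP hm.
have [j0 hj0] := content_ex hm.
have ctm : m = ct j0 by apply/ffunP => t; apply: val_inj; rewrite /= ctE hj0.
rewrite ctm.
under eq_bigl do rewrite ct_an.
under [RHS]eq_bigr do rewrite ctE.
transitivity (\sum_(j | anagram j j0) (anagrams j0)%:R^-1 * \prod_t z 0 t ^+ content j0 t : C).
  apply: eq_bigr => j hj; rewrite (anagrams_eq hj); congr (_ * _).
  by apply: eq_bigr => t _; move/forallP/(_ t)/eqP: hj => ->.
by rewrite sumr_const -[LHS]mulr_natr [LHS]mulrC mulrA (mulfV (anagrams_neq0 j0)) mul1r.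
Qed.

Definition dg3 (x y w : C) : M3 :=
  diag_mx (\row_(i < 3) (if i == 0 :> nat then x else if i == 1%N :> nat then y else w)).

(** The coefficients of the product of the first two geometric series telescope against x - y,
    leaving [S x - S y]. Each [S z] is again a geometric sum in z and w, and telescopes against z -
    w. *)
Lemma hsym_diag (x y w : C) :
  hsym (dg3 x y w) * ((x - y) * (x - w) * (y - w)) =
  x ^+ a.+2 * (y - w) - y ^+ a.+2 * (x - w) + w ^+ a.+2 * (x - y).
Proof.
have geo (z : C) k : (k <= a)%N -> (\sum_(i < a.+1) (z *: 'X) ^+ i : {poly C})`_k = z ^+ k.
  move=> ka; rewrite coef_sum (bigD1 (inord k)) //= inordK ?ltnS //.
  rewrite exprZn coefZ coefXn eqxx mulr1 big1 ?addr0 // => i ne.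
  rewrite exprZn coefZ coefXn; case: eqP => [e|]; rewrite ?mulr0 //.
  by case/negP: ne; apply/eqP/val_inj; rewrite /= inordK ?ltnS.
have xy (k : 'I_a.+1) : ((\sum_(i < a.+1) (x *: 'X) ^+ i) * (\sum_(i < a.+1) (y *: 'X) ^+ i) : {poly C})`_k * (x - y)
   = x ^+ k.+1 - y ^+ k.+1.
  rewrite coefM subrXX mulrC; congr (_ * _); rewrite [LHS](reindex_inj rev_ord_inj) /=.
  apply: eq_bigr => i _; have i1 := ltn_ord i; have k1 := ltn_ord k.
  by rewrite !geo; [congr (_ ^+ _ * _ ^+ _) | |]; lia.
have xw (z : C) : \sum_(k < a.+1) z ^+ k.+1 * w ^+ (a - k) * (z - w) = z * (z ^+ a.+1 - w ^+ a.+1).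
  rewrite subrXX mulr_sumr mulr_sumr [RHS](reindex_inj rev_ord_inj) /=.
  apply: eq_bigr => i _; have i1 := ltn_ord i.
  rewrite exprS (_ : a.+1.-1 - (a.+1 - i.+1) = i)%N; last lia.
  by rewrite (_ : a.+1 - i.+1 = a - i)%N; [ring|lia].
have prod3 (F : 'I_3 -> {poly C}) : \prod_t F t = F 0 * F (lift 0 0) * F (lift 0 (lift 0 0)).
  by rewrite !big_ord_recl big_ord0 mulr1 mulrA.
rewrite hsym_diag_poly prod3 !mxE /= coefM.
pose S (z : C) := \sum_(k < a.+1) z ^+ k.+1 * w ^+ (a - k).
have SE (z : C) : S z * (z - w) = z * (z ^+ a.+1 - w ^+ a.+1) by rewrite mulr_suml xw.
set L := (X in X * _ = _).
have eL : L * (x - y) = S x - S y.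
  rewrite -sumrB mulr_suml; apply: eq_bigr => k _.
  by rewrite mulrAC xy geo ?leq_subr // mulrBl.
transitivity (S x * (x - w) * (y - w) - S y * (y - w) * (x - w)).
  by rewrite mulrA mulrA eL; ring.
by rewrite !SE !exprS; ring.
Qed.

End Words.
End CompleteSymmetric.

(** * Haar integrals of products of two complete symmetric functions *)

Section VanishingIntegrals.
Variable R : realType.
Local Notation C := (CC R).
Local Notation M3 := 'M[C]_3.
Local Notation "M ^t*" := (map_mx Num.conj M^T) (at level 30).

Lemma unitary_diag (n : nat) (z : 'rV[C]_n) :
  (forall i, abs (z 0 i) = 1) -> diag_mx z \is unitarymx.
Proof.
move=> h; apply/unitarymxP; rewrite tr_diag_mx map_diag_mx mulmx_diag.
rewrite -diag_const_mx; congr diag_mx; apply/rowP => i; rewrite !mxE.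
by rewrite mul_conj h expr1n.
Qed.

(* [x^* x + y^* y] is Hermitian of rank at most 2; in an eigenbasis, [x] and
   [y] have no component along a null eigenvector, so rescaling the other two
   directions by [z] acts on [x] and [y] as the scalar [z]. *)
Lemma common_scaling (x y : 'rV[C]_3) (z : C) : abs z = 1 ->
  exists h : M3, [/\ SU3 h, x *m h = z *: x & y *m h = z *: y].
Proof.
move=> hz; pose A := x ^t* *m x + y ^t* *m y.
have hermA : A \is normalmx.
  apply: hermitian_normalmx; apply/is_hermitianmxP; rewrite expr0 scale1r.
  have dag (v : 'rV[C]_3) : (v^t* *m v)^t* = v^t* *m v.
    by rewrite trmx_mul map_mxM /= trmxCK.
  by rewrite /A linearD /= map_mxD !dag.
have [[U d] /= hU eA] := orthomx_spectral_subproof hermA.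
have Uu := unitarymx_unit hU.
have iU : invmx U = U ^t* by exact: invmx_unitary.
have detA : \det A = 0.
  apply/eqP; rewrite -[_ == 0]negbK -unitfE -unitmxE -row_full_unit /row_full.
  have -> : A = row_mx (x ^t*) (y ^t*) *m col_mx x y by rewrite mul_row_col.
  have := leq_trans (mxrankM_maxr (row_mx (x ^t*) (y ^t*)) (col_mx x y)) (rank_leq_row _).
  by move=> h; apply/negP => /eqP e; rewrite e in h.
have /eqP/prodf_eq0[k _ /eqP dk] : \prod_i d 0 i = 0.
  by rewrite -det_diag; move: detA; rewrite eA !det_mulmx det_inv mulrAC mulVf ?mul1r // -unitfE -unitmxE.
have eD : U *m A *m U ^t* = diag_mx d.
  by rewrite eA -iU !mulmxA mulmxV // mul1mx -mulmxA mulmxV // mulmx1.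
have comp0 : (x *m U^t*) 0 k = 0 /\ (y *m U^t*) 0 k = 0.
  have := congr1 (fun B : M3 => B k k) eD; rewrite [RHS]mxE eqxx dk mul0rn.
  have form (v : 'rV[C]_3) : (U *m (v^t* *m v) *m U^t*) k k = ofreal (abs ((v *m U^t*) 0 k) ^+ 2).
    rewrite -mul_conj mulrC; have -> : U *m (v^t* *m v) *m U^t* = (v *m U^t*)^t* *m (v *m U^t*).
      by rewrite trmx_mul map_mxM /= trmxCK !mulmxA.
    by rewrite mxE big_ord1 !mxE.
  rewrite /A mulmxDr mulmxDl mxE !form -ofrealD -ofreal0 => /ofreal_inj /eqP.
  rewrite paddr_eq0 ?sqr_ge0 // !sqrf_eq0 !abs_eq0 => /andP[/eqP h1 /eqP h2].
  by split.
pose e : 'rV[C]_3 := \row_i (if i == k then z ^- 2 else z).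
have z0 : z != 0 by rewrite -abs_gt0 hz.
have he i : abs (e 0 i) = 1.
  by rewrite mxE; case: ifP => _ //; rewrite absV absX hz expr1n invr1.
exists (U^t* *m diag_mx e *m U).
have act (v : 'rV[C]_3) : (v *m U^t*) 0 k = 0 -> v *m (U^t* *m diag_mx e *m U) = z *: v.
  move=> hk; rewrite !mulmxA.
  have -> : v *m U^t* *m diag_mx e = z *: (v *m U^t*).
    move: (v *m U^t*) hk => W hk; apply/rowP => i; rewrite mul_mx_diag !mxE.
    by case: eqP => [->|_]; rewrite ?hk ?mul0r ?mulr0 // mulrC.
  by rewrite -scalemxAl -mulmxA -iU mulVmx // mulmx1.
split; [split|exact: act comp0.1|exact: act comp0.2].
  have hU' : U^t* \is unitarymx by have -> := trmxC_unitary U.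
  exact: (mul_unitarymx (mul_unitarymx hU' (unitary_diag he)) hU).
rewrite -iU !det_mulmx det_inv mulrAC mulVf ?mul1r; last by rewrite -unitfE -unitmxE.
rewrite det_diag (bigD1 k) //= mxE eqxx.
rewrite (eq_bigr (fun=> z)) => [|i /negbTE ne]; last by rewrite mxE ne.
rewrite prodr_const.
have -> : #|[pred i : 'I_3 | i != k]| = 2%N.
  have := cardC (pred1 k); rewrite card1 card_ord add1n => -[e2]; rewrite -[RHS]e2.
  by apply: eq_card => i; rewrite !inE.
by rewrite mulVf // expf_neq0.
Qed.

Variable m : {measure set (borelM3 R) -> \bar R}.
Hypothesis haar_m : haar m.
Local Notation EE := (EE m).

(** A translation that acts on both rows as the scalar z multiplies the integrand by z^(a+b).
    Choosing z with z^(a+b) = -1 makes the integral equal to its opposite. *)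
Lemma integral_row_words (a b : nat) (x y : 'rV[C]_3)
    (j : {ffun 'I_a -> 'I_3}) (l : {ffun 'I_b -> 'I_3}) : (0 < a + b)%N ->
  EE (fun g => \prod_k (x *m g) 0 (j k) * \prod_k (y *m g) 0 (l k)) = 0.
Proof.
move=> ab.
pose z : C := cis (pi / (a + b)%:R).
have hz : abs z = 1 := abs_cis _.
have [h [hh hx hy]] := common_scaling x y hz.
set f := (fun g => _).
have crow (v : 'rV[C]_3) i : contf (fun g => (v *m g) 0 i).
  apply: (@contf_ext _ (fun g => \sum_s v 0 s * g s i)) => [g _|]; first by rewrite mxE.
  by apply: contf_sum => s _; apply: contf_mul; [exact: contf_cst|exact: contf_entry].
have cf : contf f.
  by apply: contf_mul; apply: contf_prod => k _; exact: crow.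
have := EE_translate haar_m hh cf.
have -> : EE (fun g => f (h *m g)) = EE (fun g => z ^+ (a + b) * f g).
  apply: EE_ext => g _; rewrite /f !mulmxA hx hy.
  have sc (n : nat) (v : 'rV[C]_3) (w : {ffun 'I_n -> 'I_3}) :
     \prod_k ((z *: v) *m g) 0 (w k) = z ^+ n * \prod_k (v *m g) 0 (w k).
    rewrite -[n in z ^+ n]card_ord -prodr_const -big_split /=.
    by apply: eq_bigr => k _; rewrite -scalemxAl mxE.
  by rewrite !sc exprD; ring.
rewrite (EE_scale haar_m) //.
have -> : z ^+ (a + b) = -1.
  rewrite -cisMn -[_ *+ (a + b)]mulr_natr divfK ?pnatr_eq0 -?lt0n //.
  by rewrite /cis cospi sinpi; apply: complex_ext => //=; rewrite oppr0.
rewrite mulN1r => e; have : EE f *+ 2 = 0 by rewrite mulr2n -{1}e addNr.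
by move/eqP; rewrite mulrn_eq0 /= => /eqP.
Qed.

(** Fourier inversion over the diagonal matrices of N-th roots of unity: averaging over the
    exponents t against the inverse monomial of j keeps only the words i with content congruent to
    that of j modulo N. Contents are at most a < N, so congruence is equality and the anagrams of j
    are recovered. What matters is the form of the result: each summand involves a single row times
    g. *)
Lemma hsym_rows (a N : nat) (g : M3) : (a < N)%N ->
  hsym a g = \sum_(j : {ffun 'I_a -> 'I_3}) \sum_(t : {ffun 'I_3 -> 'I_N})
     ((anagrams j)%:R^-1 * N%:R ^- 3 * \prod_k (rou R N ^- t (j k))) *
     \prod_k ((\row_s (rou R N ^+ t s)) *m g) 0 (j k).
Proof.
move=> aN; have N0 : (0 < N)%N by exact: leq_ltn_trans aN.
apply: eq_bigr => j _.
rewrite /wblock big_mkcond /=.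
transitivity (\sum_(i : {ffun 'I_a -> 'I_3}) \sum_(t : {ffun 'I_3 -> 'I_N}) (anagrams j)%:R^-1 * N%:R ^- 3 *
   ((\prod_k (rou R N ^- t (j k)) * \prod_k (rou R N ^+ t (i k))) * wprod g i j)).
  rewrite mulr_sumr; apply: eq_bigr => i _.
  rewrite -mulr_sumr -mulr_suml.
  have -> : \sum_(t : {ffun 'I_3 -> 'I_N}) \prod_k (rou R N ^- t (j k)) * \prod_k (rou R N ^+ t (i k))
     = \sum_(t : {ffun 'I_3 -> 'I_N}) \prod_s (rou R N ^ ((content i s)%:Z - (content j s)%:Z)) ^+ t s.
    have grp (u : {ffun 'I_a -> 'I_3}) (F : 'I_3 -> C) : \prod_k F (u k) = \prod_s F s ^+ content u s.
      rewrite (partition_big u xpredT) //=; apply: eq_bigr => s _.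
      rewrite /content sum1_card -prodr_const; apply: eq_big => [k|k /eqP -> //].
      by rewrite unfold_in.
    apply: eq_bigr => t _.
    rewrite (grp j (fun s => rou R N ^- t s)) (grp i (fun s => rou R N ^+ t s)) -big_split /=.
    apply: eq_bigr => s _.
    by rewrite expfzDr ?rou_neq0 // -exprnP -exprnN exprMn !exprVn -!exprM mulrC ![(_ * t s)%N]mulnC.
  rewrite sum_rou_ffun //.
  have -> : [forall s, (N%:Z %| (content i s)%:Z - (content j s)%:Z)%Z] = anagram i j.
    apply: eq_forallb => s.
    have cb (u : {ffun 'I_a -> 'I_3}) : (content u s < N)%N.
      by apply: leq_ltn_trans aN; have := content_sum u; rewrite (bigD1 s) //=; lia.
    apply/idP/eqP => [|->]; last by rewrite subrr dvdz0.
    by rewrite -eqz_mod_dvd !modz_nat !modn_small // => /eqP[].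
  case: ifP => _; last by rewrite mul0r !mulr0.
  by rewrite -mulrA mulKf // expf_neq0 // pnatr_eq0 -lt0n.
rewrite exchange_big /=; apply: eq_bigr => t _.
rewrite -mulr_sumr -!mulrA; congr (_ * (_ * _)).
under [LHS]eq_bigr do rewrite -mulrA.
rewrite -mulr_sumr; congr (_ * _).
under [RHS]eq_bigr do rewrite mxE.
rewrite (bigA_distr_bigA (fun (k : 'I_a) (s : 'I_3) => (\row_s (rou R N ^+ t s)) 0 s * g s (j k))) /=.
apply: eq_bigr => i _; rewrite big_split /=; congr (_ * _).
by apply: eq_bigr => k _; rewrite mxE.
Qed.

Lemma integral_hsym (a b : nat) : (0 < a + b)%N ->
  EE (fun g => hsym a g * hsym b g) = 0.
Proof.
move=> ab; pose N := (a + b).+1.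
have aN : (a < N)%N by rewrite ltnS leq_addr.
have bN : (b < N)%N by rewrite ltnS leq_addl.
have crow (v : 'rV[C]_3) i : contf (fun g => (v *m g) 0 i).
  apply: (@contf_ext _ (fun g => \sum_s v 0 s * g s i)) => [g _|]; first by rewrite mxE.
  by apply: contf_sum => s _; apply: contf_mul; [exact: contf_cst|exact: contf_entry].
pose f (j : {ffun 'I_a -> 'I_3}) (t : {ffun 'I_3 -> 'I_N}) (l : {ffun 'I_b -> 'I_3}) (u : {ffun 'I_3 -> 'I_N}) (g : M3) : C :=
  \prod_k ((\row_s (rou R N ^+ t s)) *m g) 0 (j k) * \prod_k ((\row_s (rou R N ^+ u s)) *m g) 0 (l k).
pose c (n : nat) (j : {ffun 'I_n -> 'I_3}) (t : {ffun 'I_3 -> 'I_N}) : C :=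
  (anagrams j)%:R^-1 * N%:R ^- 3 * \prod_k (rou R N ^- t (j k)).
have cf j t l u : contf (f j t l u).
  by apply: contf_mul; apply: contf_prod => k _; exact: crow.
transitivity (EE (fun g => \sum_j \sum_t \sum_l \sum_u c a j t * c b l u * f j t l u g)).
  apply: EE_ext => g _; rewrite (hsym_rows g aN) (hsym_rows g bN).
  rewrite mulr_suml; apply: eq_bigr => j _; rewrite mulr_suml; apply: eq_bigr => t _.
  rewrite mulr_sumr; apply: eq_bigr => l _; rewrite mulr_sumr; apply: eq_bigr => u _.
  by rewrite mulrACA.
have cs j t l u : contf (fun g => c a j t * c b l u * f j t l u g).
  by apply: contf_mul => //; exact: contf_cst.
rewrite (EE_sum haar_m) => [|j _]; last by do 3 (apply: contf_sum => ? _).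
rewrite big1 // => j _.
rewrite (EE_sum haar_m) => [|t _]; last by do 2 (apply: contf_sum => ? _).
rewrite big1 // => t _.
rewrite (EE_sum haar_m) => [|l _]; last by apply: contf_sum => ? _.
rewrite big1 // => l _.
rewrite (EE_sum haar_m) => [|//].
rewrite big1 // => u _.
by rewrite (EE_scale haar_m) // integral_row_words // mulr0.
Qed.

End VanishingIntegrals.

(** * Averages over torsion points of the torus *)

Section Alternants.
Variable R : realType.
Local Notation C := (CC R).
Implicit Types (x y w : C) (a b c : int).

Definition mono a b c x y w : C := x ^ a * y ^ b * w ^ c.
Definition alternant a b c x y w : C :=
  mono a b c x y w - mono b a c x y w - mono a c b x y w - mono c b a x y w
  + mono b c a x y w + mono c a b x y w.
Definition vdm x y w : C := (x - y) * (x - w) * (y - w).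

Definition torus3 x y w : Prop :=
  [/\ abs x = 1, abs y = 1, abs w = 1 & x * y * w = 1].

Lemma abs1_neq0 x : abs x = 1 -> x != 0.
Proof. by move=> h; rewrite -abs_gt0 h. Qed.

Lemma torus3_swap12 x y w : torus3 x y w -> torus3 y x w.
Proof. by case=> h1 h2 h3 h4; split=> //; rewrite -h4; ring. Qed.
Lemma torus3_swap23 x y w : torus3 x y w -> torus3 x w y.
Proof. by case=> h1 h2 h3 h4; split=> //; rewrite -h4; ring. Qed.

Lemma vdm_alternant x y w : vdm x y w = alternant 2 1 0 x y w.
Proof.
by rewrite /vdm /alternant /mono -!exprnP !expr0 !expr1 !expr2; ring.
Qed.

Lemma mono_shift a b c (k : int) x y w : torus3 x y w ->
  mono (a + k) (b + k) (c + k) x y w = mono a b c x y w.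
Proof.
case=> /abs1_neq0 x0 /abs1_neq0 y0 /abs1_neq0 w0 h.
rewrite /mono !expfzDr //.
transitivity (x ^ a * y ^ b * w ^ c * (x * y * w) ^ k).
  by rewrite !exprMz_comm ?unitfE ?mulf_neq0 //; [ring| exact: mulrC | exact: mulrC].
by rewrite h exp1rz mulr1.
Qed.

Lemma alternant_shift a b c (k : int) x y w : torus3 x y w ->
  alternant (a + k) (b + k) (c + k) x y w = alternant a b c x y w.
Proof. by move=> h; rewrite /alternant !mono_shift. Qed.

Lemma alternant_swap12 a b c x y w : alternant b a c x y w = - alternant a b c x y w.
Proof. by rewrite /alternant; ring. Qed.
Lemma alternant_swap23 a b c x y w : alternant a c b x y w = - alternant a b c x y w.
Proof. by rewrite /alternant; ring. Qed.

Lemma alternant_arg12 a b c x y w : alternant a b c y x w = - alternant a b c x y w.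
Proof.
rewrite /alternant /mono.
by move: (x ^ a) (x ^ b) (x ^ c) (y ^ a) (y ^ b) (y ^ c) (w ^ a) (w ^ b) (w ^ c) => *; ring.
Qed.
Lemma alternant_arg23 a b c x y w : alternant a b c x w y = - alternant a b c x y w.
Proof.
rewrite /alternant /mono.
by move: (x ^ a) (x ^ b) (x ^ c) (y ^ a) (y ^ b) (y ^ c) (w ^ a) (w ^ b) (w ^ c) => *; ring.
Qed.

Lemma mono_mul a b c a' b' c' x y w : torus3 x y w ->
  mono a b c x y w * mono a' b' c' x y w = mono (a + a') (b + b') (c + c') x y w.
Proof.
case=> /abs1_neq0 x0 /abs1_neq0 y0 /abs1_neq0 w0 h.
by rewrite /mono !expfzDr //; ring.
Qed.

Lemma mono_conj a b c x y w : torus3 x y w ->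
  ((mono a b c x y w)^*)%R = mono (- a) (- b) (- c) x y w.
Proof.
case=> hx hy hw h; rewrite /mono !rmorphM /=.
have cz (z : C) (k : int) : abs z = 1 -> ((z ^ k)^*)%R = z ^ (- k).
  move=> hz; case: k => n.
    by rewrite -exprnP rmorphXn /= (unit_conj hz) exprVn exprnN.
  by rewrite NegzE -exprnN opprK -exprnP fmorphV rmorphXn /= (unit_conj hz) exprVn invrK.
by rewrite !cz.
Qed.

Lemma abs_mono a b c x y w : torus3 x y w -> abs (mono a b c x y w) = 1.
Proof.
move=> h; have h1 := mono_conj a b c h.
have := mul_conj (mono a b c x y w); rewrite h1 mono_mul // !subrr.
rewrite /mono !expr0z !mulr1 -ofreal1 => /ofreal_inj/esym/eqP.
by rewrite sqrp_eq1 ?abs_ge0 // => /eqP.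
Qed.

Section Grid.
Variable N : nat.
Hypothesis N0 : (0 < N)%N.
Local Notation om := (rou R N).

(** The third eigenvalue, determined by determinant 1: the grid consists of the N-torsion points of
    the diagonal torus. *)
Definition gpt (i j : 'I_N) : C := (om ^+ i * om ^+ j)^-1.
Definition gridsum (F : C -> C -> C -> C) : C :=
  \sum_(i < N) \sum_(j < N) F (om ^+ i) (om ^+ j) (gpt i j).
Definition gridavg (F : C -> C -> C -> C) : C := (N%:R ^+ 2)^-1 * gridsum F.

Lemma grid_torus (i j : 'I_N) : torus3 (om ^+ i) (om ^+ j) (gpt i j).
Proof.
have hX (k : nat) : abs (om ^+ k) = 1 by rewrite absX abs_rou expr1n.
split; rewrite ?hX // /gpt; first by rewrite absV absM !hX mulr1 invr1.
by rewrite mulfV // mulf_neq0 // expf_neq0 // rou_neq0.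
Qed.

Lemma gridavg_ext F H : (forall x y w, torus3 x y w -> F x y w = H x y w) ->
  gridavg F = gridavg H.
Proof.
move=> e; congr (_ * _); apply: eq_bigr => i _; apply: eq_bigr => j _.
exact: e (grid_torus i j).
Qed.

Lemma gridavg_swap12 F : gridavg (fun x y w => F y x w) = gridavg F.
Proof.
congr (_ * _); rewrite /gridsum exchange_big /=.
by apply: eq_bigr => i _; apply: eq_bigr => j _; rewrite /gpt [om ^+ j * _]mulrC.
Qed.

Lemma rou_inj (i j : 'I_N) : om ^+ i = om ^+ j -> i = j.
Proof.
move=> e; have : om ^ (i%:Z - j%:Z) == 1.
  by rewrite expfzDr ?rou_neq0 // -exprnP -exprnN e mulfV // expf_neq0 // rou_neq0.
by rewrite rou_exp_eq1 // -eqz_mod_dvd !modz_nat !modn_small // => /eqP[] /val_inj.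
Qed.

(** For fixed i, the map from j to -(i + j) modulo N permutes the indices and exchanges the second
    and third eigenvalues. This makes grid averages symmetric in all three arguments, although the
    grid is parametrised by two of them. *)
Lemma grid_reflect (i : 'I_N) : exists2 s : 'I_N -> 'I_N, injective s &
  forall j, om ^+ s j = gpt i j.
Proof.
pose s (j : 'I_N) : 'I_N := Ordinal (ltn_pmod (N - i + (N - j))%N N0).
have hs j : om ^+ s j = gpt i j.
  rewrite /= expr_mod ?rouN // exprD /gpt invfM.
  have half (k : 'I_N) : om ^+ (N - k) = (om ^+ k)^-1.
    apply: (mulfI (expf_neq0 k (rou_neq0 R N))).
    by rewrite -exprD subnKC ?rouN ?mulfV ?expf_neq0 ?rou_neq0 // ltnW.
  by rewrite !half.
exists s => // j k e; apply: rou_inj.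
have : gpt i j = gpt i k by rewrite -!hs e.
by move/invr_inj/(mulfI (expf_neq0 i (rou_neq0 R N))).
Qed.

Lemma gridavg_swap23 F : gridavg (fun x y w => F x w y) = gridavg F.
Proof.
congr (_ * _); apply: eq_bigr => i _.
have [s sinj hs] := grid_reflect i.
rewrite [RHS](reindex_inj sinj) /=; apply: eq_bigr => j _; rewrite hs; congr (F _ _ _).
have o0 k := expf_neq0 k (rou_neq0 R N).
by rewrite [gpt _ (s j)]/gpt hs /gpt; field; rewrite !o0.
Qed.

Lemma gridavg_add F H : gridavg (fun x y w => F x y w + H x y w) = gridavg F + gridavg H.
Proof.
rewrite /gridavg -mulrDr; congr (_ * _); rewrite /gridsum -big_split.
by apply: eq_bigr => i _; rewrite -big_split.
Qed.
Lemma gridavg_scale (k : C) F : gridavg (fun x y w => k * F x y w) = k * gridavg F.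
Proof.
rewrite /gridavg mulrCA; congr (_ * _); rewrite /gridsum mulr_sumr.
by apply: eq_bigr => i _; rewrite mulr_sumr.
Qed.
Lemma gridavg_opp F : gridavg (fun x y w => - F x y w) = - gridavg F.
Proof.
rewrite -mulN1r -gridavg_scale; apply: gridavg_ext => x y w _; by rewrite mulN1r.
Qed.
Lemma gridavg_sum (I : Type) (r : seq I) (F : I -> C -> C -> C -> C) :
  gridavg (fun x y w => \sum_(i <- r) F i x y w) = \sum_(i <- r) gridavg (F i).
Proof.
elim: r => [|i r IH].
  have g0 : gridavg (fun _ _ _ => 0) = 0.
    by rewrite /gridavg /gridsum big1 ?mulr0 // => i _; rewrite big1.
  by rewrite big_nil -g0; apply: gridavg_ext => x y w _; rewrite big_nil.
rewrite big_cons -IH -gridavg_add; apply: gridavg_ext => x y w _.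
by rewrite big_cons.
Qed.

(** Eliminating the third eigenvalue leaves exponents a - c and b - c on two independent roots of
    unity, so the average factors into two geometric sums. *)
Lemma gridavg_mono a b c : gridavg (mono a b c) =
  if (N%:Z %| a - c)%Z && (N%:Z %| b - c)%Z then 1 else 0.
Proof.
have -> : gridavg (mono a b c) =
   (N%:R ^+ 2)^-1 * ((\sum_(i < N) (om ^ (a - c)) ^+ i) * (\sum_(j < N) (om ^ (b - c)) ^+ j)).
  congr (_ * _); rewrite mulr_suml; apply: eq_bigr => i _.
  rewrite mulr_sumr; apply: eq_bigr => j _.
  have o0 := rou_neq0 R N.
  have sw (k : int) (n : nat) : (om ^ k) ^+ n = (om ^+ n) ^ k.
    by rewrite !exprnP !exprz_exp mulrC.
  rewrite !sw /mono /gpt.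
  have x0 : om ^+ i != 0 := expf_neq0 i o0.
  have y0 : om ^+ j != 0 := expf_neq0 j o0.
  move: (om ^+ i) (om ^+ j) x0 y0 => x y x0 y0.
  rewrite !expfzDr // -!invr_expz exprz_inv invr_expz -[(x * y)]/(x * y).
  rewrite exprMz_comm ?unitfE //; last exact: mulrC.
  by rewrite -!invr_expz; ring.
rewrite !sum_rou //.
case: ifP => _ /=; last by rewrite mul0r mulr0.
case: ifP => _; last by rewrite !mulr0.
by rewrite -expr2 mulVf // expf_neq0 // pnatr_eq0 -lt0n.
Qed.

Definition antisym (F : C -> C -> C -> C) : Prop := forall x y w, torus3 x y w ->
  F y x w = - F x y w /\ F x w y = - F x y w.

(** Each of the six terms of the alternant arises from the first by permuting the arguments; the
    sign of the permutation cancels against that of [F], so all six contribute equally. *)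
Lemma gridavg_antisym F a b c : antisym F ->
  gridavg (fun x y w => F x y w * (alternant a b c x y w)^*%R) =
  6%:R * gridavg (fun x y w => F x y w * (mono a b c x y w)^*%R).
Proof.
move=> hF.
pose A a b c := gridavg (fun x y w => F x y w * (mono a b c x y w)^*%R).
have A12 a' b' c' : A b' a' c' = - A a' b' c'.
  rewrite -gridavg_opp /A -gridavg_swap12; apply: gridavg_ext => x y w h.
  have [-> _] := hF _ _ _ h; rewrite mulNr; congr (- (_ * _^*)%R).
  by rewrite /mono; ring.
have A23 a' b' c' : A a' c' b' = - A a' b' c'.
  rewrite -gridavg_opp /A -gridavg_swap23; apply: gridavg_ext => x y w h.
  have [_ ->] := hF _ _ _ h; rewrite mulNr; congr (- (_ * _^*)%R).
  by rewrite /mono; ring.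
transitivity (A a b c - A b a c - A a c b - A c b a + A b c a + A c a b).
  rewrite /A -!gridavg_opp -!gridavg_add; apply: gridavg_ext => x y w _.
  by rewrite /alternant !(rmorphD, rmorphN) /=; ring.
have e1 : A b a c = - A a b c by rewrite A12.
have e2 : A a c b = - A a b c by rewrite A23.
have e3 : A b c a = A a b c by rewrite A23 e1 opprK.
have e4 : A c a b = A a b c by rewrite A12 e2 opprK.
have e5 : A c b a = - A a b c by rewrite A12 e3.
rewrite e1 e2 e3 e4 e5 -/(A a b c); ring.
Qed.

End Grid.
End Alternants.

(** * Class functions and the integration formula *)

Section ClassFunctions.
Variable R : realType.
Local Notation C := (CC R).
Local Notation M3 := 'M[C]_3.
Local Notation "M ^t*" := (map_mx Num.conj M^T) (at level 30).
Implicit Types (x y w : C) (f : M3 -> C).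

Definition classf f : Prop :=
  forall u g, SU3 u -> SU3 g -> f (u *m g *m invmx u) = f g.

Lemma dg3_SU3 x y w : torus3 x y w -> SU3 (dg3 x y w).
Proof.
case=> hx hy hw h; split; last by rewrite det_diag !big_ord_recl big_ord0 mulr1 !mxE /= mulrA.
apply: unitary_diag => i; rewrite mxE; case: ifP => // _; by case: ifP.
Qed.

Lemma unitary_abs_det n (U : 'M[C]_n) : U \is unitarymx -> abs (\det U) = 1.
Proof.
move=> /unitarymxP /(congr1 determinant); rewrite det_mulmx det_map_mx det_tr det1 mul_conj.
rewrite -ofreal1 => /ofreal_inj /eqP; by rewrite sqrp_eq1 ?abs_ge0 // => /eqP.
Qed.

Lemma unitary_scale n (U : 'M[C]_n) (z : C) : abs z = 1 -> U \is unitarymx ->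
  z *: U \is unitarymx.
Proof.
move=> hz /unitarymxP hU; apply/unitarymxP.
rewrite linearZ /= map_mxZ -scalemxAl -scalemxAr hU scalerA mul_conj hz expr1n.
by rewrite ofreal1 scale1r.
Qed.

Lemma unitary_to_SU3 (U : M3) : U \is unitarymx ->
  exists z : C, abs z = 1 /\ SU3 (z *: U).
Proof.
move=> hU; have [t _ et] := cis_surj (unitary_abs_det hU).
exists (cis (- t / 3%:R)); split; first exact: abs_cis.
split; first by apply: unitary_scale => //; exact: abs_cis.
rewrite detZ et -cisMn -cisD -[_ *+ 3]mulr_natr divfK ?pnatr_eq0 //.
by rewrite addNr cis0.
Qed.

Lemma diag_mx_dg3 (d : 'rV[C]_3) :
  diag_mx d = dg3 (d 0 0) (d 0 (lift 0 0)) (d 0 (lift 0 (lift 0 0))).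
Proof.
congr diag_mx; apply/rowP => i; rewrite mxE.
by case: i => [[|[|[|//]]] hi] /=; congr (d 0 _); apply: val_inj.
Qed.

Lemma unitary_diag_entries n (d : 'rV[C]_n) : diag_mx d \is unitarymx ->
  forall i, abs (d 0 i) = 1.
Proof.
move=> /unitarymxP; rewrite tr_diag_mx map_diag_mx mulmx_diag => e i.
have := congr1 (fun A : 'M[C]_n => A i i) e; rewrite !mxE eqxx !mulr1n mul_conj.
by rewrite -ofreal1 => /ofreal_inj /eqP; rewrite sqrp_eq1 ?abs_ge0 // => /eqP.
Qed.

(** The spectral theorem diagonalises g by a unitary matrix. Multiplying that matrix by a scalar
    moves it into SU(3), and the scalar disappears in the conjugation. *)
Lemma SU3_conj_torus (g : M3) : SU3 g -> exists u x y w,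
  [/\ SU3 u, torus3 x y w & g = u *m dg3 x y w *m invmx u].
Proof.
move=> [hg dg].
have ng : g \is normalmx.
  apply/normalmxP; rewrite -(invmx_unitary hg) mulmxV ?mulVmx //; exact: unitarymx_unit.
have [[U d] /= hU eg] := orthomx_spectral_subproof ng.
have Uu := unitarymx_unit hU.
have iU : invmx U = U ^t* by exact: invmx_unitary.
have hU' : U^t* \is unitarymx by have -> := trmxC_unitary U.
have [z [hz hzU]] := unitary_to_SU3 hU'.
have z0 := abs1_neq0 hz.
have eD : diag_mx d = U *m g *m U^t*.
  by rewrite eg -iU !mulmxA mulmxV // mul1mx -mulmxA mulmxV // mulmx1.
have hD : diag_mx d \is unitarymx.
  by rewrite eD; exact: (mul_unitarymx (mul_unitarymx hU hg) hU').
have hd := unitary_diag_entries hD.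
have dd : \prod_i d 0 i = 1.
  have dU : \det U != 0 by rewrite -unitfE -unitmxE.
  by rewrite -det_diag eD -iU !det_mulmx det_inv dg mulr1; exact: mulfV.
exists (z *: U^t*), (d 0 0), (d 0 (lift 0 0)), (d 0 (lift 0 (lift 0 0))); split=> //.
  by split; rewrite ?hd // -dd !big_ord_recl big_ord0 mulr1 mulrA.
have -> : invmx (z *: U^t*) = z^-1 *: U.
  have hzu : z *: U^t* \in unitmx by exact: SU3_unit.
  apply: (can_inj (mulKmx hzu)); rewrite mulmxV // -scalemxAl -scalemxAr scalerA mulfV //.
  by rewrite scale1r -iU mulVmx.
rewrite -diag_mx_dg3 -!scalemxAl -scalemxAr scalerA mulfV // scale1r -iU.
exact: eg.
Qed.

Lemma classf_ext f h : classf f -> classf h ->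
  (forall x y w, torus3 x y w -> f (dg3 x y w) = h (dg3 x y w)) ->
  forall g, SU3 g -> f g = h g.
Proof.
move=> cf ch e g /SU3_conj_torus [u [x [y [w [hu ht ->]]]]].
by rewrite cf ?ch ?e //; exact: dg3_SU3.
Qed.

Lemma perm_conj_diag n (s : {perm 'I_n}) (d : 'rV[C]_n) :
  perm_mx s *m diag_mx d *m perm_mx s^-1%g = diag_mx (\row_i d 0 (s i)).
Proof.
rewrite -row_permE -col_permE; apply/matrixP => i j; rewrite !mxE.
by rewrite (inj_eq perm_inj); case: eqP => [->|]; rewrite ?mulr0n.
Qed.

Lemma perm_unitary n (s : {perm 'I_n}) : (perm_mx s : 'M[C]_n) \is unitarymx.
Proof.
apply/unitarymxP; rewrite tr_perm_mx map_perm_mx -perm_mxM mulgV perm_mx1 //.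
Qed.

(** A permutation matrix may have determinant -1, so it is first rescaled into SU(3); conjugation
    does not see the scalar. *)
Lemma classf_perm f (s : {perm 'I_3}) (d : 'rV[C]_3) : classf f ->
  SU3 (diag_mx d) -> f (diag_mx (\row_i d 0 (s i))) = f (diag_mx d).
Proof.
move=> cf hd.
have [z [hz hzU]] := unitary_to_SU3 (perm_unitary s).
rewrite -(cf _ _ hzU hd); congr f.
have z0 := abs1_neq0 hz.
have -> : invmx (z *: perm_mx s) = z^-1 *: perm_mx s^-1%g.
  have hzu : z *: perm_mx s \in unitmx by exact: SU3_unit.
  apply: (can_inj (mulKmx hzu)); rewrite mulmxV // -scalemxAl -scalemxAr scalerA mulfV //.
  by rewrite scale1r -perm_mxM mulgV perm_mx1.
by rewrite -!scalemxAl -scalemxAr scalerA mulfV // scale1r perm_conj_diag.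
Qed.

Lemma classf_swap12 f x y w : classf f -> torus3 x y w -> f (dg3 y x w) = f (dg3 x y w).
Proof.
move=> cf h; rewrite -(classf_perm (tperm 0 (lift 0 0)) cf (dg3_SU3 h)); congr (f (diag_mx _)).
apply/rowP => i; rewrite !mxE; by case: i => [[|[|[|//]]] hi] /=; rewrite permE /=.
Qed.

Lemma classf_swap23 f x y w : classf f -> torus3 x y w -> f (dg3 x w y) = f (dg3 x y w).
Proof.
move=> cf h.
rewrite -(classf_perm (tperm (lift 0 0) (lift 0 (lift 0 0))) cf (dg3_SU3 h)).
congr (f (diag_mx _)).
apply/rowP => i; rewrite !mxE; by case: i => [[|[|[|//]]] hi] /=; rewrite permE /=.
Qed.

(** Rotating x by t and w by -t stays on the torus. For small nonzero t the three eigenvalues are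
    distinct: distinct ones stay apart by continuity, equal ones are separated by the rotation. So
    [K] vanishes along the punctured path, and its limit is 0. *)
Lemma regular_dense x y w (K : C -> C -> C -> C) :
  torus3 x y w ->
  (forall x y w, torus3 x y w -> vdm x y w != 0 -> K x y w = 0) ->
  (K (x * cis t) y (w * cis (- t)) @[t --> (0 : R)] --> K x y w) ->
  K x y w = 0.
Proof.
move=> [hx hy hw h] K0 cK.
have p0 := pi_gt0 R.
have hs t : torus3 (x * cis t) y (w * cis (- t)).
  split; rewrite ?absM ?abs_cis ?mulr1 // cisN.
  by rewrite -h; field; exact: cis_neq0.
have small : \forall t \near (0 : R)^', `|t| < pi /\ t != 0.
  near=> t; split; near: t.
    apply: (@nbhs_dnbhs); apply/nbhs_ballP; exists pi => //= t; rewrite /ball /= sub0r normrN.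
    by [].
  exact: nbhs_dnbhs_neq.
have near_ne (f : R -> C) (a b : C) : f t @[t --> (0 : R)] --> a - b -> (a != b) ->
    \forall t \near (0 : R)^', f t != 0.
  move=> cf ab; apply: nbhs_dnbhs.
  have : 0 < abs (a - b) by rewrite abs_gt0 subr_eq0.
  move/cvg_absP : cf => cf /cf; apply: filterS => t.
  by apply: contraTN => /eqP ->; rewrite sub0r absN ltxx.
have cid : (t : R) @[t --> (0 : R)] --> (0 : R) by [].
have cis1 : cis t @[t --> (0 : R)] --> (1 : C) by rewrite -(cis0 R); exact: cvg_cis.
have cisN1 : cis (- t) @[t --> (0 : R)] --> (1 : C).
  have -> : (1 : C) = cis (- 0) by rewrite oppr0 cis0.
  by apply: cvg_cis; exact: (cvgN cid).
have cx : x * cis t @[t --> (0 : R)] --> x.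
  have e : x = x * 1 by rewrite mulr1.
  rewrite {2}e; exact: (cvgC_mul (cvg_cst x) cis1).
have cw : w * cis (- t) @[t --> (0 : R)] --> w.
  have e : w = w * 1 by rewrite mulr1.
  rewrite {2}e; exact: (cvgC_mul (cvg_cst w) cisN1).
have n1 : \forall t \near (0 : R)^', x * cis t - y != 0.
  have [e|ne] := eqVneq x y; last first.
    apply: near_ne ne; exact: (cvgC_add cx (cvgC_opp (cvg_cst y))).
  apply: filterS small => t [t1 t2]; rewrite -e -{2}[x]mulr1 -mulrBr.
  apply: mulf_neq0; first exact: abs1_neq0.
  rewrite subr_eq0; apply: contra_neq t2; apply: cis_eq1_small; rewrite mulr2n; lra.
have n2 : \forall t \near (0 : R)^', y - w * cis (- t) != 0.
  have [e|ne] := eqVneq y w; last first.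
    apply: near_ne ne; exact: (cvgC_add (cvg_cst y) (cvgC_opp cw)).
  apply: filterS small => t [t1 t2]; rewrite e -{1}[w]mulr1 -mulrBr.
  apply: mulf_neq0; first exact: abs1_neq0.
  rewrite subr_eq0 eq_sym; apply: contra_neq t2 => e1; apply: oppr_inj; rewrite oppr0.
  by apply: cis_eq1_small e1; rewrite normrN mulr2n; lra.
(* Both eigenvalues move here, in opposite directions: if they start equal, a collision means
   [cis (t + t) = 1], which |t| < pi still excludes for t nonzero. *)
have n3 : \forall t \near (0 : R)^', x * cis t - w * cis (- t) != 0.
  have [e|ne] := eqVneq x w; last first.
    apply: near_ne ne; exact: (cvgC_add cx (cvgC_opp cw)).
  apply: filterS small => t [t1 t2]; rewrite e -mulrBr.
  apply: mulf_neq0; first exact: abs1_neq0.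
  rewrite subr_eq0; apply: contra_neq t2 => e1.
  have : cis (t + t) = 1 by rewrite cisD {1}e1 cisN mulVf // cis_neq0.
  move=> /cis_eq1_small; rewrite -mulr2n normrMn => h2.
  have : t *+ 2 = 0 by apply: h2; rewrite !mulr2n; lra.
  by move/eqP; rewrite mulrn_eq0 /= => /eqP.
have z : \forall t \near (0 : R)^', K (x * cis t) y (w * cis (- t)) = 0.
  near=> t; apply: K0 => //; rewrite /vdm !mulf_neq0 //.
  - near: t; exact: n1.
  - near: t; exact: n3.
  - near: t; exact: n2.
have c' : K (x * cis t) y (w * cis (- t)) @[t --> (0 : R)^'] --> K x y w.
  by apply: cvg_trans cK; apply: cvg_app; exact: cvg_within.
apply: (cvgC_unique c').
by apply/cvg_absP => e e0; apply: filterS z => t ->; rewrite subrr abs0.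
Unshelve. all: by end_near. Qed.

Lemma contf_regular f : contf f -> classf f ->
  (forall x y w, torus3 x y w -> f (dg3 x y w) * vdm x y w = 0) ->
  forall g, SU3 g -> f g = 0.
Proof.
move=> cf clf h0; apply: (@classf_ext f (fun=> 0)) => // x y w ht.
apply: (@regular_dense x y w (fun x y w => f (dg3 x y w))) => //.
  move=> x' y' w' ht' v0; have /eqP := h0 _ _ _ ht'.
  by rewrite mulf_eq0 (negbTE v0) orbF => /eqP.
have c1 : dg3 (x * cis t) y (w * cis (- t)) @[t --> (0 : R)] -->
    within (@SU3 R) (nbhs (dg3 x y w)).
  have cid : (t : R) @[t --> (0 : R)] --> (0 : R) by [].
  have c2 : dg3 (x * cis t) y (w * cis (- t)) @[t --> (0 : R)] --> dg3 x y w.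
    apply/cvg_mxP => i j.
    have -> : (fun t => dg3 (x * cis t) y (w * cis (- t)) i j) =
       (fun t => (if i == 0 :> nat then x * cis t else if i == 1%N :> nat then y else w * cis (- t)) *+ (i == j)).
      by apply/funext => t; rewrite !mxE.
    have -> : dg3 x y w i j
      = (if i == 0 :> nat then x * cis 0 else if i == 1%N :> nat then y else w * cis (- 0)) *+ (i == j).
      by rewrite !mxE oppr0 cis0 !mulr1.
    case: (i == j); rewrite ?mulr1n ?mulr0n; last exact: cvg_cst.
    case: ifP => _; first by apply: cvgC_mul; [exact: cvg_cst|exact: cvg_cis].
    case: ifP => _; first exact: cvg_cst.
    by apply: cvgC_mul; [exact: cvg_cst|apply: cvg_cis; exact: (cvgN cid)].
  move=> U hU.
  have c3 : \forall t \near (0 : R), SU3 (dg3 (x * cis t) y (w * cis (- t))) ->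
      U (dg3 (x * cis t) y (w * cis (- t))) := c2 [set z | @SU3 R z -> U z] hU.
  change (\forall t \near (0 : R), U (dg3 (x * cis t) y (w * cis (- t)))).
  apply: filterS c3 => t; apply; apply: dg3_SU3.
  have [hx hy hw h] := ht.
  split; rewrite ?absM ?abs_cis ?mulr1 // cisN.
  by rewrite -h; field; exact: cis_neq0.
by apply: cvg_comp c1 _; exact: cf (dg3_SU3 ht).
Qed.

End ClassFunctions.

(** * Weyl's integration formula at torsion points *)

Section WeylIntegration.
Variable R : realType.
Local Notation C := (CC R).
Local Notation M3 := 'M[C]_3.
Variable m : {measure set (borelM3 R) -> \bar R}.
Hypothesis haar_m : haar m.
Local Notation EE := (EE m).
Implicit Types (a b c : int) (x y w : C) (f : M3 -> C).

Lemma classf_add f h : classf f -> classf h -> classf (fun g => f g + h g).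
Proof. by move=> cf ch u g hu hg; rewrite cf ?ch. Qed.
Lemma classf_mul f h : classf f -> classf h -> classf (fun g => f g * h g).
Proof. by move=> cf ch u g hu hg; rewrite cf ?ch. Qed.
Lemma classf_opp f : classf f -> classf (fun g => - f g).
Proof. by move=> cf u g hu hg; rewrite cf. Qed.
Lemma classf_sum (I : Type) (r : seq I) (f : I -> M3 -> C) :
  (forall i, classf (f i)) -> classf (fun g => \sum_(i <- r) f i g).
Proof. by move=> cf u g hu hg; apply: eq_bigr => i _; rewrite cf. Qed.

Lemma classf_scale (k : C) f : classf f -> classf (fun g => k * f g).
Proof. by move=> cf u g hu hg; rewrite cf. Qed.
Lemma contf_scale (k : C) f : contf f -> contf (fun g => k * f g).
Proof. by move=> cf; exact: (@contf_mul R (fun=> k) f (@contf_cst R k) cf). Qed.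

Definition weyl_avg N f : C :=
  6%:R^-1 * gridavg N (fun x y w => f (dg3 x y w) * (vdm x y w * (vdm x y w)^*%R)).
(** A threshold is unavoidable: distinct exponents that are congruent modulo N are confused by the
    grid. *)
Definition weyl_good f : Prop :=
  exists N0 : nat, forall N, (N0 < N)%N -> EE f = weyl_avg N f.

(* [J] plays the role of the virtual character with numerator [alternant a b c];
   its Haar integral only sees the trivial representation. *)
Definition schur_like a b c : Prop :=
  exists J : M3 -> C, [/\ contf J, classf J,
    forall x y w, torus3 x y w -> J (dg3 x y w) * vdm x y w = alternant a b c x y w &
    weyl_good J].

Lemma good_add f h : contf f -> contf h -> weyl_good f -> weyl_good h ->
  weyl_good (fun g => f g + h g).
Proof.
move=> cf ch [N1 h1] [N2 h2]; exists (maxn N1 N2) => N; rewrite gtn_max => /andP[n1 n2].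
rewrite (EE_add haar_m) // (h1 N) // (h2 N) // /weyl_avg -mulrDr; congr (_ * _).
by rewrite -gridavg_add; apply: gridavg_ext => x y w _; rewrite mulrDl.
Qed.
Lemma good_scale (k : C) f : contf f -> weyl_good f -> weyl_good (fun g => k * f g).
Proof.
move=> cf [N1 h1]; exists N1 => N n1.
rewrite (EE_scale haar_m) // (h1 N) // /weyl_avg mulrCA; congr (_ * _).
by rewrite -gridavg_scale; apply: gridavg_ext => x y w _; rewrite mulrA.
Qed.
Lemma good_ext f h : (forall g, SU3 g -> f g = h g) -> weyl_good f -> weyl_good h.
Proof.
move=> e [N1 h1]; exists N1 => N n1; rewrite -(EE_ext m e) (h1 N) // /weyl_avg.
congr (_ * _); apply: gridavg_ext => x y w ht.
by rewrite e //; exact: dg3_SU3.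
Qed.
Lemma good_sum (I : Type) (r : seq I) (f : I -> M3 -> C) :
  (forall i, contf (f i)) -> (forall i, weyl_good (f i)) ->
  weyl_good (fun g => \sum_(i <- r) f i g).
Proof.
move=> cf gf; elim: r => [|i r IH].
  exists 0%N => N n0; transitivity (0 : C).
    rewrite -[RHS](EE_cst haar_m); apply: EE_ext => g _; by rewrite big_nil.
  rewrite /weyl_avg /gridavg /gridsum big1 ?mulr0 // => i _.
  by rewrite big1 // => j _; rewrite big_nil mul0r.
apply: (@good_ext (fun g => f i g + \sum_(j <- r) f j g)).
  by move=> g _; rewrite big_cons.
by apply: good_add => //; apply: contf_sum.
Qed.

Lemma schur_like_swap12 a b c : schur_like a b c -> schur_like b a c.
Proof.
move=> [J [cJ clJ eJ gJ]]; exists (fun g => -1 * J g); split.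
- exact: contf_scale.
- exact: classf_scale.
- by move=> x y w ht; rewrite -mulrA eJ // mulN1r -alternant_swap12.
- exact: good_scale.
Qed.
Lemma schur_like_swap23 a b c : schur_like a b c -> schur_like a c b.
Proof.
move=> [J [cJ clJ eJ gJ]]; exists (fun g => -1 * J g); split.
- exact: contf_scale.
- exact: classf_scale.
- by move=> x y w ht; rewrite -mulrA eJ // mulN1r -alternant_swap23.
- exact: good_scale.
Qed.
Lemma schur_like_shift a b c (k : int) : schur_like (a + k) (b + k) (c + k) -> schur_like a b c.
Proof.
move=> [J [cJ clJ eJ gJ]]; exists J; split=> //.
by move=> x y w ht; rewrite eJ // alternant_shift.
Qed.

(** The index is shifted by 2 so that k is the exponent in the numerator: [hs k] is h_{k-2}, with
    h_{-1} = h_{-2} = 0. With these two zeros [hs_diag] holds for every k. *)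
Definition hs (k : nat) (g : M3) : C := if k is k'.+2 then hsym k' g else 0.

Lemma hs_contf k : contf (hs k).
Proof. by case: k => [|[|k]]; [exact: contf_cst|exact: contf_cst|exact: hsym_contf]. Qed.
Lemma hs_classf k : classf (hs k).
Proof. by case: k => [|[|k]] // u g hu hg; rewrite /= hsym_conjugate // SU3_unit. Qed.
Lemma hs_diag k x y w : hs k (dg3 x y w) * vdm x y w =
  x ^+ k * (y - w) - y ^+ k * (x - w) + w ^+ k * (x - y).
Proof.
case: k => [|[|k]] /=; rewrite ?expr0 ?expr1; try by rewrite mul0r; ring.
exact: hsym_diag.
Qed.

Lemma hsym0 (g : M3) : hsym 0 g = 1.
Proof.
have e (i j : {ffun 'I_0 -> 'I_3}) : i = j by apply/ffunP => -[].
pose j0 : {ffun 'I_0 -> 'I_3} := [ffun k => ord0].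
have a1 : anagrams j0 = 1%N.
  by rewrite /anagrams; apply: (@fintype.eq_card1 _ j0) => i; rewrite !inE (e i j0) anagram_refl eqxx.
rewrite /hsym (big_pred1 j0) => [|i]; last by rewrite (e i j0) [RHS]eqxx.
rewrite a1 invr1 mul1r /wblock (big_pred1 j0) => [|i]; last first.
  by rewrite (e i j0) anagram_refl [RHS]eqxx.
by rewrite /wprod big_ord0.
Qed.

Lemma EE_hs k l : EE (fun g => hs k g * hs l g) = ((k == 2) && (l == 2))%N%:R.
Proof.
have z0 (f : M3 -> C) : (forall g, f g = 0) -> EE f = 0.
  by move=> h; rewrite -[RHS](EE_cst haar_m); apply: EE_ext => g _; rewrite h.
case: k => [|[|k]]; try by rewrite z0 // => g; rewrite /= mul0r.
case: l => [|[|l]]; try by rewrite andbF z0 // => g; rewrite /= mulr0.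
case: (posnP (k + l)) => [|kl].
  move=> /eqP; rewrite addn_eq0 => /andP[/eqP -> /eqP ->] /=.
  rewrite -[RHS](EE_cst haar_m 1); apply: EE_ext => g _.
  by rewrite hsym0 mulr1.
rewrite /= integral_hsym // !eqSS; case: k kl => [|k] //=; by case: l.
Qed.

Lemma dvdz_small N (k : int) : (`|k| < N)%N -> (N%:Z %| k)%Z = (k == 0).
Proof.
move=> kN; apply/idP/eqP => [|->]; last exact: dvdz0.
move=> /dvdzP[q e]; case: (q =P 0) => [q0|q0]; first by rewrite e q0 mul0r.
nia.
Qed.

Lemma gridavg_mono_conj N (N0 : (0 < N)%N) a b c :
  gridavg N (fun x y w => mono a b c x y w * (mono 2 1 0 x y w)^*%R) =
  ((N%:Z %| a - c - 2)%Z && (N%:Z %| b - c - 1)%Z)%:R.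
Proof.
transitivity (gridavg N (@mono R (a - 2) (b - 1) c)).
  apply: gridavg_ext => // x y w ht; rewrite mono_conj // mono_mul //.
  by rewrite oppr0 addr0.
rewrite gridavg_mono // (_ : a - 2 - c = a - c - 2); last lia.
rewrite (_ : b - 1 - c = b - c - 1); last lia.
by case: (_ && _).
Qed.

(** Only the coefficient of the exponent (2, 1, 0), up to shift, survives. The bound on N makes
    divisibility by N mean equality to 0. Two of the six permutations of (p, q, 0) can reach that
    exponent; the other four would require a negative p or q. *)
Lemma gridavg_alternant (p q N : nat) : (p + q + 5 < N)%N ->
  gridavg N (fun x y w => alternant p%:Z q%:Z 0 x y w * (vdm x y w)^*%R) =
  6%:R * (((p == 2) && (q == 1))%N%:R - ((p == 1) && (q == 2))%N%:R).
Proof.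
move=> hN; have N0 : (0 < N)%N by lia.
have as_ : antisym (@alternant R p%:Z q%:Z 0).
  by move=> x y w _; split; [exact: alternant_arg12|exact: alternant_arg23].
transitivity (gridavg N (fun x y w => alternant p%:Z q%:Z 0 x y w * (alternant 2 1 0 x y w)^*%R)).
  by apply: gridavg_ext => // x y w _; rewrite vdm_alternant.
rewrite gridavg_antisym //; congr (_ * _).
pose T a b c := gridavg N (fun x y w => mono a b c x y w * (mono 2 1 0 x y w)^*%R).
transitivity (T p%:Z q%:Z 0 - T q%:Z p%:Z 0 - T p%:Z 0 q%:Z - T 0 q%:Z p%:Z + T q%:Z 0 p%:Z + T 0 p%:Z q%:Z).
  rewrite /T -!gridavg_opp // -!gridavg_add //; apply: gridavg_ext => // x y w _.
  by rewrite /alternant; ring.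
rewrite /T !gridavg_mono_conj // !dvdz_small; try lia.
have -> : (p%:Z - 0 - 2 == 0) && (q%:Z - 0 - 1 == 0) = ((p == 2) && (q == 1))%N by lia.
have -> : (q%:Z - 0 - 2 == 0) && (p%:Z - 0 - 1 == 0) = ((p == 1) && (q == 2))%N by lia.
have -> : (p%:Z - q%:Z - 2 == 0) && (0 - q%:Z - 1 == 0) = false by lia.
have -> : (0 - p%:Z - 2 == 0) && (q%:Z - p%:Z - 1 == 0) = false by lia.
have -> : (q%:Z - p%:Z - 2 == 0) && (0 - p%:Z - 1 == 0) = false by lia.
have -> : (0 - q%:Z - 2 == 0) && (p%:Z - q%:Z - 1 == 0) = false by lia.
by rewrite !subr0 !addr0.
Qed.

(** [J] is the two-row Jacobi-Trudi expression h_{p-2} h_{q-1} - h_{p-1} h_{q-2}. Both its integral,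
    by [EE_hs], and its weighted average, by [gridavg_alternant], are 1 for (p, q) = (2, 1), -1 for
    (1, 2), and 0 otherwise. *)
Lemma schur_like_nat (p q : nat) : schur_like p%:Z q%:Z 0.
Proof.
pose J g := hs p g * hs q.+1 g - hs p.+1 g * hs q g.
have cJ : contf J.
  apply: contf_add; [|apply: contf_opp]; by apply: contf_mul; exact: hs_contf.
have eJ x y w : torus3 x y w -> J (dg3 x y w) * vdm x y w = alternant p%:Z q%:Z 0 x y w.
  (* Where two eigenvalues coincide, exchanging them shows that the alternant equals its opposite.
     Elsewhere the identity is multiplied by the Vandermonde product once more, so that each factor
     [hs] meets its own copy. *)
  move=> ht; have [v0|v0] := eqVneq (vdm x y w) 0.
    have eN (t : C) : t = - t -> 0 = t.
      by move=> /eqP; rewrite -addr_eq0 -mulr2n mulrn_eq0 /= => /eqP.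
    rewrite v0 mulr0; apply: eN; move/eqP: v0; rewrite !mulf_eq0 !subr_eq0.
    case/orP => [/orP[/eqP e|/eqP e]|/eqP e].
    - by rewrite {1}e -alternant_arg12 e.
    - rewrite -[RHS]opprK -alternant_arg12 -alternant_arg23 -alternant_arg12.
      by rewrite e.
    - by rewrite {1}e -alternant_arg23 e.
  apply: (mulIf v0).
  transitivity ((hs p (dg3 x y w) * vdm x y w) * (hs q.+1 (dg3 x y w) * vdm x y w)
     - (hs p.+1 (dg3 x y w) * vdm x y w) * (hs q (dg3 x y w) * vdm x y w)).
    by rewrite /J; ring.
  rewrite !hs_diag /alternant /mono !expr0z !mulr1 -!exprnP !exprS /vdm.
  by move: (x ^+ p) (x ^+ q) (y ^+ p) (y ^+ q) (w ^+ p) (w ^+ q) => *; ring.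
exists J; split=> //.
  by apply: classf_add; [|apply: classf_opp]; apply: classf_mul; exact: hs_classf.
exists (p + q + 5)%N => N hN.
transitivity (((p == 2) && (q == 1))%N%:R - ((p == 1) && (q == 2))%N%:R : C).
  have c1 : contf (fun g => hs p g * hs q.+1 g) by apply: contf_mul; exact: hs_contf.
  have c2 : contf (fun g => hs p.+1 g * hs q g) by apply: contf_mul; exact: hs_contf.
  have -> : EE J = EE (fun g => hs p g * hs q.+1 g + -1 * (hs p.+1 g * hs q g)).
    by apply: EE_ext => g _; rewrite mulN1r.
  rewrite (EE_add haar_m c1 (contf_scale (k := -1) c2)) (EE_scale haar_m _ c2).
  by rewrite !EE_hs mulN1r !eqSS.
rewrite /weyl_avg.
transitivity (6%:R^-1 * gridavg N (fun x y w => alternant p%:Z q%:Z 0 x y w * (vdm x y w)^*%R)).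
  have n6 : (6%:R : C) != 0 by rewrite pnatr_eq0.
  by rewrite gridavg_alternant // mulKf.
congr (_ * _); apply: gridavg_ext => x y w ht.
by rewrite mulrA eJ.
Qed.

(** Permute the exponents so that the smallest comes last, then shift it to 0. *)
Lemma schur_like_all a b c : schur_like a b c.
Proof.
have base a' b' c' : c' <= a' -> c' <= b' -> schur_like a' b' c'.
  move=> h1 h2; apply: (@schur_like_shift a' b' c' (- c')).
  rewrite subrr; have -> : a' - c' = `|a' - c'|%N%:Z by lia.
  have -> : b' - c' = `|b' - c'|%N%:Z by lia.
  exact: schur_like_nat.
have [ca|ac] := leP c a; have [cb|bc] := leP c b; first exact: base.
- by apply: schur_like_swap23; apply: base; lia.
- apply: schur_like_swap12; apply: schur_like_swap23; apply: base; lia.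
have [ab|ba] := leP a b.
  apply: schur_like_swap12; apply: schur_like_swap23; apply: base; lia.
apply: schur_like_swap23; apply: base; lia.
Qed.

Lemma antisym_alternating F x y w : antisym F -> torus3 x y w ->
  6%:R * F x y w = F x y w - F y x w - F x w y - F w y x + F y w x + F w x y.
Proof.
move=> hF ht.
have t12 := torus3_swap12 ht; have t23 := torus3_swap23 ht.
have [e1 e2] := hF _ _ _ ht.
have [_ e3] := hF _ _ _ t12.
have [e4 _] := hF _ _ _ t23.
have t213 := torus3_swap23 t12.
have [e5 _] := hF _ _ _ t213.
rewrite e5 e3 e4 e1 e2; ring.
Qed.

Lemma alternant_args a b c x y w : alternant a b c x y w =
  mono a b c x y w - mono a b c y x w - mono a b c x w y - mono a b c w y x
  + mono a b c y w x + mono a b c w x y.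
Proof.
rewrite /alternant /mono.
by move: (x ^ a) (x ^ b) (x ^ c) (y ^ a) (y ^ b) (y ^ c) (w ^ a) (w ^ b) (w ^ c) => *; ring.
Qed.

(** For a class function the numerator is antisymmetric, so six times it is the alternating sum over
    permutations of the arguments, which replaces each monomial by an alternant. Hence f is the
    combination of the functions [J (e i)] with coefficients [k i / 6], first where the Vandermonde
    product is nonzero and then everywhere by continuity. *)
Lemma weyl_integration_numerator (I : Type) (r : seq I) (k : I -> C) (e : I -> int * int * int) f :
  contf f -> classf f ->
  (forall x y w, torus3 x y w -> f (dg3 x y w) * vdm x y w =
     \sum_(i <- r) k i * mono (e i).1.1 (e i).1.2 (e i).2 x y w) ->
  weyl_good f.
Proof.
move=> cf clf ef.
have /boolp.choice[J hJ] : forall t : int * int * int, exists J : M3 -> C,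
    [/\ contf J, classf J, forall x y w, torus3 x y w ->
      J (dg3 x y w) * vdm x y w = alternant t.1.1 t.1.2 t.2 x y w & weyl_good J].
  by move=> t; exact: schur_like_all.
have cJ t : contf (J t) by case: (hJ t).
have clJ t : classf (J t) by case: (hJ t).
have eJ t x y w : torus3 x y w -> J t (dg3 x y w) * vdm x y w = alternant t.1.1 t.1.2 t.2 x y w.
  by case: (hJ t) => _ _ h _; exact: h.
have gJ t : weyl_good (J t) by case: (hJ t).
pose S g := \sum_(i <- r) (k i / 6%:R) * J (e i) g.
have ckJ i : contf (fun g => (k i / 6%:R) * J (e i) g).
  by apply: contf_scale; exact: cJ.
have cS : contf S by apply: contf_sum => i _; exact: ckJ.
have clS : classf S by apply: classf_sum => i; exact: classf_scale.
have n6 : (6%:R : C) != 0 by rewrite pnatr_eq0.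
have e0 : forall g, SU3 g -> f g - S g = 0.
  apply: contf_regular.
  - exact: contf_add cf (contf_opp cS).
  - exact: classf_add clf (classf_opp clS).
  move=> x y w ht; rewrite mulrBl; apply/eqP; rewrite subr_eq0; apply/eqP.
  apply: (mulfI n6).
  pose F x y w := f (dg3 x y w) * vdm x y w.
  have hF : antisym F.
    move=> x' y' w' ht'; rewrite /F.
    by split; [rewrite (classf_swap12 clf ht')|rewrite (classf_swap23 clf ht')]; rewrite /vdm; ring.
  rewrite -/(F x y w) (antisym_alternating hF ht) /F.
  have t1 := torus3_swap12 ht; have t2 := torus3_swap23 ht.
  have t3 := torus3_swap23 t1; have t4 := torus3_swap12 t2; have t5 := torus3_swap23 t4.
  rewrite (ef _ _ _ ht) (ef _ _ _ t1) (ef _ _ _ t2) (ef _ _ _ t3) (ef _ _ _ t4) (ef _ _ _ t5).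
  rewrite /S mulr_suml mulr_sumr -!sumrB -!big_split /=; apply: eq_bigr => i _.
  transitivity (k i * (J (e i) (dg3 x y w) * vdm x y w)); last by field.
  rewrite eJ // alternant_args.
  case: (e i) => -[a b] c /=.
  move: (mono a b c x y w) (mono a b c y x w) (mono a b c x w y) (mono a b c w y x)
    (mono a b c y w x) (mono a b c w x y) (k i) => *; ring.
apply: (@good_ext S) => [g hg|]; first by apply/eqP; rewrite eq_sym -subr_eq0 e0.
apply: good_sum => i; first exact: ckJ.
by apply: good_scale; [exact: cJ|exact: gJ].
Qed.

Lemma weyl_integration (I : Type) (r : seq I) (k : I -> C) (e : I -> int * int * int) f :
  contf f -> classf f ->
  (forall x y w, torus3 x y w ->
     f (dg3 x y w) = \sum_(i <- r) k i * mono (e i).1.1 (e i).1.2 (e i).2 x y w) ->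
  weyl_good f.
Proof.
move=> cf clf ef.
(* The six signed monomials of the Vandermonde product; multiplying the expansion of f by them
   produces an expansion of the numerator. *)
pose S6 : seq (C * (int * int * int)) := [:: (1, (2, 1, 0)); (-1, (1, 2, 0)); (-1, (2, 0, 1));
  (-1, (0, 1, 2)); (1, (1, 0, 2)); (1, (0, 2, 1))].
pose add (s t : int * int * int) := (s.1.1 + t.1.1, s.1.2 + t.1.2, s.2 + t.2).
apply: (@weyl_integration_numerator _ [seq (i, s) | i <- r, s <- S6]
  (fun t => k t.1 * t.2.1) (fun t => add (e t.1) t.2.2)) => // x y w ht.
rewrite ef // mulr_suml big_allpairs_dep /=; apply: eq_bigr => i _.
rewrite vdm_alternant /alternant !big_cons big_nil /= -!mono_mul //.
ring.
Qed.

End WeylIntegration.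

(** * Representations and Schur orthogonality *)

Section CommutingUnitaries.
Variable R : realType.
Local Notation C := (CC R).
Local Notation "M ^t*" := (map_mx Num.conj M^T) (at level 30).

(** A finite subfamily whose span has maximal dimension. It reduces the diagonalisation of a
    possibly infinite commuting family to that of a finite list. *)
Lemma finite_spanning (n : nat) (F : set 'M[C]_n) :
  exists s : seq 'M[C]_n, (forall A, A \in s -> F A) /\ (forall A, F A -> A \in span s).
Proof.
pose P k := `[< exists s : seq 'M[C]_n, (forall A, A \in s -> F A) /\ \dim (span s) = k >].
have exP : exists k, P k by exists 0%N; apply/asboolP; exists [::]; rewrite span_nil dimv0.
have ubP k : P k -> (k <= dim 'M[C]_n)%N.
  by move=> /asboolP[s [_ <-]]; rewrite -dimvf dimvS // subvf.
have [k /asboolP[s [hs ds]] kmax] := ex_maxnP exP ubP.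
exists s; split=> // A FA.
have sub : (span s <= span (A :: s))%VS by rewrite span_cons addvSr.
have : (\dim (span (A :: s)) <= k)%N.
  apply: kmax; apply/asboolP; exists (A :: s); split=> // B.
  by rewrite inE => /orP[/eqP ->|/hs].
rewrite -ds => le.
have /eqP e : span s == span (A :: s) by rewrite eqEdim sub le.
by rewrite e memv_span // inE eqxx.
Qed.

(** The finite list is enlarged by its adjoints, which still commute. A unitary change of basis that
    makes both A and its adjoint triangular on the same side makes A diagonal. *)
Lemma unitary_codiag (n : nat) (F : set 'M[C]_n) :
  (forall A, F A -> A \is unitarymx) ->
  (forall A B, F A -> F B -> A *m B = B *m A) ->
  exists2 P : 'M[C]_n, P \is unitarymx &
    forall A, F A -> is_diag_mx (P *m A *m P^t*).
Proof.
move=> uF cF; have [s [sF Fs]] := finite_spanning F.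
pose s' := s ++ [seq A^t* | A <- s].
have com A B : F A -> F B -> A *m B^t* = B^t* *m A.
  move=> FA FB; have uB := unitarymx_unit (uF _ FB).
  rewrite -(invmx_unitary (uF _ FB)); apply: (can_inj (mulKmx uB)).
  by rewrite mulKVmx // mulmxA (cF _ _ FB FA) mulmxK.
have com2 A B : F A -> F B -> A^t* *m B^t* = B^t* *m A^t*.
  by move=> FA FB; rewrite -!map_mxM /= -!trmx_mul cF.
have [P uP /allP hP] : cotrigonalizable_in (@unitarymx C n n) s'.
  apply: cotrigonalization => A B; rewrite !mem_cat => /orP[hA|/mapP[A' hA ->]] /orP[hB|/mapP[B' hB ->]].
  - by apply: cF; exact: sF.
  - by apply: com; exact: sF.
  - by apply/esym; apply: com; exact: sF.
  - by apply: com2; exact: sF.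
exists P => //.
have Pu := unitarymx_unit uP.
have ds A : A \in s -> is_diag_mx (P *m A *m P^t*).
  move=> hA; have h1 : A \in s' by rewrite mem_cat hA.
  have h2 : A^t* \in s' by rewrite mem_cat (map_f (fun A => A^t*) hA) orbT.
  have trig X (hX : X \in s') (i j : 'I_n) : (i < j)%N -> (P *m X *m P^t*) i j = 0.
    move=> ij; have /is_trig_mxP/(_ _ _ ij) := hP _ hX.
    by rewrite conjumx // invmx_unitary.
  apply/is_diag_mxP => i j; case: ltngtP => // [ij _|ji _]; first exact: trig.
  have := trig _ h2 j i ji.
  have -> : P *m A^t* *m P^t* = (P *m A *m P^t*)^t*.
    by rewrite !trmx_mul !map_mxM /= trmxCK mulmxA.
  move: (P *m A *m P^t*) => X; rewrite !mxE => /eqP.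
  by rewrite conjC_eq0 => /eqP.
move=> A FA; have := Fs _ FA; rewrite -[s]in_tupleE => /coord_span ->.
apply/is_diag_mxP => i j ij; rewrite mulmx_sumr mulmx_suml summxE big1 // => k _.
rewrite -scalemxAr -scalemxAl mxE.
have /ds /is_diag_mxP -> // : (in_tuple s)`_k \in s by rewrite mem_nth.
by rewrite mulr0.
Qed.

End CommutingUnitaries.

Section Representations.
Variable R : realType.
Local Notation C := (CC R).
Local Notation M3 := 'M[C]_3.
Local Notation "M ^t*" := (map_mx Num.conj M^T) (at level 30).
Variable m : {measure set (borelM3 R) -> \bar R}.
Hypothesis haar_m : haar m.
Local Notation EE := (EE m).

Definition EM p q (F : M3 -> 'M[C]_(p, q)) : 'M[C]_(p, q) :=
  \matrix_(i, j) EE (fun g => F g i j).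
Definition contm p q (F : M3 -> 'M[C]_(p, q)) : Prop :=
  forall i j, contf (fun g => F g i j).

Lemma contm_mul p q r (F : M3 -> 'M[C]_(p, q)) (H : M3 -> 'M[C]_(q, r)) :
  contm F -> contm H -> contm (fun g => F g *m H g).
Proof.
move=> cF cH i j; apply: (@contf_ext _ (fun g => \sum_k F g i k * H g k j)).
  by move=> g _; rewrite mxE.
by apply: contf_sum => k _; apply: contf_mul; [exact: cF|exact: cH].
Qed.
Lemma contm_cst p q (A : 'M[C]_(p, q)) : contm (fun=> A).
Proof. by move=> i j; exact: contf_cst. Qed.
Lemma contm_dag p q (F : M3 -> 'M[C]_(p, q)) : contm F -> contm (fun g => (F g)^t*).
Proof.
move=> cF i j; apply: (@contf_ext _ (fun g => (F g j i)^*%R)).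
  by move=> g _; rewrite !mxE.
by apply: contf_conj; exact: cF.
Qed.

Lemma EM_ext p q (F H : M3 -> 'M[C]_(p, q)) : (forall g, SU3 g -> F g = H g) -> EM F = EM H.
Proof.
by move=> e; apply/matrixP => i j; rewrite !mxE; apply: EE_ext => g hg; rewrite e.
Qed.
Lemma EM_mull p q r (A : 'M[C]_(p, q)) (F : M3 -> 'M[C]_(q, r)) : contm F ->
  EM (fun g => A *m F g) = A *m EM F.
Proof.
move=> cF; apply/matrixP => i j; rewrite !mxE.
rewrite (EE_ext m (h := fun g => \sum_k A i k * F g k j)) => [|g _]; last by rewrite mxE.
rewrite (EE_sum haar_m) => [|k _]; last by apply: contf_scale; exact: cF.
by apply: eq_bigr => k _; rewrite (EE_scale haar_m _ (cF _ _)) mxE.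
Qed.
Lemma EM_mulr p q r (A : 'M[C]_(q, r)) (F : M3 -> 'M[C]_(p, q)) : contm F ->
  EM (fun g => F g *m A) = EM F *m A.
Proof.
move=> cF; apply/matrixP => i j; rewrite !mxE.
rewrite (EE_ext m (h := fun g => \sum_k A k j * F g i k)) => [|g _]; last first.
  by rewrite mxE; apply: eq_bigr => k _; rewrite mulrC.
rewrite (EE_sum haar_m) => [|k _]; last by apply: contf_scale; exact: cF.
by apply: eq_bigr => k _; rewrite (EE_scale haar_m _ (cF _ _)) mxE mulrC.
Qed.
Lemma EM_translate p q (F : M3 -> 'M[C]_(p, q)) (h : M3) : contm F -> SU3 h ->
  EM (fun g => F (h *m g)) = EM F.
Proof.
move=> cF hh; apply/matrixP => i j; rewrite !mxE.
exact: (EE_translate haar_m hh (cF i j)).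
Qed.
Lemma trace_EM p (F : M3 -> 'M[C]_p) : contm F -> \tr (EM F) = EE (fun g => \tr (F g)).
Proof.
move=> cF; rewrite /mxtrace (EE_sum haar_m) => [|i _]; last exact: cF.
by apply: eq_bigr => i _; rewrite mxE.
Qed.

(** Averaging the conjugates of A yields an intertwiner [P A], hence the scalar tr A / n. Applied to
    the matrix unit at (i, k) and read at entry (i, k), this gives the mean of W_ii times the
    conjugate of W_kk: 1 / n if i = k, and 0 otherwise. *)
Lemma schur_orthogonality n (W : M3 -> 'M[C]_n) : (0 < n)%N -> contm W ->
  (forall g, SU3 g -> W g \is unitarymx) ->
  (forall g h, SU3 g -> SU3 h -> W (g *m h) = W g *m W h) ->
  (forall A, (forall g, SU3 g -> W g *m A = A *m W g) -> exists z : C, A = z%:M) ->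
  EE (fun g => \tr (W g) * (\tr (W g))^*%R) = 1.
Proof.
move=> n_gt0 cW hB WM irrW.
have n0 : (n%:R : C) != 0 by rewrite pnatr_eq0 -lt0n.
pose P A := EM (fun g => W g *m A *m (W g)^t*).
have cP A : contm (fun g => W g *m A *m (W g)^t*).
  apply: contm_mul; last exact: (contm_dag cW).
  exact: (contm_mul cW (@contm_cst n n A)).
have Pinv A h : SU3 h -> W h *m P A = P A *m W h.
  move=> hh; have uW := unitarymx_unit (hB _ hh).
  have : W h *m P A *m (W h)^t* = P A.
    have c1 := contm_mul (@contm_cst n n (W h)) (cP A).
    rewrite /P -(EM_mull (W h) (cP A)) -(EM_mulr ((W h)^t*) c1).
    rewrite -[RHS](EM_translate (cP A) hh); apply: EM_ext => g hg.
    by rewrite WM // trmx_mul map_mxM /= !mulmxA.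
  rewrite -(invmx_unitary (hB _ hh)) => e.
  by rewrite -{2}e -mulmxA mulVmx // mulmx1.
have Psc A : exists z : C, P A = z%:M.
  by apply: irrW => h hh; exact: Pinv.
have trP A : \tr (P A) = \tr A.
  rewrite trace_EM; last exact: cP.
  rewrite -[RHS](EE_cst haar_m); apply: EE_ext => g hg.
  have uW := unitarymx_unit (hB _ hg).
  by rewrite mxtrace_mulC -(invmx_unitary (hB _ hg)) mulmxA mulVmx // mul1mx.
have PE A : P A = (\tr A / n%:R)%:M.
  have [z ez] := Psc A; have := trP A; rewrite ez mxtrace_scalar => <-.
  by rewrite -[z *+ n]mulr_natr mulfK.
transitivity (\sum_(i < n) \sum_(k < n) P (delta_mx i k) i k).
  have cc i k : contf (fun g => W g i i * (W g k k)^*%R).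
    by apply: contf_mul; [exact: cW|apply: contf_conj; exact: cW].
  rewrite (EE_ext m (h := fun g => \sum_i \sum_k W g i i * (W g k k)^*%R)) => [|g _]; last first.
    rewrite /mxtrace rmorph_sum mulr_suml; apply: eq_bigr => i _.
    by rewrite mulr_sumr.
  rewrite (EE_sum haar_m) => [|i _]; last by apply: contf_sum => k _; exact: cc.
  apply: eq_bigr => i _.
  rewrite (EE_sum haar_m) => [|k _]; last exact: cc.
  apply: eq_bigr => k _; rewrite mxE; apply: EE_ext => g _.
  rewrite mxE (bigD1 k) //= [X in _ + X]big1 ?addr0.
    rewrite [(_ ^t*) k k]mxE [_^T k k]mxE; congr (_ * _).
    rewrite mxE (bigD1 i) //= [X in _ + X]big1 ?addr0; first by rewrite mxE !eqxx mulr1.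
    by move=> l /negbTE li; rewrite mxE li mulr0.
  move=> l /negbTE lk; rewrite mxE big1 ?mul0r // => s _.
  by rewrite mxE lk andbF mulr0.
transitivity (\sum_(i < n) (n%:R^-1 : C)); last first.
  by rewrite sumr_const card_ord -[LHS]mulr_natr mulVf.
have trd i k : \tr (delta_mx i k : 'M[C]_n) = (i == k)%:R.
  rewrite /mxtrace (bigD1 i) //= mxE eqxx /= big1 ?addr0 // => l /negbTE li.
  by rewrite mxE li.
apply: eq_bigr => i _; rewrite (bigD1 i) //= big1 ?addr0.
  by rewrite PE trd eqxx mxE eqxx mulr1n mul1r.
by move=> k /negbTE ki; rewrite PE mxE eq_sym ki mulr0n.
Qed.

Variable V : irrep R.
Local Notation n := (repdim V).
Local Notation rho := (rep V).

Lemma rho_contm : contm rho.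
Proof.
move=> i j g hg; have /subspace_continuousP/(_ g hg) := @rep_continuous _ V.
by move=> /(@cvg_mxP _ _ _ (within_filter_SU3 g)); exact.
Qed.

Lemma rho_inv (g : M3) : SU3 g -> rho g *m rho (invmx g) = 1%:M.
Proof. by move=> hg; rewrite -repM ?mulmxV ?rep1 ?SU3_unit //; exact: SU3_inv. Qed.

Lemma rho_bounded : exists2 M : R, 0 < M & forall g i j, SU3 g -> abs (rho g i j) <= M.
Proof.
have h (ij : 'I_n * 'I_n) : exists M : R, 0 < M /\ forall g, SU3 g -> abs (rho g ij.1 ij.2) <= M.
  by have [M M0 hM] := contf_bounded (@rho_contm ij.1 ij.2); exists M.
have /boolp.choice[M hM] := h.
exists (1 + \sum_ij M ij).
  by rewrite ltr_wpDr // sumr_ge0 // => ij _; case: (hM ij) => /ltW.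
move=> g i j hg; apply: le_trans ((hM (i, j)).2 g hg) _.
rewrite (bigD1 (i, j)) //= addrCA lerDl addr_ge0 //.
by rewrite sumr_ge0 // => ij _; case: (hM ij) => /ltW.
Qed.

(** The vector v is recovered from [v *m rho g] by the inverse of [rho g], whose entries are at most
    M on SU(3). If all entries of [v *m rho g] were below |v_k| / (M n), then |v_k| < |v_k|. *)
Lemma orbit_lower_bound (v : 'rV[C]_n) : v != 0 ->
  exists2 c : R, 0 < c & forall g, SU3 g -> exists j, c <= abs ((v *m rho g) 0 j).
Proof.
move=> /rV0Pn [k vk]; have [M M0 hM] := rho_bounded.
have n0 : 0 < n%:R :> R by rewrite ltr0n repdim_gt0.
exists (abs (v 0 k) / (M * n%:R)); first by rewrite divr_gt0 ?abs_gt0 // mulr_gt0.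
move=> g hg; apply: contrapT => /forallNP h.
have hlt j : abs ((v *m rho g) 0 j) < abs (v 0 k) / (M * n%:R).
  by rewrite ltNge; apply/negP; exact: h.
have e : v 0 k = \sum_j (v *m rho g) 0 j * rho (invmx g) j k.
  by rewrite -[v in LHS]mulmx1 -(rho_inv hg) mulmxA mxE.
have : abs (v 0 k) < abs (v 0 k).
  rewrite {1}e; apply: le_lt_trans (abs_sum _ _ _) _.
  apply: (@lt_le_trans _ _ (\sum_(j < n) abs (v 0 k) / (M * n%:R) * M)).
    apply: ltr_sum => [|j _]; first by apply/hasP; exists (Ordinal (repdim_gt0 V)); rewrite ?mem_index_enum.
    rewrite absM; apply: (@le_lt_trans _ _ (abs ((v *m rho g) 0 j) * M)).
      by rewrite ler_wpM2l ?abs_ge0 // hM //; exact: SU3_inv.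
    by rewrite ltr_pM2r.
  rewrite sumr_const card_ord -[X in X <= _]mulr_natr -!mulrA.
  have -> : (M * n%:R)^-1 * (M * n%:R) = 1 by rewrite mulVf // mulf_neq0 // gt_eqF.
  by rewrite mulr1.
by rewrite ltxx.
Qed.

Definition gram : 'M[C]_n := EM (fun g => rho g *m (rho g)^t*).

Lemma gram_contm : contm (fun g => rho g *m (rho g)^t*).
Proof. by apply: contm_mul; [exact: rho_contm|apply: contm_dag; exact: rho_contm]. Qed.

Lemma gram_invariant (h : M3) : SU3 h -> rho h *m gram *m (rho h)^t* = gram.
Proof.
move=> hh; rewrite /gram -EM_mull; last exact: gram_contm.
rewrite -EM_mulr; last by apply: contm_mul; [exact: contm_cst|exact: gram_contm].
rewrite -[RHS](EM_translate gram_contm hh); apply: EM_ext => g hg.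
by rewrite repM // trmx_mul map_mxM /= !mulmxA.
Qed.

(** Monotonicity of the integral is only weak; the uniform bound of [orbit_lower_bound] makes the
    averaged form at least c^2, hence strictly positive. *)
Lemma gram_form (v : 'rV[C]_n) : v != 0 ->
  exists2 d : R, 0 < d & (v *m gram *m v^t*) 0 0 = ofreal d.
Proof.
move=> v0; have [c c0 hc] := orbit_lower_bound v0.
pose f g : R := \sum_j abs ((v *m rho g) 0 j) ^+ 2.
have e : (v *m gram *m v^t*) 0 0 = EE (fun g => ofreal (f g)).
  rewrite /gram -EM_mull; last exact: gram_contm.
  rewrite -EM_mulr; last by apply: contm_mul; [exact: contm_cst|exact: gram_contm].
  rewrite mxE; apply: EE_ext => g _.
  rewrite mulmxA -mulmxA.
  have -> : (rho g)^t* *m v^t* = (v *m rho g)^t* by rewrite trmx_mul map_mxM.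
  rewrite mxE /f ofreal_sum; apply: eq_bigr => j _.
  by rewrite [(_ ^t*) j 0]mxE [_^T j 0]mxE mul_conj.
have cfC : contf (fun g => ofreal (f g)).
  apply: (@contf_ext _ (fun g => \sum_j (v *m rho g) 0 j * ((v *m rho g) 0 j)^*%R)).
    by move=> g _; rewrite /f ofreal_sum; apply: eq_bigr => j _; rewrite mul_conj.
  have c1 : contm (fun g => v *m rho g) by apply: contm_mul; [exact: contm_cst|exact: rho_contm].
  by apply: contf_sum => j _; apply: contf_mul; [exact: c1|apply: contf_conj; exact: c1].
exists (ERe m f); last first.
  rewrite e; apply: complex_ext => //=.
  by rewrite (ERe_cst haar_m 0).
apply: (@lt_le_trans _ _ (c ^+ 2)); first by rewrite exprn_gt0.
rewrite -[c ^+ 2](ERe_cst haar_m); apply: (ERe_le haar_m).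
- by apply/subspace_continuousP => g _; exact: cvg_cst.
- exact: (contf_re cfC).
move=> g hg; have [j hj] := hc g hg.
rewrite /f (bigD1 j) //= -[c ^+ 2]addr0 lerD //.
  by rewrite ler_pXn2r // nnegrE ?abs_ge0 // ltW.
by rewrite sumr_ge0 // => i _; exact: sqr_ge0.
Qed.

(** Weyl's averaging trick. With B B^* = [gram], obtained by taking square roots of the eigenvalues,
    the invariance of [gram] under [rho g] says exactly that B^-1 [rho g] B is unitary. *)
Lemma unitarize : exists B : 'M[C]_n, B \in unitmx /\
  forall g, SU3 g -> invmx B *m rho g *m B \is unitarymx.
Proof.
have hermG : gram^t* = gram.
  apply/matrixP => i j; rewrite [LHS]mxE [_^T i j]mxE /gram [in LHS]mxE [RHS]mxE -(EE_conj haar_m); last exact: gram_contm.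
  apply: EE_ext => g _; rewrite !mxE rmorph_sum; apply: eq_bigr => k _.
  by rewrite !mxE rmorphM /= conjCK mulrC.
have nG : gram \is normalmx by apply/normalmxP; rewrite hermG.
have [[U d] /= hU eG] := orthomx_spectral_subproof nG.
have Uu := unitarymx_unit hU.
have iU : invmx U = U ^t* by exact: invmx_unitary.
have eD : U *m gram *m U ^t* = diag_mx d.
  by rewrite eG -iU !mulmxA mulmxV // mul1mx -mulmxA mulmxV // mulmx1.
have hd i : exists2 r : R, 0 < r & d 0 i = ofreal r.
  have v0 : row i U != 0.
    apply/eqP => z; have := congr1 (fun A => (A *m invmx U) 0 i) z.
    rewrite -row_mul mulmxV // mul0mx !mxE eqxx => /eqP; by rewrite oner_eq0.
  have [r r0 er] := gram_form v0; exists r => //; rewrite -er.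
  have := congr1 (fun A : 'M[C]_n => A i i) eD; rewrite [RHS]mxE eqxx mulr1n => <-.
  rewrite -row_mul [RHS]mxE mxE; apply: eq_bigr => k _; rewrite !mxE; congr (_ * _).
have /boolp.choice[r hr] : forall i, exists r : R, 0 < r /\ d 0 i = ofreal r.
  by move=> i; have [r r0 er] := hd i; exists r.
pose S : 'rV[C]_n := \row_i ofreal (Num.sqrt (r i)).
have SS : diag_mx S *m (diag_mx S)^t* = diag_mx d.
  rewrite tr_diag_mx map_diag_mx mulmx_diag; congr diag_mx; apply/rowP => i; rewrite !mxE.
  have [r0 ->] := hr i.
  by rewrite mul_conj abs_ofreal ger0_norm ?sqrtr_ge0 // sqr_sqrtr // ltW.
have Su : diag_mx S \in unitmx.
  rewrite unitmxE det_diag unitfE; apply/prodf_neq0 => i _; rewrite mxE.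
  by rewrite -abs_gt0 abs_ofreal normr_gt0 gt_eqF // sqrtr_gt0; case: (hr i).
exists (U^t* *m diag_mx S); split.
  by rewrite unitmx_mul Su andbT -iU unitmx_inv.
set B := U^t* *m diag_mx S.
have Bu : B \in unitmx by rewrite unitmx_mul Su andbT -iU unitmx_inv.
have BB : B *m B^t* = gram.
  rewrite /B trmx_mul map_mxM /= trmxCK mulmxA -(mulmxA (U^t*)) SS -iU; exact/esym.
have Bdu : B^t* \in unitmx by rewrite map_unitmx unitmx_tr.
clearbody B.
move=> g hg; apply/unitarymxP.
have dag : (invmx B *m rho g *m B)^t* = B^t* *m (rho g)^t* *m invmx (B^t*).
  have e1 : (invmx B)^t* = invmx (B^t*).
    transitivity (map_mx Num.conj (invmx B^T)); last exact: map_invmx.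
    by congr (map_mx _ _); exact: trmx_inv.
  by rewrite -e1 !trmx_mul !map_mxM /= mulmxA.
transitivity (invmx B *m (rho g *m (B *m B^t*) *m (rho g)^t*) *m invmx (B^t*)).
  by rewrite dag !mulmxA.
by rewrite BB gram_invariant // -BB mulmxA mulVmx // mul1mx mulmxV.
Qed.

(** Schur's lemma: the kernel of A - z is stable for any eigenvalue z and nonzero, so it is
    everything. The eigenvalue is taken for the transpose because eigenvectors are row vectors
    there, while the representation acts on columns. *)
Lemma irreducible_scalar (A : 'M[C]_n) : (forall g, SU3 g -> rho g *m A = A *m rho g) ->
  exists z : C, A = z%:M.
Proof.
move=> cA; have [z /eigenvalueP [v vA v0]] := eigenvalue_closed A^T (repdim_gt0 V).
exists z; pose f : 'cV[C]_n -> 'cV[C]_n := mulmx (A - z%:M).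
pose U := lker (linfun (mulmx (A - z%:M) : 'cV[C]_n -> 'cV[C]_n)).
have memU w : (w \in U) = ((A - z%:M) *m w == 0) by rewrite memv_ker lfunE.
have stab : forall g, SU3 g -> forall w, w \in U -> rho g *m w \in U.
  move=> g hg w; rewrite !memU => /eqP h.
  rewrite mulmxA mulmxBl -cA // -scalar_mxC -mulmxBr -mulmxA h mulmx0 //.
have [U0|Uf] := rep_irr stab.
  have : v^T \in U.
    rewrite memU mulmxBl mul_scalar_mx -[A]trmxK -trmx_mul vA linearZ /= subrr //.
  rewrite U0 memv0 => /eqP /(congr1 trmx); rewrite trmxK trmx0 => /eqP.
  by rewrite (negbTE v0).
apply/eqP; rewrite -subr_eq0; apply/eqP/matrixP => i j.
have : delta_mx j 0 \in U by rewrite Uf memvf.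
rewrite memU -colE => /eqP /(congr1 (fun w : 'cV[C]_n => w i 0)).
by rewrite [LHS]mxE => ->; rewrite !mxE.
Qed.

Lemma character_norm : EE (fun g => character V g * (character V g)^*%R) = 1.
Proof.
have [B [Bu hB]] := unitarize.
pose W g := invmx B *m rho g *m B.
have cW : contm W.
  by apply: contm_mul; [apply: contm_mul; [exact: contm_cst|exact: rho_contm]|exact: contm_cst].
have trW g : \tr (W g) = character V g by rewrite /W mxtrace_mulC mulmxA mulmxV // mul1mx.
have WM g h : SU3 g -> SU3 h -> W (g *m h) = W g *m W h.
  by move=> hg hh; rewrite /W repM // !mulmxA mulmxK.
rewrite -(schur_orthogonality (repdim_gt0 V) cW hB WM).
  by apply: EE_ext => g _; rewrite trW.
have WE g : rho g = B *m W g *m invmx B by rewrite /W !mulmxA mulmxV // mul1mx mulmxK.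
clearbody W.
move=> A cA; have [z ez] : exists z : C, B *m A *m invmx B = z%:M.
  apply: irreducible_scalar => g hg.
  have e := WE g.
  by rewrite e !mulmxA !mulmxKV // -!(mulmxA B) cA.
exists z; apply: (can_inj (mulKmx Bu)).
by rewrite scalar_mxC -ez mulmxKV.
Qed.

Lemma rho_codiag (A0 : set M3) : A0 `<=` @SU3 R ->
  (forall s t, A0 s -> A0 t -> s *m t = t *m s) ->
  exists Q : 'M[C]_n, Q \in unitmx /\ forall t, A0 t -> exists2 d : 'rV[C]_n,
    rho t = Q *m diag_mx d *m invmx Q & forall i, abs (d 0 i) = 1.
Proof.
move=> sA cA; have [B [Bu hB]] := unitarize.
pose W g := invmx B *m rho g *m B.
have WM g h : SU3 g -> SU3 h -> W (g *m h) = W g *m W h.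
  by move=> hg hh; rewrite /W repM // !mulmxA mulmxK.
have uW g : SU3 g -> W g \is unitarymx := hB g.
have WE g : W g = invmx B *m rho g *m B by [].
clearbody W.
have [||P uP hP] := @unitary_codiag R n (W @` A0).
- by move=> _ [g hg <-]; apply: uW; exact: sA.
- by move=> _ _ [g hg <-] [h hh <-]; 
  by rewrite -(WM _ _ (sA _ hg) (sA _ hh)) -(WM _ _ (sA _ hh) (sA _ hg)) (cA _ _ hg hh).
have Pu := unitarymx_unit uP.
have iP : invmx P = P^t* by exact: invmx_unitary.
exists (B *m P^t*); split; first by rewrite unitmx_mul Bu -iP unitmx_inv.
move=> t ht; have : is_diag_mx (P *m W t *m P^t*) by apply: hP; exists t.
move=> /diag_mxP [d ed]; exists d.
  have u : B *m P^t* \in unitmx by rewrite unitmx_mul Bu -iP unitmx_inv.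
  have -> : invmx (B *m P^t*) = P *m invmx B.
    by apply: (can_inj (mulKmx u)); rewrite mulmxV // -iP !mulmxA mulmxKV // mulmxV.
  rewrite -ed -iP !mulmxA mulmxKV // mulmxKV // WE !mulmxA mulmxV // mul1mx mulmxK //.
have uWt : W t \is unitarymx by apply: uW; exact: sA.
have uP' : P^t* \is unitarymx by have -> := trmxC_unitary P.
apply: unitary_diag_entries; rewrite -ed.
exact: (mul_unitarymx (mul_unitarymx uP uWt) uP').
Qed.

End Representations.

(** * Tori and their Lie algebras *)

Section CircleCharacters.
Variable R : realType.
Local Notation C := (CC R).

Lemma cis_near1 (z : C) : abs z = 1 -> abs (z - 1) < 1 ->
  exists2 t : R, `|t| < pi / 2 & z = cis t.
Proof.
move=> hz h1; have [t /andP[t1 t2] ez] := cis_surj hz.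
exists t => //; have p0 := pi_gt0 R.
have ct : 0 < cos t.
  have := re_le_abs (z - 1); rewrite ez reD reN /= ler_norml => /andP[h _].
  rewrite -ez in h; lra.
have ct' : 0 < cos `|t| by rewrite cos_norm.
rewrite ltNge; apply/negP => h.
have tp : `|t| <= pi by rewrite ler_norml t1.
have : cos `|t| <= cos (pi / 2).
  rewrite leNgt ltr_cos ?in_itv /= -?leNgt ?h ?normr_ge0 ?tp //.
  by apply/andP; split; lra.
by rewrite cos_pihalf; lra.
Qed.

(** Evaluate f at 2 pi / 2^n. For large n these values have an angle smaller than pi / 2, and
    halving the point halves the angle, so one angle [phi] determines all later ones. Since f(2 pi)
    = 1, a multiple of [phi] is 2 pi k, which identifies the exponent k. The quotient of f by
    [cis t ^ k] is then 1 at all these points, hence on their integer multiples, which are dense. *)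
Lemma circle_hom (f : R -> C) :
  (forall s t, f (s + t) = f s * f t) -> (forall t, abs (f t) = 1) ->
  (f t @[t --> (0 : R)] --> f 0) -> f (pi *+ 2) = 1 ->
  exists k : int, forall t, f t = cis t ^ k.
Proof.
move=> fD f1 fc fp; have p0 := pi_gt0 R.
have f0 : f 0 = 1.
  have n0 : f 0 != 0 by rewrite -abs_gt0 f1.
  by apply: (mulfI n0); rewrite -fD addr0 mulr1.
have fMn t n : f (t *+ n) = f t ^+ n.
  by elim: n => [|n IH]; rewrite ?mulr0n ?expr0 // mulrSr exprSr fD IH.
have near0 (h : R -> C) : (h t @[t --> (0 : R)] --> (1 : C)) -> forall e : R, 0 < e ->
    exists2 d : R, 0 < d & forall t, `|t| < d -> abs (h t - 1) < e.
  move=> hc e e0; have /cvg_absP/(_ e e0) := hc.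
  move=> /nbhs_ballP[d /= d0 hd]; exists d => // t td.
  by apply: (hd t); rewrite /ball /= sub0r normrN.
pose a n : R := pi *+ 2 / 2 ^+ n.
have e2 n : (0 : R) < 2 ^+ n by rewrite exprn_gt0.
have a0 n : 0 < a n by rewrite divr_gt0 // mulr2n; lra.
have aS n : a n = a n.+1 *+ 2.
  rewrite /a exprS mulr2n invfM; have := e2 n; move: (2 ^+ n) => x x0.
  by field; rewrite gt_eqF.
have a2 n : a n *+ (2 ^ n) = pi *+ 2.
  by rewrite -[LHS]mulr_natr natrX divfK // gt_eqF.
have asmall (d : R) : 0 < d -> exists n0, forall n, (n0 <= n)%N -> a n < d.
  move=> d0; have [n0 hn0] : exists n0 : nat, pi *+ 2 / d < n0%:R.
    exists (Num.truncn (pi *+ 2 / d)).+1; exact: truncnS_gt.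
  exists n0 => n hn; rewrite /a ltr_pdivrMr // mulrC -ltr_pdivrMr //.
  apply: lt_le_trans hn0 _; rewrite -natrX ler_nat.
  by apply: leq_trans hn _; exact/ltnW/ltn_expl.
have [d d0 hd] := near0 f (eq_rect _ (fun z => f t @[t --> (0 : R)] --> z) fc _ f0) 1 ltr01.
have [n0 hn0] := asmall d d0.
have fa n : (n0 <= n)%N -> exists2 t : R, `|t| < pi / 2 & f (a n) = cis t.
  move=> hn; apply: cis_near1 => //; apply: hd.
  by rewrite gtr0_norm // hn0.
have [phi hphi ephi] := fa n0 (leqnn n0).
(* The doubled new angle and the old one have the same exponential and differ by less than pi + pi /
   2, below 2 pi, so they are equal. *)
have step j : exists2 t : R, `|t| < pi / 2 & f (a (n0 + j)%N) = cis t /\ t *+ (2 ^ j) = phi.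
  elim: j => [|j [t ht [et e]]]; first by exists phi => //; rewrite addn0 expn0 mulr1n.
  have [t' ht' et'] := fa (n0 + j.+1)%N (leq_addr _ _).
  exists t' => //; split=> //.
  have : cis (t' *+ 2 - t) = 1.
    by rewrite cisB cisMn -et' -fMn addnS -aS et mulfV // cis_neq0.
  move=> /cis_eq1_small h.
  have : t' *+ 2 - t = 0.
    apply: h; apply: le_lt_trans (ler_normB _ _) _; rewrite normrMn !mulr2n; lra.
  by move/eqP; rewrite subr_eq0 => /eqP tt; rewrite expnS mulrnA tt.
have : cis (phi *+ (2 ^ n0)) = 1 by rewrite cisMn -ephi -fMn a2.
move=> /cis_eq1[k hk]; exists k.
pose g t := f t * (cis t ^ k)^-1.
have gD s t : g (s + t) = g s * g t.
  rewrite /g fD cisD exprMz_comm ?unitfE ?cis_neq0 //; last exact: mulrC.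
  by rewrite invfM mulrACA.
have gc : g t @[t --> (0 : R)] --> (1 : C).
  have e : (1 : C) = f 0 * cis (- (0 *~ k)) by rewrite f0 mul0rz oppr0 cis0 mulr1.
  rewrite e; have -> : g = (fun t => f t * cis (- (t *~ k))).
    by apply/funext => t; rewrite /g cisN cisMz.
  have ck : (t * k%:~R : R) @[t --> (0 : R)] --> (0 * k%:~R : R).
    by apply: cvgM; [exact: cvg_id|exact: cvg_cst].
  have ck' : (- (t *~ k) : R) @[t --> (0 : R)] --> (- (0 *~ k) : R).
    rewrite -[0 *~ k]mulrzr; apply: cvgN.
    have -> : (fun t : R => t *~ k) = (fun t : R => t * k%:~R) by apply/funext => t; rewrite mulrzr.
    exact: ck.
  exact: (cvgC_mul fc (cvg_cis ck')).
have ga j : g (a (n0 + j)%N) = 1.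
  have [t _ [et e]] := step j; rewrite /g et -cisMz -cisB.
  suff -> : t - a (n0 + j)%N *~ k = 0 by rewrite cis0.
  have p2 : (2 : R) ^+ (n0 + j) != 0 by rewrite gt_eqF.
  have ea : a (n0 + j)%N * 2 ^+ (n0 + j) = pi *+ 2 by rewrite /a divfK.
  have et2 : t * 2 ^+ (n0 + j) = pi *+ 2 *~ k.
    by rewrite -hk -e -[RHS]mulr_natr -[X in _ = X * _]mulr_natr !natrX exprD; ring.
  by apply: (mulIf p2); rewrite mul0r mulrBl -[_ *~ k]mulrzr mulrAC ea et2 mulrzr subrr.
have gMz s (i : int) : g (s *~ i) = g s ^ i.
  have g00 : g 0 = 1 by rewrite /g f0 cis0 exp1rz invr1 mulr1.
  have gMn n : g (s *+ n) = g s ^+ n.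
    by elim: n => [|n IH]; rewrite ?mulr0n ?expr0 ?g00 // mulrSr exprSr gD IH.
  have gn0 t : g t != 0.
    by apply/eqP => z; have := gD t (- t); rewrite subrr g00 z mul0r => /eqP; rewrite oner_eq0.
  case: i => n; first by rewrite -pmulrn gMn.
  rewrite NegzE mulrNz -pmulrn -exprnN -gMn; apply: (mulfI (gn0 (s *+ n.+1))).
  by rewrite -gD subrr g00 mulfV.
have g1 t : g t = 1.
  apply/eqP; rewrite -subr_eq0 -abs_eq0; apply/eqP/le_anti; rewrite abs_ge0 andbT.
  apply/ler_addgt0Pr => e e0; rewrite add0r.
  have [d' d'0 hd'] := near0 g gc e e0.
  have [n1 hn1] := asmall d' d'0.
  pose b := a (n0 + n1)%N; have b0 : 0 < b := a0 _.
  pose i := Num.floor (t / b).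
  have /andP[i1 i2] := floor_itv (t / b).
  have k2 : t < (i%:~R + 1) * b by rewrite -ltr_pdivrMr // -[1]/(1%:~R) -intrD.
  have k1 : i%:~R * b <= t by rewrite -ler_pdivlMr.
  clearbody i; have gb : g b = 1 by exact: ga.
  have -> : g t = g (t - b *~ i).
    by have := gD (t - b *~ i) (b *~ i); rewrite subrK gMz gb exp1rz mulr1.
  apply/ltW/hd'; rewrite -mulrzr ger0_norm; last by rewrite mulrC; lra.
  have : b < d' by apply: hn1; rewrite leq_addl.
  rewrite [b * _]mulrC; lra.
move=> t; have := g1 t; rewrite /g => h.
have n0' : cis t ^ k != 0 by rewrite expfz_neq0 // cis_neq0.
by rewrite -[LHS](divfK n0') h mul1r.
Qed.

End CircleCharacters.

Section MatrixExponential.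
Variable R : realType.
Local Notation C := (CC R).

Lemma cis_series (t : R) :
  series (fun k : nat => (k`!%:R : C)^-1 * (iu R * ofreal t) ^+ k) n @[n --> \oo] --> cis t.
Proof.
have ii : iu R ^+ 2 = ofreal (-1).
  by apply: complex_ext; rewrite expr2 ?reM ?imM /=; ring.
have ipow (k : nat) : iu R ^+ k = (if odd k then iu R else 1) * ofreal ((-1) ^+ k./2).
  rewrite -[in LHS](odd_double_half k) exprD -mul2n exprM ii -ofrealX.
  by case: (odd k).
have term k : (k`!%:R : C)^-1 * (iu R * ofreal t) ^+ k = (cos_coeff t k +i* sin_coeff t k)%C.
  rewrite exprMn ipow -ofrealX -ofreal_nat -ofrealV /cos_coeff /sin_coeff /=.
  have hk : odd k -> ((k.-1)./2 = k./2)%N.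
    by case: k => [//|k] /= /negbTE ok; rewrite uphalf_half ok.
  case: (odd k) hk => [/(_ isT) ->|_] /=;
    apply: complex_ext; rewrite ?(reM, imM) /= -?exprnP; ring.
apply: cvg_complex.
  have -> : (fun n => re (series (fun k : nat => (k`!%:R : C)^-1 * (iu R * ofreal t) ^+ k) n)) = series (cos_coeff t).
    apply/funext => n; rewrite /series /= re_sum; apply: eq_bigr => k _.
    by rewrite term.
  rewrite /re /= cos.unlock; exact: (is_cvg_series_cos_coeff (x := t)).
have -> : (fun n => im (series (fun k : nat => (k`!%:R : C)^-1 * (iu R * ofreal t) ^+ k) n)) = series (sin_coeff t).
  apply/funext => n; rewrite /series /= im_sum; apply: eq_bigr => k _.
  by rewrite term.
rewrite /im /= sin.unlock; exact: (is_cvg_series_sin_coeff (x := t)).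
Qed.

Lemma lim_mx (f : nat -> 'M[C]_3) (A : 'M[C]_3) : f n @[n --> \oo] --> A -> lim (f @ \oo) = A.
Proof. by move=> h; apply: (@cvg_lim _ (@norm_hausdorff C 'M[C]_3)). Qed.

Lemma expmx_diag (u : 'M[C]_3) (t0 t1 t2 : R) : u \in unitmx ->
  expmx (u *m dg3 (iu R * ofreal t0) (iu R * ofreal t1) (iu R * ofreal t2) *m invmx u) =
  u *m dg3 (cis t0) (cis t1) (cis t2) *m invmx u.
Proof.
move=> hu; apply: lim_mx.
set X := dg3 _ _ _.
have pw k : (u *m X *m invmx u) ^+ k = u *m X ^+ k *m invmx u.
  elim: k => [|k IH]; first by rewrite !expr0 mulmx1 mulmxV.
  by rewrite !exprS IH -!mulmxE !mulmxA mulmxKV.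
have pwd (d : 'rV[C]_3) k : (diag_mx d) ^+ k = diag_mx (\row_i d 0 i ^+ k).
  elim: k => [|k IH].
    by rewrite expr0; apply/matrixP => i j; rewrite !mxE expr0.
  rewrite exprS IH -mulmxE mulmx_diag; congr diag_mx; apply/rowP => i.
  by rewrite !mxE exprS.
have -> : series (fun k : nat => (k`!%:R : C)^-1 *: (u *m X *m invmx u) ^+ k) =
   (fun n => u *m series (fun k : nat => (k`!%:R : C)^-1 *: X ^+ k) n *m invmx u).
  apply/funext => n; rewrite /series /= mulmx_sumr mulmx_suml; apply: eq_bigr => k _.
  by rewrite pw -scalemxAr -scalemxAl.
apply: cvg_mulmx; last exact: cvg_cst.
apply: cvg_mulmx; first exact: cvg_cst.
apply/cvg_mxP => i j.
have -> : (fun n => series (fun k : nat => (k`!%:R : C)^-1 *: X ^+ k) n i j) =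
  (fun n => if i == j then series (fun k : nat => (k`!%:R : C)^-1 *
      (iu R * ofreal (if i == 0 :> nat then t0 else if i == 1%N :> nat then t1 else t2)) ^+ k) n else 0).
  apply/funext => n; rewrite /series /= summxE; case: (i =P j) => [<-|ij].
    apply: eq_bigr => k _; rewrite mxE pwd !mxE eqxx mulr1n; congr (_ * _ ^+ _).
    by case: ifP => // _; case: ifP.
  rewrite big1 // => k _; rewrite mxE pwd !mxE.
  by case: (i =P j) => // _; rewrite mulr0n mulr0.
rewrite !mxE; case: (i =P j) => [_|_]; last exact: cvg_cst.
rewrite mulr1n; have -> : (if i == 0 :> nat then cis t0 else if i == 1%N :> nat then cis t1 else cis t2) =
   cis (if i == 0 :> nat then t0 else if i == 1%N :> nat then t1 else t2).
  by case: ifP => // _; case: ifP.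
exact: cis_series.
Qed.

(* Entrywise, the tail of the exponential series is dominated by the real one. *)
Lemma expmx_entries (X : 'M[C]_3) : exists2 M : R, 0 < M & forall s : R,
  forall i j, abs (expmx (ofreal s *: X) i j - (i == j)%:R - ofreal s * X i j)
    <= (`|s| * M) ^+ 2 * expR (`|s| * M).
Proof.
pose M : R := 1 + \sum_i \sum_j abs (X i j).
have M0 : 0 < M.
  by rewrite ltr_wpDr // sumr_ge0 // => i _; apply: sumr_ge0 => j _; exact: abs_ge0.
have rowM i : \sum_j abs (X i j) <= M.
  rewrite /M [X in _ <= 1 + X](bigD1 i) //= addrCA lerDl addr_ge0 // sumr_ge0 // => k _.
  by apply: sumr_ge0 => j _; exact: abs_ge0.
have powM k i j : abs ((X ^+ k) i j) <= M ^+ k.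
  elim: k i j => [|k IH] i j.
    by rewrite !expr0 mxE; case: eqP; rewrite ?abs1 ?abs0.
  rewrite !exprS -mulmxE mxE; apply: le_trans (abs_sum _ _ _) _.
  apply: (@le_trans _ _ (\sum_l abs (X i l) * M ^+ k)).
    by apply: ler_sum => l _; rewrite absM ler_wpM2l ?abs_ge0.
  by rewrite -mulr_suml ler_wpM2r // exprn_ge0 // ltW.
have key (y : R) k : 0 <= y -> y ^+ k.+2 / (k.+2)`!%:R <= y ^+ 2 * (y ^+ k / k`!%:R).
  move=> y0; rewrite mulrA -exprD add2n ler_wpM2l ?exprn_ge0 //.
  rewrite lef_pV2 ?posrE ?ltr0n ?fact_gt0 // ler_nat !factS.
  by have := fact_gt0 k; nia.
exists M => // s; set x := `|s| * M.
have x0 : 0 <= x by rewrite mulr_ge0 // ltW.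
pose c i j k : C := (k`!%:R : C)^-1 * (ofreal s ^+ k * (X ^+ k) i j).
have cb i j k : abs (c i j k) <= exp_coeff x k.
  rewrite /c !absM absV absX abs_ofreal -ofreal_nat abs_ofreal normr_nat.
  rewrite /exp_coeff /= exprMn mulrC ler_pM2r ?invr_gt0 ?ltr0n ?fact_gt0 //.
  by rewrite ler_wpM2l // exprn_ge0.
have ecvg : cvgn (series (exp_coeff x)) := is_cvg_series_exp_coeff _.
have e0 k : 0 <= exp_coeff x k by apply: exp_coeff_ge0.
have cvg_r i j (f : nat -> R) : (forall k, `|f k| <= abs (c i j k)) -> cvgn (series f).
  move=> hf; apply: normed_cvg; apply: (series_le_cvg _ e0 _ ecvg) => k /=.
    exact: normr_ge0.
  exact: le_trans (hf k) (cb i j k).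
have tail i j n : abs (series (c i j) n.+2 - (i == j)%:R - ofreal s * X i j) <= x ^+ 2 * expR x.
  have -> : series (c i j) n.+2 - (i == j)%:R - ofreal s * X i j = \sum_(k < n) c i j k.+2.
    rewrite /series /= big_mkord !big_ord_recl /= /c /bump /= !fact0 !factS fact0 !invr1.
    rewrite !expr0 !expr1 mxE !mul1r ?invr1 ?mul1r.
    ring.
  apply: le_trans (abs_sum _ _ _) _.
  apply: (@le_trans _ _ (x ^+ 2 * series (exp_coeff x) n)).
    rewrite /series /= big_mkord mulr_sumr; apply: ler_sum => k _.
    by apply: le_trans (cb _ _ _) _; exact: key.
  rewrite ler_wpM2l ?sqr_ge0 //; apply: nondecreasing_cvgn_le => //.
  by apply: nondecreasing_series => k _ _; exact: e0.
have lim_ij (ij : 'I_3 * 'I_3) : exists L : C, series (c ij.1 ij.2) n @[n --> \oo] --> L.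
  case: ij => i j /=.
  have [Lr hLr] : exists L : R, series (fun k => re (c i j k)) n @[n --> \oo] --> L.
    by apply/cvg_ex; apply: (cvg_r i j) => k; exact: re_le_abs.
  have [Li hLi] : exists L : R, series (fun k => im (c i j k)) n @[n --> \oo] --> L.
    by apply/cvg_ex; apply: (cvg_r i j) => k; exact: im_le_abs.
  exists (Lr +i* Li)%C; apply: cvg_complex.
    have -> : (fun n => re (series (c i j) n)) = series (fun k => re (c i j k)).
      by apply/funext => n; rewrite /series /= re_sum.
    exact: hLr.
  have -> : (fun n => im (series (c i j) n)) = series (fun k => im (c i j k)).
    by apply/funext => n; rewrite /series /= im_sum.
  exact: hLi.
have /boolp.choice[L hL] := lim_ij.
have eL : expmx (ofreal s *: X) = \matrix_(i, j) L (i, j).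
  apply: lim_mx; apply/cvg_mxP => i j; rewrite mxE.
  have -> : (fun n => series (fun k : nat => (k`!%:R : C)^-1 *: (ofreal s *: X) ^+ k) n i j) =
      series (c i j).
    apply/funext => n; rewrite /series /= summxE; apply: eq_bigr => k _.
    by rewrite exprZn !mxE.
  exact: (hL (i, j)).
move=> i j; rewrite eL mxE; have /cvg_absP hij := hL (i, j).
apply/ler_addgt0Pr => e e_gt0; have [n0 _ hn0] := hij e e_gt0.
have := hn0 n0.+2 (leq_trans (leqnSn _) (leqnSn _)); rewrite /= => h1.
have h2 := tail i j n0.
have h3 := absD (L (i, j) - series (c i j) n0.+2)
  (series (c i j) n0.+2 - (i == j)%:R - ofreal s * X i j).
have e3 : L (i, j) - series (c i j) n0.+2 + (series (c i j) n0.+2 - (i == j)%:R - ofreal s * X i j)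
  = L (i, j) - (i == j)%:R - ofreal s * X i j by ring.
rewrite e3 in h3; rewrite absC in h1; lra.
Qed.

End MatrixExponential.

(** * Maximal tori are conjugate to the diagonal torus *)

Section MaximalTori.
Variable R : realType.
Local Notation C := (CC R).
Local Notation M3 := 'M[C]_3.
Local Notation "M ^t*" := (map_mx Num.conj M^T) (at level 30).
Implicit Types (u g X Y : M3) (T : set M3).

Definition o0 : 'I_3 := ord0.
Definition o1 : 'I_3 := lift ord0 ord0.
Definition o2 : 'I_3 := lift ord0 (lift ord0 ord0).

Lemma ord3_ind (P : 'I_3 -> Prop) : P o0 -> P o1 -> P o2 -> forall i, P i.
Proof.
move=> h0 h1 h2 [[|[|[|//]]] hi].
- by have -> : Ordinal hi = o0 by exact: val_inj.
- by have -> : Ordinal hi = o1 by exact: val_inj.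
- by have -> : Ordinal hi = o2 by exact: val_inj.
Qed.

Definition conj_torus u : set M3 :=
  [set g | exists x y w : C, torus3 x y w /\ g = u *m dg3 x y w *m invmx u].

Lemma torus3_cis (x y w : C) : torus3 x y w ->
  exists t0 t1 : R, [/\ x = cis t0, y = cis t1 & w = cis (- (t0 + t1))].
Proof.
move=> [hx hy hw h]; have [t0 _ e0] := cis_surj hx; have [t1 _ e1] := cis_surj hy.
exists t0, t1; split=> //.
have xy0 : x * y != 0 by rewrite mulf_neq0 // abs1_neq0.
apply: (mulfI xy0); rewrite h e0 e1 cisN cisD; apply/esym/mulfV.
by rewrite mulf_neq0 ?cis_neq0.
Qed.

Lemma cis_torus3 (t0 t1 : R) : torus3 (cis t0) (cis t1) (cis (- (t0 + t1)) : C).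
Proof.
by split; rewrite ?abs_cis // -!cisD subrr cis0.
Qed.

Lemma dg3_mul (x y w x' y' w' : C) :
  dg3 x y w *m dg3 x' y' w' = dg3 (x * x') (y * y') (w * w').
Proof.
rewrite mulmx_diag; congr diag_mx; apply/rowP => i; rewrite !mxE.
by case: ifP => // _; case: ifP.
Qed.
Lemma dg3_1 : dg3 1 1 1 = 1%:M :> M3.
Proof.
rewrite -diag_const_mx; congr diag_mx; apply/rowP => i; rewrite !mxE.
by case: ifP => // _; case: ifP.
Qed.

Lemma cvg_dg3 (D : Type) (F : set_system D) (FF : Filter F) (x y w : D -> C) (x0 y0 w0 : C) :
  x n @[n --> F] --> x0 -> y n @[n --> F] --> y0 -> w n @[n --> F] --> w0 ->
  dg3 (x n) (y n) (w n) @[n --> F] --> dg3 x0 y0 w0.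
Proof.
move=> hx hy hw; apply/cvg_mxP => i j.
pose f (i : 'I_3) (x y w : C) : C :=
  if i == 0 :> nat then x else if i == 1%N :> nat then y else w.
have E a b c : dg3 a b c i j = f j a b c * (i == j)%:R :> C.
  by rewrite 2!mxE mulr_natr; have [<-|] := eqVneq i j.
have -> : (fun n => dg3 (x n) (y n) (w n) i j) =
  (fun n => f j (x n) (y n) (w n) * (i == j)%:R) by apply/funext => n; exact: E.
rewrite E; have hf : f j (x n) (y n) (w n) @[n --> F] --> f j x0 y0 w0.
  rewrite /f; case: (nat_of_ord j == 0%N); first exact: hx.
  by case: (nat_of_ord j == 1%N); [exact: hy|exact: hw].
exact: (cvgC_mul hf (cvg_cst ((i == j)%:R : C))).
Qed.

Lemma diag_conj_torus u g : SU3 u -> SU3 g ->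
  is_diag_mx (invmx u *m g *m u) -> conj_torus u g.
Proof.
move=> hu hg /diag_mxP[d ed].
have uu := SU3_unit hu.
have [hD dD] : SU3 (diag_mx d).
  rewrite -ed; exact: (SU3_mul (SU3_mul (SU3_inv hu) hg) hu).
have hd := unitary_diag_entries hD.
exists (d 0 o0), (d 0 o1), (d 0 o2); split.
  by split; rewrite ?hd // -dD det_diag !big_ord_recl big_ord0 mulr1 mulrA.
by rewrite -diag_mx_dg3 -ed !mulmxA mulmxV // mul1mx mulmxK.
Qed.

Lemma conj_torusE u g : SU3 u ->
  conj_torus u g <-> SU3 g /\ is_diag_mx (invmx u *m g *m u).
Proof.
move=> hu; split=> [[x [y [w [ht ->]]]]|[hg hD]]; last exact: diag_conj_torus.
have uu := SU3_unit hu.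
split; first exact: (SU3_mul (SU3_mul hu (dg3_SU3 ht)) (SU3_inv hu)).
by rewrite !mulmxA mulVmx // mul1mx mulmxKV // diag_mx_is_diag.
Qed.

Lemma conj_mulmx u (A B : M3) : u \in unitmx ->
  (u *m A *m invmx u) *m (u *m B *m invmx u) = u *m (A *m B) *m invmx u.
Proof. by move=> uu; rewrite -!mulmxA mulKmx. Qed.

Lemma conj_torus_is_torus u : SU3 u -> torus (conj_torus u).
Proof.
move=> hu; have uu := SU3_unit hu.
have sub : conj_torus u `<=` @SU3 R by move=> g /(conj_torusE _ hu) [].
have com g h : conj_torus u g -> conj_torus u h -> g *m h = h *m g.
  move=> [x [y [w [_ ->]]]] [x' [y' [w' [_ ->]]]].
  rewrite !(conj_mulmx _ _ uu) !dg3_mul.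
  by rewrite [x' * _]mulrC [y' * _]mulrC [w' * _]mulrC.
split=> //.
- exists 1, 1, 1; split; first by split; rewrite ?abs1 ?mul1r.
  by rewrite dg3_1 mulmx1 mulmxV.
- move=> g h hg hh; have hh' := sub _ hh; have hu' := SU3_unit hh'.
  apply/(conj_torusE _ hu); split; first exact: SU3_mul (sub _ hg) (SU3_inv hh').
  move: hg hh => [x [y [w [ht eg]]]] [x' [y' [w' [ht' eh]]]].
  have [hx hy hw h1] := ht'.
  have -> : invmx h = u *m dg3 x'^-1 y'^-1 w'^-1 *m invmx u.
    apply: (can_inj (mulKmx hu')); rewrite mulmxV // eh (conj_mulmx _ _ uu).
    rewrite dg3_mul (mulfV (abs1_neq0 hx)) (mulfV (abs1_neq0 hy)) (mulfV (abs1_neq0 hw)).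
    by rewrite dg3_1 mulmx1 mulmxV.
  rewrite eg (conj_mulmx _ _ uu) !mulmxA mulVmx // mul1mx mulmxKV // dg3_mul.
  exact: diag_mx_is_diag.
split.
  have -> : conj_torus u = @SU3 R `&` [set g | invmx u *m g *m u =
      diag_mx (\row_i (invmx u *m g *m u) i i)].
    apply/seteqP; split=> g /=.
      move=> /(conj_torusE _ hu) [hg /diag_mxP[d ->]]; split=> //.
      by congr diag_mx; apply/rowP => i; rewrite !mxE eqxx mulr1n.
    by move=> [hg e]; apply/(conj_torusE _ hu); rewrite e diag_mx_is_diag.
  apply: closedI; first exact: SU3_closed.
  have cf : continuous (fun g : M3 => invmx u *m g *m u).
    move=> g; apply: (@cvg_mulmx _ _ _ (nbhs_filter g) 3 3 3 (fun g => invmx u *m g) (fun=> u)).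
      apply: (@cvg_mulmx _ _ _ (nbhs_filter g) 3 3 3 (fun=> invmx u) (fun g => g)).
        exact: cvg_cst.
      exact: cvg_nbhs_id.
    exact: cvg_cst.
  apply: closed_eq_fun; [exact: (@norm_hausdorff C 'M[C]_3)|exact: cf|].
  move=> g; apply/(@cvg_mxP _ _ _ (nbhs_filter g)) => i j.
  have E (h : M3) : diag_mx (\row_i (invmx u *m h *m u) i i) i j =
      (invmx u *m h *m u) i i * (i == j)%:R by rewrite 2!mxE mulr_natr.
  have -> : (fun h : M3 => diag_mx (\row_i (invmx u *m h *m u) i i) i j) =
     (fun h : M3 => (invmx u *m h *m u) i i * (i == j)%:R) by apply/funext => h; exact: E.
  rewrite E.
  have /(@cvg_mxP _ _ _ (nbhs_filter g))/(_ i i) ci := cf g.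
  exact: (cvgC_mul ci (cvg_cst ((i == j)%:R : C))).
(* Connectedness: the torus is the union of its one-parameter curves, all of which pass through the
   identity at s = 0. *)
have -> : conj_torus u = \bigcup_(t in [set: R * R])
   ((fun s : R => u *m dg3 (cis (s * t.1)) (cis (s * t.2)) (cis (- (s * t.1 + s * t.2))) *m invmx u) @` [set: R]).
  apply/seteqP; split=> g.
    move=> [x [y [w [/torus3_cis [t0 [t1 [-> -> ->]]] ->]]]].
    exists (t0, t1); first exact: I.
    by exists 1; [exact: I|rewrite (mul1r t0) (mul1r t1)].
  move=> [t _ [s _ <-]].
  by exists (cis (s * t.1)), (cis (s * t.2)), (cis (- (s * t.1 + s * t.2))); split => //; exact: cis_torus3.
apply: bigcup_connected => [|t _].
  exists 1%:M => t _; exists 0 => //.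
  by rewrite !mul0r addr0 oppr0 cis0 dg3_1 mulmx1 mulmxV.
apply: connected_continuous_connected.
  by apply/connected_intervalP; move=> x y _ _ z _.
apply: continuous_subspaceT => s.
have cl (a : R) : (s' * a : R) @[s' --> s] --> (s * a : R).
  by apply: cvgM; [exact: cvg_id|exact: cvg_cst].
have cd : dg3 (cis (s' * t.1)) (cis (s' * t.2)) (cis (- (s' * t.1 + s' * t.2))) @[s' --> s] -->
    dg3 (cis (s * t.1)) (cis (s * t.2)) (cis (- (s * t.1 + s * t.2))).
  apply: cvg_dg3; apply: cvg_cis; [exact: cl|exact: cl|].
  by apply: cvgN; apply: cvgD; exact: cl.
exact: (cvg_mulmx (cvg_mulmx (cvg_cst u) cd) (cvg_cst (invmx u))).
Qed.

(** A torus is a commuting family of unitary matrices, hence simultaneously diagonal in some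
    orthonormal basis; it lies in the corresponding diagonal torus, and maximality gives
    equality. *)
Lemma maximal_torus_conj T : maximal_torus T -> exists2 u, SU3 u & T = conj_torus u.
Proof.
move=> [[sT _ _ cT _] maxT].
have [P uP hP] : exists2 P : M3, P \is unitarymx & forall A, T A -> is_diag_mx (P *m A *m P^t*).
  by apply: unitary_codiag => [A /sT[]|].
have Pu := unitarymx_unit uP.
have iP : invmx P = P^t* by exact: invmx_unitary.
have uP' : P^t* \is unitarymx by have -> := trmxC_unitary P.
have [z [hz hu]] := unitary_to_SU3 uP'.
have z0 := abs1_neq0 hz.
exists (z *: P^t*) => //.
apply/esym; apply: maxT; first exact: conj_torus_is_torus.
move=> g hg; apply/(conj_torusE _ hu); split; first exact: sT.
have -> : invmx (z *: P^t*) = z^-1 *: P.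
  have hzu : z *: P^t* \in unitmx by exact: SU3_unit.
  apply: (can_inj (mulKmx hzu)); rewrite mulmxV // -scalemxAl -scalemxAr scalerA mulfV //.
  by rewrite scale1r -iP mulVmx.
by rewrite -!scalemxAl -scalemxAr scalerA mulVf // scale1r; exact: hP.
Qed.

Definition lie_elt u (t0 t1 : R) : M3 :=
  u *m dg3 (iu R * ofreal t0) (iu R * ofreal t1) (iu R * ofreal (- (t0 + t1))) *m invmx u.

Lemma expmx_lie u t0 t1 : SU3 u ->
  expmx (lie_elt u t0 t1) = u *m dg3 (cis t0) (cis t1) (cis (- (t0 + t1))) *m invmx u.
Proof. by move=> hu; rewrite expmx_diag // SU3_unit. Qed.

Lemma lie_elt_scale u (s t0 t1 : R) : ofreal s *: lie_elt u t0 t1 = lie_elt u (s * t0) (s * t1).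
Proof.
rewrite /lie_elt scalemxAl scalemxAr; congr (_ *m _ *m _).
apply/matrixP => i j; rewrite !mxE mulrnAr; congr (_ *+ _).
by case: ifP => _; [|case: ifP => _]; rewrite ?ofrealN ?ofrealD ?ofrealM; ring.
Qed.

Lemma lie_elt_Lie u t0 t1 : SU3 u -> Lie (conj_torus u) (lie_elt u t0 t1).
Proof.
move=> hu s; rewrite lie_elt_scale expmx_lie //.
by exists (cis (s * t0)), (cis (s * t1)), (cis (- (s * t0 + s * t1))); split => //; exact: cis_torus3.
Qed.

(** With s = 1 / (n+1), the second-order remainder multiplied by n+1 is at most s M^2 e^M. This
    recovers X from the one-parameter group that it generates. *)
Lemma difference_quotient X :
  ((n.+1)%:R : C) *: (expmx (ofreal (n.+1)%:R^-1 *: X) - 1%:M) @[n --> \oo] --> X.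
Proof.
have [M M0 hM] := expmx_entries X.
apply/cvg_mxP => i j; apply/cvg_absP => e e0.
pose K := M ^+ 2 * expR M.
have K0 : 0 <= K by rewrite mulr_ge0 ?sqr_ge0 ?expR_ge0.
have [n0 hn0] : exists n0 : nat, K / e < n0%:R.
  by exists (Num.truncn (K / e)).+1; exact: truncnS_gt.
exists n0 => // n /= hn.
set s : R := (n.+1)%:R^-1.
have n1 : 0 < (n.+1)%:R :> R by rewrite ltr0n.
have s0 : 0 < s by rewrite invr_gt0.
have s1 : s <= 1 by rewrite invf_le1 // ler1n.
have := hM s i j; rewrite (gtr0_norm s0) => h.
rewrite !mxE.
have -> : (n.+1)%:R * (expmx (ofreal s *: X) i j - (i == j)%:R) - X i j =
  ofreal (n.+1)%:R * (expmx (ofreal s *: X) i j - (i == j)%:R - ofreal s * X i j).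
  have e1 : ofreal (n.+1)%:R * ofreal s = 1 by rewrite -ofrealM mulfV ?gt_eqF.
  by rewrite [in RHS]mulrBr mulrA e1 mul1r ofreal_nat.
rewrite absM abs_ofreal (gtr0_norm n1).
have sn : (n.+1)%:R * s = 1 by rewrite mulfV // gt_eqF.
apply: (@le_lt_trans _ _ ((n.+1)%:R * ((s * M) ^+ 2 * expR (s * M)))).
  by rewrite ler_wpM2l // ltW.
apply: (@le_lt_trans _ _ (s * K)).
  have -> : (n.+1)%:R * ((s * M) ^+ 2 * expR (s * M)) = ((n.+1)%:R * s) * (s * (M ^+ 2 * expR (s * M))) by ring.
  rewrite sn mul1r /K.
  rewrite ler_wpM2l ?(ltW s0) // ler_wpM2l ?sqr_ge0 // ler_expR.
  by rewrite ler_piMl // ltW.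
rewrite mulrC ltr_pdivrMr // mulrC -ltr_pdivrMr //.
by apply: lt_trans hn0 _; rewrite ltr_nat ltnS.
Qed.

(** In the basis given by u, X is the limit Y of (n+1)(E_n - 1) with E_n diagonal, unitary and of
    determinant 1. The three properties of E_n pass to the limit: Y is diagonal, its entries are
    imaginary, and its trace is 0. *)
Lemma Lie_conj_torus u : SU3 u ->
  Lie (conj_torus u) = [set X | exists t0 t1 : R, X = lie_elt u t0 t1].
Proof.
move=> hu; have uu := SU3_unit hu.
apply/seteqP; split=> X; last by move=> [t0 [t1 ->]]; exact: lie_elt_Lie.
move=> hX; pose E n := invmx u *m expmx (ofreal (n.+1)%:R^-1 *: X) *m u.
pose Y := invmx u *m X *m u.
have eX : X = u *m Y *m invmx u by rewrite /Y !mulmxA mulmxV // mul1mx mulmxK.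
have /boolp.choice[z hz] : forall n, exists t : C * C * C, torus3 t.1.1 t.1.2 t.2 /\
    E n = dg3 t.1.1 t.1.2 t.2.
  move=> n; have [x [y [w [ht e]]]] := hX (n.+1)%:R^-1.
  exists (x, y, w); split=> //=.
  by rewrite /E e !mulmxA mulVmx // mul1mx mulmxKV.
have cE : ((n.+1)%:R : C) *: (E n - 1%:M) @[n --> \oo] --> Y.
  have -> : (fun n => ((n.+1)%:R : C) *: (E n - 1%:M)) =
     (fun n => invmx u *m (((n.+1)%:R : C) *: (expmx (ofreal (n.+1)%:R^-1 *: X) - 1%:M)) *m u).
    apply/funext => n; rewrite -scalemxAr -scalemxAl mulmxBr mulmxBl mulmx1 mulVmx //.
  apply: cvg_mulmx; last exact: cvg_cst.
  apply: cvg_mulmx; first exact: cvg_cst.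
  exact: difference_quotient.
have cEij i j : (n.+1)%:R * (E n i j - (i == j)%:R) @[n --> \oo] --> Y i j.
  have /cvg_mxP/(_ i j) := cE.
  have -> // : (fun n => ((n.+1)%:R *: (E n - 1%:M)) i j) = (fun n => (n.+1)%:R * (E n i j - (i == j)%:R)).
  by apply/funext => n; rewrite !mxE.
have Yoff i j : i != j -> Y i j = 0.
  move=> ij; apply: (cvgC_unique (cEij i j)).
  have -> : (fun n => (n.+1)%:R * (E n i j - (i == j)%:R)) = (fun=> 0 : C).
    apply/funext => n; rewrite (hz n).2 !mxE (negbTE ij) subr0 mulr0n mulr0 //.
  exact: cvg_cst.
have inv0 : ((n.+1)%:R^-1 : C) @[n --> \oo] --> (0 : C).
  have h : ((n.+1)%:R^-1 : R) @[n --> \oo] --> (0 : R) := @cvg_harmonic R.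
  have : ofreal ((n.+1)%:R^-1 : R) @[n --> \oo] --> (ofreal 0 : C) by exact: (cvg_ofreal h).
  rewrite ofreal0.
  have -> // : (fun n => ofreal ((n.+1)%:R^-1 : R)) = (fun n => (n.+1)%:R^-1 : C).
  by apply/funext => n; rewrite ofrealV ofreal_nat.
have E1 i : E n i i @[n --> \oo] --> (1 : C).
  have e n : (n.+1)%:R^-1 * ((n.+1)%:R * (E n i i - (i == i)%:R)) + 1 = E n i i.
    by rewrite eqxx mulKf ?subrK // pnatr_eq0.
  have h : (n.+1)%:R^-1 * ((n.+1)%:R * (E n i i - (i == i)%:R)) + 1 @[n --> \oo] --> (0 * Y i i + 1 : C).
    exact: (cvgC_add (cvgC_mul inv0 (cEij i i)) (cvg_cst (1 : C))).
  have ef : (fun n => (n.+1)%:R^-1 * ((n.+1)%:R * (E n i i - (i == i)%:R)) + 1) = (fun n => E n i i).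
    by apply/funext => n; exact: e.
  by move: h; rewrite ef mul0r add0r.
have E_abs n i : abs (E n i i) = 1.
  have [[h0 h1 h2 _] ->] := hz n; rewrite mxE eqxx mulr1n mxE.
  by case: ifP => _ //; case: ifP.
have Yre i : re (Y i i) = 0.
  (* Limit of (n+1)(E conj(E) - 1) = 0, written as (n+1)(E - 1) conj(E) plus the conjugate of
     (n+1)(E - 1). *)
  have e : Y i i * (1^*)%R + (Y i i)^*%R = 0.
    apply: (cvgC_unique (cvgC_add (cvgC_mul (cEij i i) (cvg_conj (E1 i))) (cvg_conj (cEij i i)))).
    have -> : (fun n => (n.+1)%:R * (E n i i - (i == i)%:R) * (E n i i)^*%R +
       ((n.+1)%:R * (E n i i - (i == i)%:R))^*%R) = (fun=> 0 : C).
      apply/funext => n; rewrite eqxx rmorphM rmorphB /= conjC1 conjC_nat.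
      have := mul_conj (E n i i); rewrite E_abs expr1n ofreal1 => h.
      transitivity ((n.+1)%:R * (E n i i * (E n i i)^*%R - 1) : C); first ring.
      by rewrite h subrr mulr0.
    exact: cvg_cst.
  have := congr1 (@re R) e; rewrite conjC1 mulr1 reD re_conj -mulr2n => /eqP.
  by rewrite mulrn_eq0 /= => /eqP.
have Ytr : Y o0 o0 + Y o1 o1 + Y o2 o2 = 0.
  pose q i n : C := (n.+1)%:R * (E n i i - 1).
  have cq i : q i n @[n --> \oo] --> Y i i.
    by have := cEij i i; rewrite eqxx.
  (* The product of the three eigenvalues minus 1 is telescoped, changing one factor at a time into
     1. *)
  have e : Y o0 o0 * 1 * 1 + Y o1 o1 * 1 + Y o2 o2 = 0.
    apply: (cvgC_unique (cvgC_add (cvgC_add (cvgC_mul (cvgC_mul (cq o0) (E1 o1)) (E1 o2))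
      (cvgC_mul (cq o1) (E1 o2))) (cq o2))).
    have -> : (fun n => q o0 n * E n o1 o1 * E n o2 o2 + q o1 n * E n o2 o2 + q o2 n) = (fun=> 0 : C).
      apply/funext => n; have [[_ _ _ h] ez] := hz n.
      have h' : E n o0 o0 * E n o1 o1 * E n o2 o2 = 1 by rewrite ez !mxE /=.
      transitivity ((n.+1)%:R * (E n o0 o0 * E n o1 o1 * E n o2 o2 - 1) : C); first by rewrite /q; ring.
      by rewrite h' subrr mulr0.
    exact: cvg_cst.
  by rewrite -e !mulr1.
have Yi i : Y i i = iu R * ofreal (im (Y i i)).
  by rewrite {1}[Y i i]complexE Yre ofreal0 add0r.
exists (im (Y o0 o0)), (im (Y o1 o1)); rewrite eX /lie_elt; congr (_ *m _ *m _).
have Y2 : Y o2 o2 = iu R * ofreal (- (im (Y o0 o0) + im (Y o1 o1))).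
  have e2 : Y o2 o2 = - (Y o0 o0 + Y o1 o1) by apply/eqP; rewrite -addr_eq0 addrC Ytr.
  by rewrite ofrealN ofrealD mulrN mulrDr -!Yi.
apply/matrixP => i j; have [<-|ij] := eqVneq i j; last first.
  by rewrite (Yoff _ _ ij) [RHS]mxE (negbTE ij) mulr0n.
move: i; apply: ord3_ind; rewrite [RHS]mxE eqxx mulr1n [RHS]mxE /=; [exact: Yi|exact: Yi|exact: Y2].
Qed.

End MaximalTori.

(** * Roots and weights *)

Section Roots.
Variable R : realType.
Local Notation C := (CC R).
Local Notation M3 := 'M[C]_3.
Implicit Types (u g X Y : M3) (l : M3 -> C).

Lemma faddE l l' X : (l + l') X = l X + l' X. Proof. by []. Qed.
Lemma foppE l X : (- l) X = - l X. Proof. by []. Qed.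

(* Functionals are written in the coordinates (c0, c1, 0): the third one can be taken
   to be 0 because the diagonal entries of an element of the Lie algebra add up to 0. *)
Definition lf u (c0 c1 : R) : M3 -> C := fun X =>
  if `[< Lie (conj_torus u) X >] then
    ofreal c0 * (invmx u *m X *m u) o0 o0 + ofreal c1 * (invmx u *m X *m u) o1 o1
  else 0.

Definition rt u (j k : 'I_3) : M3 -> C := fun X =>
  if `[< Lie (conj_torus u) X >] then
    (invmx u *m X *m u) j j - (invmx u *m X *m u) k k
  else 0.

Definition th (t0 t1 : R) (j : 'I_3) : R :=
  if j == 0 :> nat then t0 else if j == 1%N :> nat then t1 else - (t0 + t1).

Lemma lie_eltE u (t0 t1 : R) :
  lie_elt u t0 t1 = u *m diag_mx (\row_j (iu R * ofreal (th t0 t1 j))) *m invmx u.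
Proof.
congr (_ *m diag_mx _ *m _); apply/rowP => j; rewrite !mxE /th.
by case: ifP => _ //; case: ifP.
Qed.

Lemma lie_elt_diag u (t0 t1 : R) : SU3 u ->
  invmx u *m lie_elt u t0 t1 *m u = diag_mx (\row_j (iu R * ofreal (th t0 t1 j))).
Proof.
move=> hu; have uu := SU3_unit hu.
by rewrite lie_eltE !mulmxA mulVmx // mul1mx mulmxKV.
Qed.

Lemma lie_elt_entry u (t0 t1 : R) j : SU3 u ->
  (invmx u *m lie_elt u t0 t1 *m u) j j = iu R * ofreal (th t0 t1 j).
Proof. by move=> hu; rewrite lie_elt_diag // 2!mxE eqxx mulr1n. Qed.

Lemma rt_lie u j k t0 t1 : SU3 u ->
  rt u j k (lie_elt u t0 t1) = iu R * ofreal (th t0 t1 j - th t0 t1 k).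
Proof.
move=> hu; rewrite /rt asboolT; last exact: lie_elt_Lie.
by rewrite !lie_elt_entry // ofrealD ofrealN mulrBr.
Qed.

Lemma lf_lie u c0 c1 t0 t1 : SU3 u ->
  lf u c0 c1 (lie_elt u t0 t1) = iu R * ofreal (c0 * t0 + c1 * t1).
Proof.
move=> hu; rewrite /lf asboolT; last exact: lie_elt_Lie.
rewrite !lie_elt_entry // ofrealD !ofrealM /th /=; ring.
Qed.

Lemma lf_out u c0 c1 X : ~ Lie (conj_torus u) X -> lf u c0 c1 X = 0.
Proof. by move=> h; rewrite /lf asboolF. Qed.

Lemma rt_out u j k X : ~ Lie (conj_torus u) X -> rt u j k X = 0.
Proof. by move=> h; rewrite /rt asboolF. Qed.

Lemma functional_ext u l l' : SU3 u ->
  (forall t0 t1, l (lie_elt u t0 t1) = l' (lie_elt u t0 t1)) ->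
  (forall X, ~ Lie (conj_torus u) X -> l X = 0) ->
  (forall X, ~ Lie (conj_torus u) X -> l' X = 0) -> l = l'.
Proof.
move=> hu h h0 h1; apply/funext => X.
have [hX|hX] := pselect (Lie (conj_torus u) X); last by rewrite h0 // h1.
by move: hX; rewrite Lie_conj_torus // => -[t0 [t1 ->]].
Qed.

Lemma lie_elt_add u t0 t1 s0 s1 :
  lie_elt u t0 t1 + lie_elt u s0 s1 = lie_elt u (t0 + s0) (t1 + s1).
Proof.
rewrite /lie_elt -mulmxDl -mulmxDr; congr (_ *m _ *m _).
apply/matrixP => i j; rewrite !mxE -mulrnDl; congr (_ *+ _).
by case: ifP => _; [|case: ifP => _]; rewrite ?ofrealN ?ofrealD; ring.
Qed.

Lemma re_iu_ofreal (t : R) : re (iu R * ofreal t) = 0.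
Proof. by rewrite reM re_ofreal im_ofreal /= mulr0 mul0r subr0. Qed.
Lemma im_iu_ofreal (t : R) : im (iu R * ofreal t) = t.
Proof. by rewrite imM re_ofreal im_ofreal /= mul1r mulr0 ?add0r ?addr0. Qed.

Lemma idual_lf u c0 c1 : SU3 u -> idual (conj_torus u) (lf u c0 c1).
Proof.
move=> hu; split; rewrite ?Lie_conj_torus //.
- by move=> X [t0 [t1 ->]]; rewrite lf_lie //; exact: re_iu_ofreal.
- move=> X Y [t0 [t1 ->]] [s0 [s1 ->]]; rewrite lie_elt_add !lf_lie // -mulrDr -ofrealD.
  by congr (_ * ofreal _); ring.
- move=> s X [t0 [t1 ->]]; rewrite lie_elt_scale !lf_lie // [RHS]mulrCA -ofrealM.
  by congr (_ * ofreal _); ring.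
by move=> X hX; apply: lf_out; rewrite Lie_conj_torus.
Qed.

Lemma idualE u l : SU3 u -> idual (conj_torus u) l -> exists c0 c1, l = lf u c0 c1.
Proof.
move=> hu [lre lD lZ l0].
exists (im (l (lie_elt u 1 0))), (im (l (lie_elt u 0 1))).
apply: (functional_ext hu) => //; last by move=> X; exact: lf_out.
move=> t0 t1; rewrite lf_lie //.
have -> : lie_elt u t0 t1 = ofreal t0 *: lie_elt u 1 0 + ofreal t1 *: lie_elt u 0 1.
  by rewrite !lie_elt_scale lie_elt_add !mulr1 !mulr0 addr0 add0r.
have L a b : Lie (conj_torus u) (lie_elt u a b) by exact: lie_elt_Lie.
have L' s a b : Lie (conj_torus u) (ofreal s *: lie_elt u a b) by rewrite lie_elt_scale.
apply: (etrans (lD _ _ (L' t0 1 0) (L' t1 0 1))).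
apply: (etrans (congr2 +%R (lZ t0 _ (L 1 0)) (lZ t1 _ (L 0 1)))).
have e a b : l (lie_elt u a b) = iu R * ofreal (im (l (lie_elt u a b))).
  by rewrite {1}[l _]complexE [re _](lre _ (L a b)) ofreal0 add0r.
apply: (etrans (congr2 +%R (congr1 (fun z => ofreal t0 * z) (e 1 0))
  (congr1 (fun z => ofreal t1 * z) (e 0 1)))).
have G (a b : R) : ofreal t0 * (iu R * ofreal a) + ofreal t1 * (iu R * ofreal b) =
    iu R * ofreal (a * t0 + b * t1) by rewrite ofrealD !ofrealM; ring.
exact: G.
Qed.

Lemma lf_add u c0 c1 d0 d1 : SU3 u -> lf u c0 c1 + lf u d0 d1 = lf u (c0 + d0) (c1 + d1).
Proof.
move=> hu; apply: (functional_ext hu) => [t0 t1|X hX|X]; last exact: lf_out.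
  rewrite faddE !lf_lie // -mulrDr -ofrealD; congr (_ * ofreal _); ring.
by rewrite faddE !lf_out // addr0.
Qed.

Lemma lf_scale u s c0 c1 : SU3 u -> ofreal s \*o lf u c0 c1 = lf u (s * c0) (s * c1).
Proof.
move=> hu; apply: (functional_ext hu) => [t0 t1|X hX|X]; last exact: lf_out.
  by rewrite /= !lf_lie // [LHS]mulrCA -ofrealM; congr (_ * ofreal _); ring.
by rewrite /= lf_out // mulr0.
Qed.

Lemma lf_opp u c0 c1 : SU3 u -> - lf u c0 c1 = lf u (- c0) (- c1).
Proof.
move=> hu; apply: (functional_ext hu) => [t0 t1|X hX|X]; last exact: lf_out.
  rewrite foppE !lf_lie // -[LHS]mulrN -ofrealN; congr (_ * ofreal _); ring.
by rewrite foppE lf_out // oppr0.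
Qed.

Lemma lf_natmul u c0 c1 n : SU3 u -> lf u c0 c1 *+ n = lf u (c0 *+ n) (c1 *+ n).
Proof.
move=> hu; elim: n => [|n IH]; last by rewrite !mulrS IH lf_add.
apply: (functional_ext hu) => [t0 t1|X hX|X]; last exact: lf_out.
  by rewrite lf_lie // !mulr0n !mul0r addr0 ofreal0 mulr0.
by [].
Qed.

Lemma lf_inj u c0 c1 d0 d1 : SU3 u -> lf u c0 c1 = lf u d0 d1 -> c0 = d0 /\ c1 = d1.
Proof.
move=> hu e; split.
  have := congr1 (fun f => im (f (lie_elt u 1 0))) e.
  by rewrite /= !lf_lie // !im_iu_ofreal !mulr1 !mulr0 !addr0.
have := congr1 (fun f => im (f (lie_elt u 0 1))) e.
by rewrite /= !lf_lie // !im_iu_ofreal !mulr1 !mulr0 !add0r.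
Qed.

Definition ec0 (j : 'I_3) : R := th 1 0 j.
Definition ec1 (j : 'I_3) : R := th 0 1 j.

Lemma thE t0 t1 j : th t0 t1 j = ec0 j * t0 + ec1 j * t1.
Proof. by rewrite /ec0 /ec1 /th; case: ifP => _; [|case: ifP => _]; ring. Qed.

Lemma rtE u j k : SU3 u -> rt u j k = lf u (ec0 j - ec0 k) (ec1 j - ec1 k).
Proof.
move=> hu; apply: (functional_ext hu) => [t0 t1|X|X]; [|exact: rt_out|exact: lf_out].
by rewrite rt_lie // lf_lie // !(thE t0 t1); congr (_ * ofreal _); ring.
Qed.

Lemma rt_add u j k m : rt u j k + rt u k m = rt u j m.
Proof.
apply/funext => X; rewrite faddE /rt; case: ifP => _; last by rewrite addr0.
by ring.
Qed.

Lemma rt_opp u j k : - rt u j k = rt u k j.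
Proof. by apply/funext => X; rewrite foppE /rt; case: ifP => _; rewrite ?oppr0 ?opprB. Qed.

Lemma rt_inj u j k j' k' : SU3 u -> j != k -> rt u j k = rt u j' k' -> j = j' /\ k = k'.
Proof.
move=> hu; rewrite !rtE // => jk /(lf_inj hu); move: jk.
rewrite /ec0 /ec1 /th.
by move: j k j' k'; do 4!apply: ord3_ind => /=; move=> //= _ [h1 h2]; split => //; exfalso; lra.
Qed.

(** After conjugation by u the adjoint action is diagonal on matrix units, with eigenvalue the
    difference of the diagonal entries j and k. Conversely, any nonzero entry (j, k) of a root
    vector reads off its root; the root being nonzero forces j and k to differ. *)
Lemma roots_conj_torus u : SU3 u ->
  Defs.roots (conj_torus u) = [set a | exists j k, j != k /\ a = rt u j k].
Proof.
move=> hu; have uu := SU3_unit hu.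
apply/seteqP; split=> a; last first.
  move=> [j [k [jk ->]]]; split; first by rewrite rtE //; exact: idual_lf.
    move=> e; have e' : rt u j k = rt u k j by rewrite -[RHS]rt_opp e oppr0.
    by have [E _] := rt_inj hu jk e'; rewrite E eqxx in jk.
  exists (u *m delta_mx j k *m invmx u); split.
  - rewrite mxtrace_mulC mulmxA mulVmx // mul1mx /mxtrace big1 // => i _.
    by rewrite mxE; case: eqP => //= ->; rewrite (negbTE jk).
  - move=> e; have : delta_mx j k = 0 :> M3.
      by rewrite -[delta_mx j k](mulKmx uu) -[u *m _](mulmxKV uu) e mul0mx mulmx0.
    by move=> /matrixP/(_ j k); rewrite !mxE !eqxx => /eqP; rewrite oner_eq0.
  move=> X hX; move: (hX); rewrite Lie_conj_torus // => -[t0 [t1 eX]].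
  rewrite eX rt_lie // lie_eltE !(conj_mulmx _ _ uu) -mulmxBl -mulmxBr [RHS]scalemxAl scalemxAr.
  congr (_ *m _ *m _); apply/matrixP => i m.
  rewrite mul_diag_mx mul_mx_diag !mxE.
  case: (eqVneq i j) => [->|] /=; last by rewrite !mulr0 !mul0r subrr.
  case: (eqVneq m k) => [->|] /=; last by rewrite !mulr0 !mul0r subrr.
  by rewrite !mulr1 mul1r ofrealD ofrealN mulrBr.
move=> [ia a0 [Y [_ Y0 hY]]].
pose Y' := invmx u *m Y *m u.
have eY : Y = u *m Y' *m invmx u by rewrite /Y' !mulmxA mulmxV // mul1mx mulmxK.
have [j [k jk]] : exists j k, Y' j k != 0.
  apply: contrapT => h; apply: Y0; rewrite eY.
  have -> : Y' = 0.
    apply/matrixP => j k; rewrite [RHS]mxE; apply/eqP; apply: contrapT => /negP h'.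
    by apply: h; exists j, k.
  by rewrite mulmx0 mul0mx.
clearbody Y'.
have e t0 t1 : a (lie_elt u t0 t1) = rt u j k (lie_elt u t0 t1).
  have := hY _ (lie_elt_Lie t0 t1 hu).
  rewrite rt_lie //; move: (a _) => z.
  rewrite lie_eltE eY !(conj_mulmx _ _ uu) -mulmxBl -mulmxBr scalemxAl scalemxAr => E.
  have E' := can_inj (mulKmx uu) (can_inj (mulmxKV uu) E).
  have := congr1 (fun A : M3 => A j k) E'.
  rewrite /= mul_diag_mx mul_mx_diag !mxE => h.
  apply: (mulIf jk); rewrite -h ofrealD ofrealN; ring.
have [_ _ _ aout] := ia.
have ea : a = rt u j k by apply: (functional_ext hu) => // X; exact: rt_out.
exists j, k; split=> //; apply/eqP => ejk; apply: a0; rewrite ea ejk.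
by apply/funext => X; rewrite /rt subrr; case: ifP.
Qed.

End Roots.

(** * The Weyl group and the normal form of a positive system *)

Section PositiveSystem.
Variable R : realType.
Local Notation C := (CC R).
Local Notation M3 := 'M[C]_3.
Local Notation "M ^t*" := (map_mx Num.conj M^T) (at level 30).
Implicit Types (u g n X Y A : M3) (T : set M3) (l : M3 -> C).

Lemma perm_SU3 (s : {perm 'I_3}) : exists2 n, SU3 n &
  forall A j k, (invmx n *m A *m n) j k = A (s j) (s k).
Proof.
have [z [hz hn]] := unitary_to_SU3 (perm_unitary R s^-1%g).
have z0 := abs1_neq0 hz.
exists (z *: perm_mx s^-1%g) => // A j k.
have -> : invmx (z *: perm_mx s^-1%g) = z^-1 *: perm_mx s :> M3.
  have hu : z *: perm_mx s^-1%g \in unitmx by exact: SU3_unit.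
  apply: (can_inj (mulKmx hu)); rewrite mulmxV // -scalemxAl -scalemxAr scalerA mulfV //.
  by rewrite scale1r -perm_mxM mulVg perm_mx1.
rewrite -!scalemxAl -scalemxAr scalerA mulVf // scale1r -row_permE -col_permE !mxE //.
Qed.

Lemma conj_torus_perm u n (s : {perm 'I_3}) : SU3 u -> SU3 n ->
  (forall A j k, (invmx n *m A *m n) j k = A (s j) (s k)) ->
  conj_torus (u *m n) = conj_torus u.
Proof.
move=> hu hn hs; have hun := SU3_mul hu hn.
have iun : invmx (u *m n) = invmx n *m invmx u.
  have h := SU3_unit hun; apply: (can_inj (mulKmx h)); rewrite mulmxV //.
  by rewrite -mulmxA mulKVmx ?SU3_unit // mulmxV // SU3_unit.
apply/seteqP; split=> g.
  move=> /(conj_torusE _ hun) []; rewrite iun => hg /is_diag_mxP h; apply/(conj_torusE _ hu); split=> //.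
  apply/is_diag_mxP => i j ij.
  have := h (s^-1 i)%g (s^-1 j)%g.
  have -> : invmx n *m invmx u *m g *m (u *m n) = invmx n *m (invmx u *m g *m u) *m n.
    by rewrite !mulmxA.
  rewrite hs !permKV; apply.
  by apply: contraNneq ij => /val_inj/perm_inj ->.
move=> /(conj_torusE _ hu) [hg /is_diag_mxP h]; apply/(conj_torusE _ hun); split=> //.
apply/is_diag_mxP => i j ij; rewrite iun.
have -> : invmx n *m invmx u *m g *m (u *m n) = invmx n *m (invmx u *m g *m u) *m n.
  by rewrite !mulmxA.
by rewrite hs; apply: h; apply: contraNneq ij => /val_inj/perm_inj ->.
Qed.

Lemma rt_perm u n (s : {perm 'I_3}) j k : SU3 u -> SU3 n ->
  (forall A j k, (invmx n *m A *m n) j k = A (s j) (s k)) ->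
  rt (u *m n) j k = rt u (s j) (s k).
Proof.
move=> hu hn hs; apply/funext => X; rewrite /rt (conj_torus_perm hu hn hs).
have hun := SU3_unit (SU3_mul hu hn).
have iun : invmx (u *m n) = invmx n *m invmx u.
  apply: (can_inj (mulKmx hun)); rewrite mulmxV //.
  by rewrite -mulmxA mulKVmx ?SU3_unit // mulmxV // SU3_unit.
have -> : invmx (u *m n) *m X *m (u *m n) = invmx n *m (invmx u *m X *m u) *m n.
  by rewrite iun !mulmxA.
rewrite (hs (invmx u *m X *m u) j j) (hs (invmx u *m X *m u) k k); reflexivity.
Qed.

(** The three angles add up to 0, so after a permutation the third is still minus the sum of the
    first two. *)
Lemma th_sum (t0 t1 : R) (s : {perm 'I_3}) j :
  th (th t0 t1 (s o0)) (th t0 t1 (s o1)) j = th t0 t1 (s j).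
Proof.
have e : th t0 t1 (s o0) + th t0 t1 (s o1) + th t0 t1 (s o2) = 0.
  transitivity (\sum_i th t0 t1 (s i)); first by rewrite !big_ord_recl big_ord0 addr0 addrA.
  transitivity (\sum_i th t0 t1 i); first by rewrite [RHS](reindex_perm s).
  rewrite !big_ord_recl big_ord0 /th /=; ring.
move: j; apply: ord3_ind; rewrite {1}/th //=.
by apply/esym/eqP; rewrite -addr_eq0 addrC e.
Qed.

Lemma weyl_act_rt u (s : {perm 'I_3}) : SU3 u -> exists n,
  [/\ SU3 n, [set n *m g *m invmx n | g in conj_torus u] = conj_torus u &
  forall j k, weyl_act n (rt u j k) = rt u (s j) (s k)].
Proof.
move=> hu; have uu := SU3_unit hu; have [n hn hs] := perm_SU3 s.
have nu := SU3_unit hn.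
pose m := u *m n *m invmx u.
have hm : SU3 m by exact: (SU3_mul (SU3_mul hu hn) (SU3_inv hu)).
have mu := SU3_unit hm.
have cc (A B g : M3) : A *m B = 1%:M -> A *m (B *m g *m A) *m B = g.
  by move=> e; rewrite !mulmxA e mul1mx -mulmxA e mulmx1.
have im_ : invmx m = u *m invmx n *m invmx u.
  by apply: (can_inj (mulKmx mu)); rewrite mulmxV // conj_mulmx // mulmxV // mulmx1 mulmxV.
have conjd (d : 'rV[C]_3) : invmx n *m diag_mx d *m n = diag_mx (\row_j d 0 (s j)).
  by apply/matrixP => i j; rewrite hs !mxE (inj_eq perm_inj); case: eqP => [->|]; rewrite ?mulr0n.
have conjd' (d : 'rV[C]_3) : n *m diag_mx d *m invmx n = diag_mx (\row_j d 0 ((s^-1)%g j)).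
  have -> : diag_mx d = invmx n *m diag_mx (\row_j d 0 ((s^-1)%g j)) *m n.
    by rewrite conjd; congr diag_mx; apply/rowP => j; rewrite !mxE permK.
  by rewrite !mulmxA mulmxV // mul1mx mulmxK.
have wl t0 t1 : invmx m *m lie_elt u t0 t1 *m m = lie_elt u (th t0 t1 (s o0)) (th t0 t1 (s o1)).
  rewrite !lie_eltE im_ /m !(conj_mulmx _ _ uu) conjd; congr (_ *m diag_mx _ *m _).
  by apply/rowP => j; rewrite !mxE th_sum.
have wl' t0 t1 : m *m lie_elt u t0 t1 *m invmx m =
    lie_elt u (th t0 t1 ((s^-1)%g o0)) (th t0 t1 ((s^-1)%g o1)).
  rewrite !lie_eltE im_ /m !(conj_mulmx _ _ uu) conjd'; congr (_ *m diag_mx _ *m _).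
  by apply/rowP => j; rewrite !mxE th_sum.
exists m; split => //.
  apply/seteqP; split=> g.
    move=> [h hh <-]; have [hh1 _] := (conj_torusE h hu).1 hh.
    move: hh => [x [y [w [_ eh]]]].
    apply/(conj_torusE _ hu); split; first exact: (SU3_mul (SU3_mul hm hh1) (SU3_inv hm)).
    rewrite eh im_ /m !(conj_mulmx _ _ uu) conjd' !mulmxA mulVmx // mul1mx mulmxKV //.
  move=> hg; exists (invmx m *m g *m m); last first.
    exact: cc (mulmxV mu).
  have [hg1 _] := (conj_torusE g hu).1 hg.
  move: hg => [x [y [w [_ eg]]]].
  apply/(conj_torusE _ hu); split; first exact: (SU3_mul (SU3_mul (SU3_inv hm) hg1) hm).
  rewrite eg im_ /m !(conj_mulmx _ _ uu) conjd !mulmxA mulVmx // mul1mx mulmxKV //.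
move=> j k; apply: (functional_ext hu) => [t0 t1|X hX|X]; last exact: rt_out.
  by rewrite /weyl_act wl !rt_lie // !th_sum.
rewrite /weyl_act; apply: rt_out; move: hX; rewrite Lie_conj_torus // => hX [t0 [t1 e]].
have cc' := cc _ _ X (mulmxV mu).
apply: hX.
exists (th t0 t1 ((s^-1)%g o0)), (th t0 t1 ((s^-1)%g o1)).
by rewrite -wl' -e cc'.
Qed.

Lemma perm3 (j k m : 'I_3) : j != k -> k != m -> j != m ->
  exists s : {perm 'I_3}, [/\ s o0 = j, s o1 = k & s o2 = m].
Proof.
move=> jk km jm.
pose f (i : 'I_3) := if i == 0 :> nat then j else if i == 1%N :> nat then k else m.
have fi : injective f.
  move=> a b; rewrite /f.
  by move: a b; do 2!apply: ord3_ind => //=; move=> e; move: jk km jm; rewrite e ?eqxx.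
by exists (perm fi); rewrite !permE /f.
Qed.

(** A positive system chooses an orientation of each pair of indices. On three indices some two
    oriented pairs can be chained, closure under addition orients the third pair accordingly, and
    the result is a total order. Renumbering the eigenvalues, that is multiplying u by a permutation
    element of SU(3), makes it the standard one. *)
Lemma positive_system_normal T P : maximal_torus T -> positive_system T P ->
  exists u, [/\ SU3 u, T = conj_torus u &
    P = [set a | a = rt u o0 o1 \/ a = rt u o1 o2 \/ a = rt u o0 o2]].
Proof.
move=> hT; have [u hu ->] := maximal_torus_conj hT => -[P1 P2 P3 P4].
have rootT j k : j != k -> Defs.roots (conj_torus u) (rt u j k).
  by move=> jk; rewrite roots_conj_torus //; exists j, k.
have tot j k : j != k -> P (rt u j k) \/ P (rt u k j).
  by move=> /rootT /P2; rewrite rt_opp.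
have anti j k : P (rt u j k) -> P (rt u k j) -> False.
  by move=> h h'; apply: (P3 (rt u j k)); rewrite rt_opp.
have trans j k m : P (rt u j k) -> P (rt u k m) -> j != m -> P (rt u j m).
  by move=> h1 h2 jm; rewrite -(rt_add u j k m); apply: P4 => //; rewrite rt_add; exact: rootT.
have [j [k [m [jk km jm [h1 h2]]]]] : exists j k m : 'I_3,
    [/\ j != k, k != m, j != m & P (rt u j k) /\ P (rt u k m)].
  have [h01|h10] := tot o0 o1 isT.
    have [h12|h21] := tot o1 o2 isT; first by exists o0, o1, o2.
    have [h02|h20] := tot o0 o2 isT; first by exists o0, o2, o1.
    by exists o2, o0, o1.
  have [h02|h20] := tot o0 o2 isT; first by exists o1, o0, o2.
  have [h12|h21] := tot o1 o2 isT; first by exists o1, o2, o0.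
  by exists o2, o1, o0.
have [s [s0 s1 s2]] := perm3 jk km jm.
have [n hn hs] := perm_SU3 s.
have hun := SU3_mul hu hn.
have ra i i' := rt_perm i i' hu hn hs.
exists (u *m n); split=> //; first by rewrite (conj_torus_perm hu hn hs).
have h3 := trans _ _ _ h1 h2 jm.
apply/seteqP; split=> a; last first.
  by rewrite /= !ra s0 s1 s2 => -[->|[->|->]].
move=> Pa; have := P1 _ Pa.
rewrite -(conj_torus_perm hu hn hs) roots_conj_torus // => -[i [i' [ii' ea]]].
move: i i' ii' ea; do 2!apply: ord3_ind => //=; move=> _ ea; rewrite ea; try by tauto.
all: exfalso; move: Pa; rewrite ea ra ?s0 ?s1 ?s2 => Pa.
- exact: (anti _ _ h1 Pa).
- exact: (anti _ _ h3 Pa).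
- exact: (anti _ _ h2 Pa).
Qed.

End PositiveSystem.

(** * Pairings and the weight lattice in coordinates *)

Section InnerProduct.
Variable R : realType.
Local Notation C := (CC R).
Local Notation M3 := 'M[C]_3.
Implicit Types (u g n X Y A : M3) (T : set M3) (l : M3 -> C).

Variables (u : M3) (ip : (M3 -> C) -> (M3 -> C) -> R).
Hypothesis hu : SU3 u.
Local Notation T := (conj_torus u).
Local Notation a1 := (rt u o0 o1).
Local Notation a2 := (rt u o1 o2).
Local Notation a3 := (rt u o0 o2).
Hypothesis hip : weyl_invariant_inner_product T ip.
Local Notation P := [set a | a = a1 \/ a = a2 \/ a = a3].

Lemma a1E : a1 = lf u 1 (-1).
Proof. by rewrite rtE // /ec0 /ec1 /th /=; congr (lf u _ _); ring. Qed.
Lemma a2E : a2 = lf u 1 2.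
Proof. by rewrite rtE // /ec0 /ec1 /th /=; congr (lf u _ _); ring. Qed.
Lemma a3E : a3 = lf u 2 1.
Proof. by rewrite rtE // /ec0 /ec1 /th /=; congr (lf u _ _); ring. Qed.

Lemma sum_positive_roots (f : (M3 -> C) -> (M3 -> C)) :
  \sum_(a \in P) f a = f a1 + (f a2 + f a3).
Proof.
have n12 : a1 != a2 by apply/eqP; rewrite a1E a2E => /(lf_inj hu) [_ h]; lra.
have n13 : a1 != a3 by apply/eqP; rewrite a1E a3E => /(lf_inj hu) [_ h]; lra.
have n23 : a2 != a3 by apply/eqP; rewrite a2E a3E => /(lf_inj hu) [h _]; lra.
rewrite (fsbigE [:: a1; a2; a3]).
- have m1 : a1 \in P by apply/mem_set; left.
  have m2 : a2 \in P by apply/mem_set; right; left.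
  have m3 : a3 \in P by apply/mem_set; right; right.
  by rewrite !big_cons big_nil m1 m2 m3 /= addr0.
- by rewrite /= !inE negb_or n12 n13 n23.
- by move=> a /=; rewrite !inE => /or3P[] /eqP ->; tauto.
by move=> a /= h; rewrite !inE => /negP[]; case: h => [->|[->|->]]; rewrite eqxx ?orbT.
Qed.

Lemma half_sumE : half_sum P = lf u 2 1.
Proof.
rewrite /half_sum (sum_positive_roots id) /= a1E a2E a3E !lf_add // lf_scale //.
by congr (lf u _ _); field.
Qed.

(** The transposition of the first two indices sends [a1] to [- a1] and [a2] to [a1 + a2], so
    invariance forces the pairing of [a1] and [a2] to be minus half the square length of [a1]. The
    other simple reflection gives the same for [a2]. Both simple roots thus have square length N,
    which determines the form. *)
Lemma ip_coordinates : exists2 N : R, 0 < N & forall m0 m1,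
  [/\ ip (lf u m0 m1) a1 = N / 2 * (m0 - m1), ip (lf u m0 m1) a2 = N / 2 * m1 &
      ip (lf u m0 m1) a3 = N / 2 * m0].
Proof.
have [ipC ipD ipZ ip0 ipW] := hip.
have il c0 c1 : idual T (lf u c0 c1) by exact: idual_lf.
have ir j k : idual T (rt u j k) by rewrite rtE.
have ipN l l' : idual T l -> idual T l' -> ip (- l) l' = - ip l l'.
  move=> hl hl'; have [c0 [c1 ->]] := idualE hu hl.
  rewrite lf_opp // -[- c0]mulN1r -[- c1]mulN1r -lf_scale // ipZ ?mulN1r //.
have [n1 [hn1 nT1 w1]] := weyl_act_rt (tperm o0 o1) hu.
have [n2 [hn2 nT2 w2]] := weyl_act_rt (tperm o1 o2) hu.
have iA l l' : idual T l -> idual T l' -> idual T (l + l').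
  by move=> hl hl'; have [c0 [c1 ->]] := idualE hu hl; have [d0 [d1 ->]] := idualE hu hl'; rewrite lf_add.
have iz s l : idual T l -> idual T (ofreal s \*o l).
  by move=> hl; have [c0 [c1 ->]] := idualE hu hl; rewrite lf_scale.
have i1 := ir o0 o1; have i2 := ir o1 o2; have i12 := iA _ _ i1 i2.
have i1N : idual T (- a1) by rewrite rt_opp; exact: ir.
have i2N : idual T (- a2) by rewrite rt_opp; exact: ir.
have e1 : ip a1 a2 = - (ip a1 a1 / 2).
  have := ipW _ hn1 nT1 _ _ i1 i2.
  rewrite !w1 tpermL tpermR tpermD // -(rt_add u o0 o1 o2) -(rt_opp u o0 o1).
  rewrite (ipN _ _ i1 i12) (ipC _ _ i1 i12) (ipD _ _ _ i1 i2 i1) (ipC _ _ i2 i1); lra.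
have e2 : ip a1 a2 = - (ip a2 a2 / 2).
  have := ipW _ hn2 nT2 _ _ i1 i2.
  rewrite !w2 tpermL tpermR tpermD // -(rt_add u o0 o1 o2) -(rt_opp u o1 o2).
  rewrite (ipC _ _ i12 i2N) (ipN _ _ i2 i12) (ipC _ _ i2 i12) (ipD _ _ _ i1 i2 i2); lra.
have N0 : 0 < ip a1 a1.
  apply: ip0 => //; rewrite a1E => h.
  have : lf u 1 (-1) = lf u 0 0 by rewrite h; apply: (functional_ext hu) => // [t0 t1|X]; rewrite ?lf_lie ?mul0r ?addr0 ?ofreal0 ?mulr0 //; exact: lf_out.
  by move=> /(lf_inj hu) [/eqP]; rewrite oner_eq0.
exists (ip a1 a1) => // m0 m1.
(* The coefficients solve (m0, m1) = x (1, -1) + y (1, 2). *)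
have -> : lf u m0 m1 = ofreal ((2 * m0 - m1) / 3) \*o a1 + ofreal ((m0 + m1) / 3) \*o a2.
  by rewrite a1E a2E !lf_scale // lf_add //; congr (lf u _ _); field.
have [x ex] : exists x, x = (2 * m0 - m1) / 3 by exists ((2 * m0 - m1) / 3).
have [y ey] : exists y, y = (m0 + m1) / 3 by exists ((m0 + m1) / 3).
rewrite -ex -ey.
have j1 := iz x _ i1; have j2 := iz y _ i2; have j12 := iA _ _ j1 j2.
have h1 : ip (ofreal x \*o a1 + ofreal y \*o a2) a1 = x * ip a1 a1 + y * ip a1 a2.
  by rewrite (ipD _ _ _ j1 j2 i1) (ipZ _ _ _ i1 i1) (ipZ _ _ _ i2 i1) (ipC _ _ i2 i1).
have h2 : ip (ofreal x \*o a1 + ofreal y \*o a2) a2 = x * ip a1 a2 + y * ip a2 a2.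
  by rewrite (ipD _ _ _ j1 j2 i2) (ipZ _ _ _ i1 i2) (ipZ _ _ _ i2 i2).
have e3 : ip a2 a2 = ip a1 a1 by lra.
have h3 : ip (ofreal x \*o a1 + ofreal y \*o a2) a3 =
   ip (ofreal x \*o a1 + ofreal y \*o a2) a1 + ip (ofreal x \*o a1 + ofreal y \*o a2) a2.
  rewrite -(rt_add u o0 o1 o2) (ipC _ _ j12 i12) (ipD _ _ _ i1 i2 j12).
  by rewrite (ipC _ _ i1 j12) (ipC _ _ i2 j12).
rewrite h3 h1 h2 e3 e1 ex ey; by split; field.
Qed.

(** Integrality is tested on the elements with angles (2 pi, 0) and (0, 2 pi), whose exponentials
    are 1. *)
Lemma weight_lattice_int l : weight_lattice T l ->
  exists k0 k1 : int, l = lf u k0%:~R k1%:~R.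
Proof.
move=> [hl hk]; have [c0 [c1 el]] := idualE hu hl; subst l.
have p0 := pi_gt0 R.
have int_of c t0 t1 : cis t0 = 1 :> C -> cis t1 = 1 :> C -> c * (2 * pi) = c0 * t0 + c1 * t1 ->
    exists k : int, c = k%:~R.
  move=> h0 h1 e; have [||k] := hk (lie_elt u t0 t1).
  - exact: lie_elt_Lie.
  - rewrite expmx_lie // cisN cisD h0 h1 mulr1 invr1 dg3_1 mulmx1 mulmxV //; exact: SU3_unit.
  rewrite lf_lie // -e => /(congr1 (@im R)); rewrite im_iu_ofreal /= => e'.
  exists k; apply: (mulIf (x := 2 * pi)); first by rewrite gt_eqF // mulr_gt0.
  by rewrite e' mulrC.
have c2 : cis (2 * pi) = 1 :> C by rewrite mulr_natl cis2pi.
have [k0 e0] := int_of c0 (2 * pi) 0 c2 (cis0 R) ltac:(by rewrite mulr0 addr0).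
have [k1 e1] := int_of c1 0 (2 * pi) (cis0 R) c2 ltac:(by rewrite mulr0 add0r).
by exists k0, k1; rewrite e0 e1.
Qed.

(** Adding rho = (2, 1) makes the three pairings N / 2 times m0 - m1 + 1, m1 + 1 and m0 + 2. The
    inequalities point in the direction of use: a large maximum forces m0 to be large, and a bounded
    minimum bounds one of the two smaller pairings. *)
Lemma pairing_bounds (N m0 m1 : R) : 0 < N ->
  (forall c0 c1, [/\ ip (lf u c0 c1) a1 = N / 2 * (c0 - c1), ip (lf u c0 c1) a2 = N / 2 * c1 &
      ip (lf u c0 c1) a3 = N / 2 * c0]) ->
  0 <= m1 <= m0 ->
  max_pairing P ip (lf u m0 m1) <= N / 2 * (m0 + 2) /\
  N / 2 * Num.min (m1 + 1) (m0 - m1 + 1) <= min_pairing P ip (lf u m0 m1).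
Proof.
move=> N0 hN /andP[m10 m01].
have N20 : 0 < N / 2 by rewrite divr_gt0.
have hv a : P a -> exists2 c, ip (lf u m0 m1 + half_sum P) a = N / 2 * c &
    Num.min (m1 + 1) (m0 - m1 + 1) <= c <= m0 + 2.
  rewrite half_sumE lf_add //; have [h1 h2 h3] := hN (m0 + 2) (m1 + 1).
  case=> [->|[->|->]]; rewrite ?h1 ?h2 ?h3.
  - by exists (m0 + 2 - (m1 + 1)) => //; rewrite ge_min; apply/andP; split; [apply/orP; right|]; lra.
  - by exists (m1 + 1) => //; rewrite ge_min lexx /=; lra.
  - by exists (m0 + 2) => //; rewrite ge_min lexx andbT; apply/orP; left; lra.
have ne : [set ip (lf u m0 m1 + half_sum P) a | a in P] !=set0.
  by exists (ip (lf u m0 m1 + half_sum P) a1); exists a1 => //; left.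
split.
  apply: ge_sup => // _ [a /hv [c -> /andP[_ hc]] <-].
  by apply: ler_wpM2l hc; exact: ltW.
apply: lb_le_inf => // _ [a /hv [c -> /andP[hc _]] <-].
by apply: ler_wpM2l hc; exact: ltW.
Qed.

Lemma highest_weight_difference (c0 c1 d0 d1 : R) :
  (exists k : (M3 -> C) -> nat, lf u c0 c1 - lf u d0 d1 = \sum_(a \in P) a *+ k a) ->
  exists k1 k2 k3 : nat, c0 - d0 = k1%:R + k2%:R + 2 * k3%:R /\ c1 - d1 = - k1%:R + 2 * k2%:R + k3%:R.
Proof.
move=> [k]; rewrite (sum_positive_roots (fun a => a *+ k a)).
move: (k a1) (k a2) (k a3) => k1 k2 k3; rewrite a1E a2E a3E.
rewrite lf_opp // !lf_natmul // !lf_add // => /(lf_inj hu) [h1 h2].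
exists k1, k2, k3; split.
  by rewrite h1 -[2 *+ k3]mulr_natr addrA.
by rewrite h2 mulNrn -[2 *+ k2]mulr_natr addrA.
Qed.

End InnerProduct.

(** * Weights of a representation as exponents of its character *)

Section RepresentationWeights.
Variable R : realType.
Local Notation C := (CC R).
Local Notation M3 := 'M[C]_3.
Variable m : {measure set (borelM3 R) -> \bar R}.
Hypothesis haar_m : haar m.
Variables (V : irrep R) (u : M3).
Hypothesis hu : SU3 u.
Local Notation n := (repdim V).
Local Notation rho := (rep V).

Definition tpt (t0 t1 : R) : M3 := u *m dg3 (cis t0) (cis t1) (cis (- (t0 + t1))) *m invmx u.

Lemma tpt_SU3 t0 t1 : SU3 (tpt t0 t1).
Proof. exact: (SU3_mul (SU3_mul hu (dg3_SU3 (cis_torus3 t0 t1))) (SU3_inv hu)). Qed.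

Lemma tpt_torus t0 t1 : conj_torus u (tpt t0 t1).
Proof. by exists (cis t0), (cis t1), (cis (- (t0 + t1))); split => //; exact: cis_torus3. Qed.

Lemma tptD s0 s1 t0 t1 : tpt (s0 + t0) (s1 + t1) = tpt s0 s1 *m tpt t0 t1.
Proof.
rewrite /tpt (conj_mulmx _ _ (SU3_unit hu)) dg3_mul -!cisD.
by congr (_ *m dg3 _ _ (cis _) *m _); ring.
Qed.

Lemma cvg_cis_line (a : R) (s : R) : cis (a * t) @[t --> s] --> (cis (a * s) : C).
Proof. by apply: cvg_cis; apply: cvgM; [exact: cvg_cst|exact: cvg_id]. Qed.

Lemma cvg_tpt (a b s : R) : tpt (a * t) (b * t) @[t --> s] --> tpt (a * s) (b * s).
Proof.
have e t : - (a * t + b * t) = - (a + b) * t by ring.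
have h : dg3 (cis (a * t)) (cis (b * t)) (cis (- (a * t + b * t))) @[t --> s] -->
   dg3 (cis (a * s)) (cis (b * s)) (cis (- (a * s + b * s))).
  apply: cvg_dg3; [exact: cvg_cis_line|exact: cvg_cis_line|].
  rewrite e; have -> : (fun t => cis (- (a * t + b * t)) : C) = (fun t => cis (- (a + b) * t)).
    by apply/funext => t; rewrite e.
  exact: cvg_cis_line.
exact: (cvg_mulmx (cvg_mulmx (cvg_cst u) h) (cvg_cst (invmx u))).
Qed.

Lemma cvg_SU3_path (f : M3 -> C) (g : R -> M3) (s : R) : contf f -> (forall t, SU3 (g t)) ->
  g t @[t --> s] --> g s -> f (g t) @[t --> s] --> f (g s).
Proof.
move=> cf hg cg.
have c1 : g t @[t --> s] --> within (@SU3 R) (nbhs (g s)).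
  move=> U /= hU; have hU' : nbhs (g s) [set x | @SU3 R x -> U x] by [].
  have h : nbhs s [set t | @SU3 R (g t) -> U (g t)] := cg _ hU'.
  change (nbhs s [set t | U (g t)]).
  by apply: filterS h => t /=; apply; exact: hg.
exact: cvg_comp c1 (cf (g s) (hg s)).
Qed.

(** The torus acts diagonally in a common basis, and each diagonal entry is a continuous
    homomorphism in the two angles. Restricted to either angle it factors through the circle, so
    [circle_hom] supplies the integer exponents. *)
Lemma torus_weights : exists (Q : 'M[C]_n) (a b : 'I_n -> int), Q \in unitmx /\
  forall t0 t1, rho (tpt t0 t1) =
    Q *m diag_mx (\row_i (cis t0 ^ a i * cis t1 ^ b i)) *m invmx Q.
Proof.
have sub : conj_torus u `<=` @SU3 R by move=> g /(conj_torusE _ hu) [].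
have com g h : conj_torus u g -> conj_torus u h -> g *m h = h *m g.
  by have [_ _ _ + _] := conj_torus_is_torus hu; exact.
have [Q [uQ hQ]] := rho_codiag haar_m V sub com.
have dd (d e : 'rV[C]_n) i : (diag_mx d *m diag_mx e) i i = d 0 i * e 0 i.
  by rewrite mulmx_diag !mxE eqxx mulr1n.
pose f i t0 t1 := (invmx Q *m rho (tpt t0 t1) *m Q) i i.
have hf t0 t1 : rho (tpt t0 t1) = Q *m diag_mx (\row_i f i t0 t1) *m invmx Q /\
    forall i, abs (f i t0 t1) = 1.
  have [d ed d1] := hQ _ (tpt_torus t0 t1).
  have ef i : f i t0 t1 = d 0 i.
    by rewrite /f ed !mulmxA mulVmx // mul1mx mulmxKV // mxE eqxx mulr1n.
  split=> [|i]; last by rewrite ef.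
  by rewrite ed; congr (_ *m diag_mx _ *m _); apply/rowP => i; rewrite [RHS]mxE ef.
have fD i s0 s1 t0 t1 : f i (s0 + t0) (s1 + t1) = f i s0 s1 * f i t0 t1.
  rewrite {1}/f tptD repM; [|exact: tpt_SU3|exact: tpt_SU3].
  rewrite (hf s0 s1).1 (hf t0 t1).1 !mulmxA mulVmx // mul1mx mulmxKV // mulmxKV //.
  by rewrite dd; congr (_ * _); exact: mxE.
have f0 i : f i 0 0 = 1.
  have n0 : f i 0 0 != 0 by rewrite -abs_gt0 (hf 0 0).2.
  by apply: (mulfI n0); rewrite -fD !addr0 mulr1.
have fc i (a b : R) : f i (a * t) (b * t) @[t --> (0 : R)] --> f i (a * 0) (b * 0).
  pose F (g : M3) := (invmx Q *m rho g *m Q) i i.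
  have cF : contf F.
    have h : contm (fun g => invmx Q *m rho g *m Q).
      by apply: contm_mul; [apply: contm_mul; [exact: contm_cst|exact: rho_contm]|exact: contm_cst].
    exact: h.
  have hg t : SU3 (tpt (a * t) (b * t)) by exact: tpt_SU3.
  exact: (@cvg_SU3_path F (fun t : R => tpt (a * t) (b * t)) 0 cF hg (@cvg_tpt a b 0)).
have tpt2pi a b : cis a = 1 :> C -> cis b = 1 :> C -> tpt a b = tpt 0 0.
  move=> h0 h1; rewrite /tpt !cisN !cisD h0 h1 cis0 //.
have c2 : cis (pi *+ 2) = 1 :> C by exact: cis2pi.
have f2a i : f i (pi *+ 2) 0 = 1 by rewrite /f (tpt2pi _ _ c2 (cis0 R)) -[LHS]/(f i 0 0) f0.
have f2b i : f i 0 (pi *+ 2) = 1 by rewrite /f (tpt2pi _ _ (cis0 R) c2) -[LHS]/(f i 0 0) f0.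
clearbody f.
have fca i : f i t 0 @[t --> (0 : R)] --> f i 0 0.
  have := fc i 1 0; rewrite mulr0 mulr0.
  have -> : (fun t : R => f i (1 * t) (0 * t)) = (fun t => f i t 0).
    by apply/funext => t; rewrite (mul1r t) (mul0r t).
  exact: id.
have fcb i : f i 0 t @[t --> (0 : R)] --> f i 0 0.
  have := fc i 0 1; rewrite mulr0 mulr0.
  have -> : (fun t : R => f i (0 * t) (1 * t)) = (fun t => f i 0 t).
    by apply/funext => t; rewrite (mul1r t) (mul0r t).
  exact: id.
have /boolp.choice[a ha] : forall i, exists k : int, forall t, f i t 0 = cis t ^ k.
  move=> i; apply: circle_hom; [|by move=> t; exact: (hf t 0).2|exact: fca|exact: f2a].
  by move=> s t; rewrite -fD addr0.
have /boolp.choice[b hb] : forall i, exists k : int, forall t, f i 0 t = cis t ^ k.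
  move=> i; apply: circle_hom; [|by move=> t; exact: (hf 0 t).2|exact: fcb|exact: f2b].
  by move=> s t; rewrite -fD addr0.
exists Q, a, b; split=> // t0 t1.
rewrite (hf t0 t1).1; congr (_ *m diag_mx _ *m _); apply/rowP => i; rewrite !mxE.
by rewrite -ha -hb -fD addr0 add0r.
Qed.

Lemma character_classf : classf (character V).
Proof.
move=> g h hg hh; rewrite /character repM ?repM //; [|exact: SU3_mul|exact: SU3_inv].
by rewrite mxtrace_mulC mulmxA -repM ?mulVmx ?rep1 ?mul1mx ?SU3_unit //; exact: SU3_inv.
Qed.

Lemma character_contf : contf (character V).
Proof. by apply: contf_sum => i _; exact: rho_contm. Qed.

Lemma cis_line_inj (c : R) : (forall t, cis (c * t) = 1 :> C) -> c = 0.
Proof.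
move=> h; apply: contrapT => /eqP c0.
(* At t = 1 / c the hypothesis reads [cis 1 = 1], which is impossible because 0 < 1 < 2 pi. *)
have := h c^-1; rewrite mulfV // => /cis_eq1_small.
rewrite normr1; have p2 := @pi_ge2 R.
by move=> h1; have /eqP := h1 ltac:(rewrite mulr2n; lra); rewrite oner_eq0.
Qed.

(** The columns of the diagonalising matrix are weight vectors, so each exponent pair is a weight
    and lies below the highest one. Conversely, a highest weight vector has a nonzero coordinate in
    this basis, and comparing the action on it identifies that coordinate's exponents with [k0] and
    [k1]. *)
Lemma highest_weight_expansion (P : set (M3 -> C)) (k0 k1 : int) :
  highest_weight (conj_torus u) P V (lf u k0%:~R k1%:~R) ->
  exists a b : 'I_n -> int,
  [/\ forall x y w, torus3 x y w -> character V (dg3 x y w) = \sum_i mono (a i) (b i) 0 x y w,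
     exists i, a i = k0 /\ b i = k1 &
     forall i, exists k : (M3 -> C) -> nat,
       lf u k0%:~R k1%:~R - lf u (a i)%:~R (b i)%:~R = \sum_(a \in P) a *+ k a].
Proof.
move=> [[_ [v [v0 hv]]] hw]; have [Q [a [b [uQ hQ]]]] := torus_weights.
have hQl t0 t1 i : expC (lf u (a i)%:~R (b i)%:~R (lie_elt u t0 t1)) = cis t0 ^ a i * cis t1 ^ b i.
  by rewrite lf_lie // expC_iu cisD -!cisMz !mulrzl.
exists a, b; split.
- move=> x y w /torus3_cis [t0 [t1 [-> -> ->]]].
  have := character_classf hu (dg3_SU3 (cis_torus3 t0 t1)) => <-.
  rewrite /character -/(tpt t0 t1) hQ mxtrace_mulC mulmxA mulVmx // mul1mx mxtrace_diag.
  by apply: eq_bigr => i _; rewrite mxE /mono expr0z mulr1.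
- pose w := invmx Q *m v.
  have [i wi] : exists i, w i 0 != 0.
    apply: contrapT => h; apply: v0; rewrite -[v](mulKVmx uQ) -/w.
    have -> : w = 0.
      apply/matrixP => i j; rewrite (ord1 j) [RHS]mxE; apply/eqP; apply: contrapT => /negP h'.
      by apply: h; exists i.
    by rewrite mulmx0.
  have key (t0 t1 : R) : cis t0 ^ a i * cis t1 ^ b i = cis (k0%:~R * t0 + k1%:~R * t1).
    have hL : Lie (conj_torus u) (lie_elt u t0 t1) by exact: lie_elt_Lie.
    have := hv _ hL; rewrite expmx_lie // -/(tpt t0 t1) hQ lf_lie // expC_iu.
    move=> /(congr1 (fun z => (invmx Q *m z) i 0)) /=.
    rewrite !mulmxA mulVmx // mul1mx -mulmxA -/w -scalemxAr -/w.
    have hD (d : 'rV[C]_n) : (diag_mx d *m w) i 0 = d 0 i * w i 0 by rewrite mul_diag_mx mxE.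
    by rewrite hD [RHS]mxE [X in X * _ = _]mxE; exact: mulIf.
  exists i; split.
    have /cis_line_inj/eqP : forall t, cis ((k0 - a i)%:~R * t) = 1 :> C.
      move=> t; have := key t 0; rewrite cis0 exp1rz mulr1 mulr0 addr0 => e.
      by rewrite rmorphB mulrBl cisB -e mulrzl cisMz mulfV // expfz_neq0 // cis_neq0.
    by rewrite intr_eq0 subr_eq0 => /eqP.
  have /cis_line_inj/eqP : forall t, cis ((k1 - b i)%:~R * t) = 1 :> C.
    move=> t; have := key 0 t; rewrite cis0 exp1rz mul1r mulr0 add0r => e.
    by rewrite rmorphB mulrBl cisB -e mulrzl cisMz mulfV // expfz_neq0 // cis_neq0.
  by rewrite intr_eq0 subr_eq0 => /eqP.
move=> i; apply: hw; split; first exact: idual_lf.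
exists (col i Q); split.
  move=> h; have : invmx Q *m col i Q = 0 by rewrite h mulmx0.
  rewrite colE mulKmx // => /matrixP/(_ i 0); rewrite !mxE !eqxx => /eqP.
  by rewrite oner_eq0.
move=> X; rewrite Lie_conj_torus // => -[t0 [t1 ->]].
rewrite expmx_lie // -/(tpt t0 t1) hQl hQ.
rewrite colE -mulmxA mulKmx // -mulmxA scalemxAr; congr (_ *m _).
apply/matrixP => j j'; rewrite mul_diag_mx !mxE.
by case: eqP => [->|_] //=; rewrite !mulr0.
Qed.

End RepresentationWeights.

(** * The character formula at torsion points *)

Section CharacterFormula.
Variable R : realType.
Local Notation C := (CC R).
Local Notation M3 := 'M[C]_3.

(** The functions whose restriction to the diagonal torus is a trigonometric polynomial; this is the
    condition under which the integration formula applies to a continuous class function. *)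
Definition monosum (f : M3 -> C) : Prop :=
  exists r : seq (C * (int * int * int)), forall x y w, torus3 x y w ->
    f (dg3 x y w) = \sum_(s <- r) s.1 * mono s.2.1.1 s.2.1.2 s.2.2 x y w.

Lemma monosum_cst (c : C) : monosum (fun=> c).
Proof. by exists [:: (c, (0, 0, 0))] => x y w _; rewrite big_seq1 /mono !expr0z !mulr1. Qed.

Lemma monosum_add f h : monosum f -> monosum h -> monosum (fun g => f g + h g).
Proof.
move=> [r hr] [s hs]; exists (r ++ s) => x y w ht.
by rewrite big_cat /= -hr // -hs.
Qed.

Lemma monosum_mul f h : monosum f -> monosum h -> monosum (fun g => f g * h g).
Proof.
move=> [r hr] [s hs].
exists [seq (t.1 * v.1, (t.2.1.1 + v.2.1.1, t.2.1.2 + v.2.1.2, t.2.2 + v.2.2)) | t <- r, v <- s].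
move=> x y w ht; rewrite hr // hs // big_allpairs_dep /= mulr_suml; apply: eq_bigr => t _.
rewrite mulr_sumr; apply: eq_bigr => v _.
by rewrite -mono_mul // mulrACA.
Qed.

Lemma monosum_conj f : monosum f -> monosum (fun g => (f g)^*%R).
Proof.
move=> [r hr]; exists [seq ((s.1^*)%R, (- s.2.1.1, - s.2.1.2, - s.2.2)) | s <- r] => x y w ht.
rewrite hr // rmorph_sum big_map; apply: eq_bigr => s _ /=.
by rewrite rmorphM /= mono_conj.
Qed.

Variable m : {measure set (borelM3 R) -> \bar R}.
Hypothesis haar_m : haar m.

Lemma weyl_good_monosum f : contf f -> classf f -> monosum f -> weyl_good m f.
Proof. by move=> cf hf [r hr]; exact: (weyl_integration haar_m cf hf hr). Qed.

Variable V : irrep R.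
Local Notation n := (repdim V).
Local Notation chi := (character V).
Variables (a b : 'I_n -> int) (k0 k1 : int).
Hypothesis hchi : forall x y w, torus3 x y w -> chi (dg3 x y w) = \sum_i mono (a i) (b i) 0 x y w.
Hypothesis hk : 0 <= k1 <= k0.
Hypothesis hdom : forall i, exists c1 c2 c3 : nat,
  k0 - a i = c1%:Z + c2%:Z + 2 * c3%:Z /\ k1 - b i = - c1%:Z + 2 * c2%:Z + c3%:Z.
Hypothesis htop : exists i, a i = k0 /\ b i = k1.

Lemma monosum_character : monosum chi.
Proof.
exists [seq (1, (a i, b i, 0)) | i <- index_enum 'I_n] => x y w ht.
by rewrite hchi // big_map; apply: eq_bigr => i _; rewrite mul1r.
Qed.

Local Notation F x y w := (chi (dg3 x y w) * vdm x y w).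
Local Notation A := (@alternant R (k0 + 2) (k1 + 1) 0).

Lemma antisym_F : antisym (fun x y w => F x y w).
Proof.
move=> x y w ht; have hcl := @character_classf _ V.
rewrite (classf_swap12 hcl ht) (classf_swap23 hcl ht) -!mulrN.
by split; congr (_ * _); rewrite /vdm; ring.
Qed.

Lemma antisym_A : antisym A.
Proof. by move=> x y w ht; split; [exact: alternant_arg12|exact: alternant_arg23]. Qed.

Lemma gridavg_F : exists N0 : nat, forall N, (N0 < N)%N ->
  gridavg N (fun x y w => F x y w * (F x y w)^*%R) = 6%:R.
Proof.
have cc := @character_contf _ V; have hcl := @character_classf _ V.
have [N0 hN] : weyl_good m (fun g => chi g * (chi g)^*%R).
  apply: weyl_good_monosum.
  - by apply: contf_mul; [exact: cc|exact: contf_conj].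
  - by move=> g h hg hh; rewrite hcl.
  - by apply: monosum_mul; [exact: monosum_character|apply: monosum_conj; exact: monosum_character].
exists N0 => N hN0; have := hN N hN0; rewrite (character_norm haar_m) /weyl_avg => h.
move: (congr1 (fun z => 6%:R * z) h); rewrite mulr1 mulrA mulfV ?pnatr_eq0 // mul1r => ->.
by apply: gridavg_ext => x y w _; rewrite rmorphM /= mulrACA.
Qed.

(** No nontrivial permutation of (P, Q, 0) is a shift of it, since P > Q > 0; the bound on N turns
    divisibility by N into equality. Only the identity permutation contributes. *)
Lemma gridavg_A N : (2 * (k0 + 2) < N%:Z) ->
  gridavg N (fun x y w => A x y w * (A x y w)^*%R) = 6%:R.
Proof.
move=> hN; have N0 : (0 < N)%N by lia.
rewrite (gridavg_antisym N0 _ _ _ antisym_A) -[RHS]mulr1; congr (_ * _).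
pose M e1 e2 e3 := @mono R (e1 - (k0 + 2)) (e2 - (k1 + 1)) (e3 - 0).
transitivity (gridavg N (fun x y w =>
   M (k0 + 2) (k1 + 1) 0 x y w + (- M (k1 + 1) (k0 + 2) 0 x y w + (- M (k0 + 2) 0 (k1 + 1) x y w
   + (- M 0 (k1 + 1) (k0 + 2) x y w + (M (k1 + 1) 0 (k0 + 2) x y w + M 0 (k0 + 2) (k1 + 1) x y w)))))).
  apply: gridavg_ext => x y w ht; rewrite mono_conj // /alternant !mulrDl !mulNr !mono_mul //.
  by rewrite /M; ring.
rewrite !gridavg_add !gridavg_opp // !gridavg_mono //.
have D z : (`|z| < N)%N -> (N%:Z %| z)%Z = (z == 0) by exact: dvdz_small.
rewrite !D; try lia.
rewrite ifT; last by lia.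
do 5!(rewrite ifF; last by lia).
by rewrite !oppr0 !addr0.
Qed.

(** A term of F is a weight plus an exponent of the Vandermonde product. Matching it with (P, Q, 0)
    up to shift is possible only for the top weight together with (2, 1, 0): the other five
    exponents would make [k0 - a i] negative, contrary to [hdom]. So r counts the indices with the
    top weight, and [htop] makes it positive. *)
Lemma gridavg_FA : exists N0 : nat, exists2 r : nat, (0 < r)%N & forall N, (N0 < N)%N ->
  gridavg N (fun x y w => F x y w * (A x y w)^*%R) = 6%:R * r%:R.
Proof.
pose B := \sum_i (`|a i|%N + `|b i|%N)%N.
have hB i : (`|a i|%N + `|b i|%N <= B)%N by rewrite /B (bigD1 i) //= leq_addr.
pose good i := (a i == k0) && (b i == k1).
exists (2 * (B + `|k0|%N + `|k1|%N + 10))%N, (\sum_i good i)%N.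
  have [i [e1 e2]] := htop; rewrite lt0n; apply/eqP => h.
  by have := leqnn (\sum_i good i)%N; rewrite {2}h (bigD1 i) //= /good e1 e2 !eqxx.
move=> N hN; have N0 : (0 < N)%N by lia.
rewrite (gridavg_antisym N0 _ _ _ antisym_F); congr (_ * _).
pose M i e1 e2 e3 := @mono R (a i + e1 - (k0 + 2)) (b i + e2 - (k1 + 1)) (e3 - 0).
transitivity (gridavg N (fun x y w => \sum_i (M i 2 1 0 x y w + (- M i 1 2 0 x y w +
    (- M i 2 0 1 x y w + (- M i 0 1 2 x y w + (M i 1 0 2 x y w + M i 0 2 1 x y w))))))).
  apply: gridavg_ext => x y w ht.
  rewrite hchi // mono_conj // -mulrA mulr_suml; apply: eq_bigr => i _.
  rewrite vdm_alternant /alternant !mulrDl !mulrDr !mulNr !mulrN !mono_mul //.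
  by rewrite /M -!addrA; do !congr (_ + _); try (congr (- _)); congr (mono _ _ _ _ _ _); ring.
rewrite gridavg_sum natr_sum; apply: eq_bigr => i _.
rewrite !gridavg_add !gridavg_opp // !gridavg_mono //.
have [c1 [c2 [c3 [d1 d2]]]] := hdom i; have := hB i => hBi.
have D z : (`|z| < N)%N -> (N%:Z %| z)%Z = (z == 0) by exact: dvdz_small.
rewrite !D; try lia.
have -> : (a i + 2 - (k0 + 2) - (0 - 0) == 0) && (b i + 1 - (k1 + 1) - (0 - 0) == 0) = good i.
  by rewrite /good; lia.
have -> : (if good i then 1 else 0) = (good i)%:R :> C by case: (good i).
do 5!(rewrite ifF; last by lia).
by rewrite !oppr0 !addr0.
Qed.

Lemma gridavg_ofreal N (f : C -> C -> C -> R) :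
  gridavg N (fun x y w => ofreal (f x y w)) =
  ofreal ((N%:R ^+ 2)^-1 * \sum_(i < N) \sum_(j < N)
     f (rou R N ^+ i) (rou R N ^+ j) (gpt R i j)).
Proof.
rewrite /gridavg /gridsum ofrealM ofrealV ofrealX ofreal_nat ofreal_sum; congr (_ * _).
by apply: eq_bigr => i _; rewrite ofreal_sum.
Qed.

(* [F] and [A] both have mean square 6, and the mean of [F A^*] is 6 times the
   multiplicity of the highest weight, so the mean of [|F - A|^2] is nonpositive. *)
Lemma weyl_character_formula : exists N0 : nat, forall N, (N0 < N)%N -> forall i j : 'I_N,
  F (rou R N ^+ i) (rou R N ^+ j) (gpt R i j) =
  A (rou R N ^+ i) (rou R N ^+ j) (gpt R i j).
Proof.
have [N1 h1] := gridavg_F; have [N2 [r r0 h2]] := gridavg_FA.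
exists (N1 + N2 + 2 * (`|k0|%N + 2))%N => N hN.
have N0 : (0 < N)%N by lia.
have hA : gridavg N (fun x y w => A x y w * (A x y w)^*%R) = 6%:R by apply: gridavg_A; lia.
have hF := h1 N ltac:(lia); have hFA := h2 N ltac:(lia).
have hAF : gridavg N (fun x y w => A x y w * (F x y w)^*%R) = 6%:R * r%:R.
  have c : ((6%:R * r%:R : C)^*)%R = 6%:R * r%:R by rewrite -natrM conjC_nat.
  rewrite -c -hFA.
  have e : (N%:R ^+ 2)^-1 = ofreal ((N%:R ^+ 2)^-1) :> C by rewrite ofrealV ofrealX ofreal_nat.
  rewrite /gridavg !e rmorphM /= conj_ofreal; congr (_ * _).
  rewrite rmorph_sum; apply: eq_bigr => i _; rewrite rmorph_sum; apply: eq_bigr => j _.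
  by rewrite rmorphM /= conjCK mulrC.
pose D x y w := F x y w - A x y w.
have hD : gridavg N (fun x y w => ofreal (abs (D x y w) ^+ 2)) = 12%:R - 12%:R * r%:R.
  transitivity (gridavg N (fun x y w => F x y w * (F x y w)^*%R + (A x y w * (A x y w)^*%R +
     (- (F x y w * (A x y w)^*%R) + - (A x y w * (F x y w)^*%R))))).
    by apply: gridavg_ext => x y w _; rewrite -mul_conj /D rmorphB; ring.
  by rewrite !gridavg_add !gridavg_opp // hF hA hFA hAF; ring.
move: hD; rewrite gridavg_ofreal.
have -> : 12%:R - 12%:R * r%:R = ofreal (12%:R - 12%:R * r%:R) :> C.
  by rewrite ofrealD ofrealN ofrealM !ofreal_nat.
move=> /ofreal_inj hD.
have le0 : \sum_(i < N) \sum_(j < N) abs (D (rou R N ^+ i) (rou R N ^+ j) (gpt R i j)) ^+ 2 <= 0.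
  have Np : 0 < (N%:R ^+ 2)^-1 :> R by rewrite invr_gt0 exprn_gt0 // ltr0n.
  rewrite -(pmulr_rle0 _ Np) hD subr_le0 ler_peMr // ler1n //.
move=> i j; apply/eqP; rewrite -subr_eq0 -abs_eq0 -sqrf_eq0.
have sq (z : C) : 0 <= abs z ^+ 2 by rewrite sqr_ge0.
have s1 (i' : 'I_N) : 0 <= \sum_(j < N) abs (D (rou R N ^+ i') (rou R N ^+ j) (gpt R i' j)) ^+ 2.
  by apply: sumr_ge0.
have /eqP := le_anti (introT andP (conj le0 (sumr_ge0 _ (fun i _ => s1 i)))).
rewrite psumr_eq0 // => /allP/(_ i (mem_index_enum i)) /=.
by rewrite psumr_eq0 // => /allP/(_ j (mem_index_enum j)) /=.
Qed.

End CharacterFormula.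

(** * Estimates on the torus *)

Section Estimates.
Variable R : realType.
Local Notation C := (CC R).
Implicit Types (x y w z : C) (s t c : R).

(** Young's inequality for the numbers r^a and 1 with exponents 1 / a and 1 / (1 - a); it is the
    tangent line at 1 of a concave power. *)
Lemma powR_le_affine (r a : R) : 0 <= r -> 0 < a < 1 -> r `^ a <= a * r + (1 - a).
Proof.
move=> r0 /andP[a0 a1]; have b0 : 0 < 1 - a by rewrite subr_gt0.
have := @conjugate_powR _ (r `^ a) 1 a^-1 (1 - a)^-1 (powR_ge0 _ _) ler01.
rewrite !invr_gt0 !invrK => /(_ a0 b0); rewrite subrKC => /(_ erefl).
by rewrite mulr1 -powRrM mulfV ?gt_eqF // powRr1 // powR1 mul1r [r * a]mulrC.
Qed.

(** The concave tangent bound with exponent 1 / p, applied to r^p. *)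
Lemma bernoulli_powR (r p : R) : 0 <= r -> 1 < p -> p * r - (p - 1) <= r `^ p.
Proof.
move=> r0 p1; have p0 : 0 < p by apply: lt_trans p1.
have a0 : 0 < p^-1 < 1 by rewrite invr_gt0 p0 invf_lt1.
have := powR_le_affine (powR_ge0 r p) a0.
rewrite -powRrM mulfV ?gt_eqF // powRr1 // -(ler_pM2l p0) mulrDr mulrA mulfV ?gt_eqF //.
by rewrite mul1r mulrBr mulr1 mulfV ?gt_eqF //; lra.
Qed.

(** The induction step needs n^(1-s) + (1-s) (n+1)^(-s) <= (n+1)^(1-s). After division by
    (n+1)^(1-s) this is the tangent bound at the ratio n / (n+1). *)
Lemma sum_powR_le s n : 0 < s < 1 ->
  (1 - s) * (\sum_(k < n) ((k.+1)%:R^-1 : R) `^ s) <= n%:R `^ (1 - s).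
Proof.
move=> /andP[s0 s1]; have a0 : 0 < 1 - s < 1 by lra.
elim: n => [|n IH]; first by rewrite big_ord0 mulr0 powR_ge0.
rewrite big_ord_recr /= mulrDr; apply: le_trans (lerD IH (lexx _)) _.
have n0 : 0 < n.+1%:R :> R by rewrite ltr0n.
have en : n%:R = n.+1%:R * (n%:R / n.+1%:R) :> R by rewrite mulrCA mulfV ?gt_eqF // mulr1.
have r0 : 0 <= n%:R / n.+1%:R :> R by rewrite divr_ge0.
rewrite {1}en powRM ?(ltW n0) //.
have e1 : (n.+1%:R^-1 : R) `^ s = n.+1%:R `^ (1 - s) / n.+1%:R.
  rewrite -powR_inv1 ?ltW // -powRrM mulN1r.
  rewrite -powRD; last by rewrite (gt_eqF n0) implybT.
  by congr (_ `^ _); ring.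
have h := powR_le_affine r0 a0.
have er : n%:R / n.+1%:R = 1 - n.+1%:R^-1 :> R.
  by apply: (mulIf (x := n.+1%:R)); rewrite ?gt_eqF // mulfVK ?gt_eqF // mulrBl mulVf ?gt_eqF // mul1r -natr1 addrK.
rewrite e1; have P := powR_ge0 (n.+1%:R : R) (1 - s).
apply: (@le_trans _ _ (n.+1%:R `^ (1 - s) * ((1 - s) * (n%:R / n.+1%:R) + (1 - (1 - s))) +
   (1 - s) * (n.+1%:R `^ (1 - s) / n.+1%:R))); first by rewrite lerD2r ler_wpM2l.
by rewrite er le_eqVlt; apply/orP; left; apply/eqP; ring.
Qed.

Lemma abs_sub_exp x y n : abs x = 1 -> abs y = 1 -> abs (x ^+ n - y ^+ n) <= n%:R * abs (x - y).
Proof.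
move=> hx hy; elim: n => [|n IH]; first by rewrite !expr0 subrr abs0 mul0r.
have -> : x ^+ n.+1 - y ^+ n.+1 = x ^+ n * (x - y) + (x ^+ n - y ^+ n) * y by rewrite !exprSr; ring.
apply: le_trans (absD _ _) _; rewrite !absM absX hx hy expr1n mul1r mulr1.
by rewrite -natr1 mulrDl mul1r addrC lerD2r.
Qed.

Lemma cos_le0 t : pi / 2 <= t <= pi -> cos t <= 0.
Proof.
move=> ht; have := cosDpi (t - pi); rewrite subrK => ->; rewrite oppr_le0.
by apply: cos_ge0_pihalf; have := pi_gt0 R; lra.
Qed.

Lemma rou_gap_half N k : (0 < k)%N -> (2 * k <= N)%N -> k%:R / N%:R <= abs (1 - rou R N ^+ k).
Proof.
move=> k0 kN.
(* [k * m] lies between [N / 4] and [N / 2], so [1 - rou R N ^+ (k * m)] has real part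
   at least 1, and it is at most [m] times the quantity to be bounded. *)
pose m := (N %/ (2 * k))%N.
have m0 : (0 < m)%N by rewrite divn_gt0 //; lia.
have h1 : (m * (2 * k) <= N)%N by exact: leq_divM.
have h2 : (N < m.+1 * (2 * k))%N by rewrite ltn_ceil //; lia.
have N0 : 0 < N%:R :> R by rewrite ltr0n; lia.
have mR : 0 < m%:R :> R by rewrite ltr0n.
have hp := pi_gt0 R.
have big : 1 <= abs (1 - rou R N ^+ (k * m)).
  apply: le_trans (re_le_abs _).
  rewrite /rou -cisMn reD reN /= -[_ *+ (k * m)]mulr_natr.
  have hc : cos (pi *+ 2 / N%:R * (k * m)%:R) <= 0 :> R.
    apply: cos_le0.
    have -> : pi *+ 2 / N%:R * (k * m)%:R = pi * ((2 * (k * m)%:R) / N%:R) :> R.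
      by rewrite -[pi *+ 2]mulr_natr; ring.
    apply/andP; split.
      rewrite ler_pM2l // ler_pdivlMr // mulrC -ler_pdivlMr ?invr_gt0 // invrK.
      by rewrite -!natrM ler_nat; nia.
    rewrite -[leRHS]mulr1 ler_pM2l // ler_pdivrMr // mul1r -natrM ler_nat; nia.
  by apply: le_trans (ler_norm _); lra.
have le : 1 <= m%:R * abs (1 - rou R N ^+ k).
  apply: le_trans big _; rewrite exprM -{1}[1](expr1n _ m).
  by apply: abs_sub_exp; rewrite ?abs1 // absX abs_rou expr1n.
apply: (@le_trans _ _ (m%:R^-1)).
  rewrite ler_pdivrMr // -ler_pdivrMl ?invr_gt0 // invrK -natrM ler_nat; nia.
by rewrite -(ler_pM2l mR) mulfV ?gt_eqF.
Qed.

(* [dist s x x] is 0, since [0^-1 = 0] and [0 `^ s = 0] for [s != 0]. *)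
Definition dist s x y : R := (abs (x - y))^-1 `^ s.

(** The smaller of k and N - k is at most N / 2, and [rou_gap_half] applies to it, the chord being
    the same for both. Adding the two terms avoids recording which one it was. *)
Lemma rou_gap N k s : (0 < k < N)%N -> 0 < s ->
  dist s 1 (rou R N ^+ k) <=
    (N%:R : R) `^ s * ((k%:R^-1 : R) `^ s + ((N - k)%:R^-1 : R) `^ s).
Proof.
move=> /andP[k0 kN] s0; have N0 : 0 < N%:R :> R by rewrite ltr0n; lia.
have gap j : (0 < j)%N -> j%:R / N%:R <= abs (1 - rou R N ^+ k) ->
    dist s 1 (rou R N ^+ k) <= (N%:R : R) `^ s * (j%:R^-1 : R) `^ s.
  move=> j0 h; have jR : 0 < j%:R :> R by rewrite ltr0n.
  have h0 : 0 < abs (1 - rou R N ^+ k) by apply: lt_le_trans h; rewrite divr_gt0.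
  rewrite /dist -powRM ?invr_ge0 ?(ltW N0) ?(ltW jR) //.
  apply: (ge0_ler_powR (ltW s0)); rewrite ?nnegrE; [by rewrite invr_ge0 ltW|by rewrite ltW ?divr_gt0|].
  by rewrite -[leRHS]invrK lef_pV2 ?posrE ?invr_gt0 ?divr_gt0 // invf_div.
rewrite mulrDr; have [h|h] := leqP (2 * k) N.
  apply: le_trans (gap k k0 (rou_gap_half k0 h)) _.
  by rewrite lerDl mulr_ge0 ?powR_ge0.
apply: le_trans (gap (N - k)%N _ _) _; first by lia.
  have := @rou_gap_half N (N - k) ltac:(lia) ltac:(lia).
  have -> // : abs (1 - rou R N ^+ (N - k)) = abs (1 - rou R N ^+ k).
  have e : rou R N ^+ k * (1 - rou R N ^+ (N - k)) = - (1 - rou R N ^+ k).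
    rewrite mulrBr mulr1 -exprD subnKC ?rouN ?opprB //; lia.
  by rewrite -[RHS]absN -e absM absX abs_rou expr1n mul1r.
by rewrite lerDr mulr_ge0 ?powR_ge0.
Qed.

(** Each of the two sums of powers is at most N^(1-s) / (1-s), and the factor N^s restores a full
    power of N. The singular index k = 0 contributes nothing, by the convention on [dist]. *)
Lemma sum_dist1 N s : (0 < N)%N -> 0 < s < 1 ->
  \sum_(k < N) dist s 1 (rou R N ^+ k) <= 2 / (1 - s) * N%:R.
Proof.
move=> N0 hs; have /andP[s0 s1] := hs; have a0 : 0 < 1 - s by rewrite subr_gt0.
have NR : 0 < N%:R :> R by rewrite ltr0n.
pose g k : R := (k%:R^-1 : R) `^ s.
have g0 k : 0 <= g k by exact: powR_ge0.
apply: (@le_trans _ _ (\sum_(k < N) N%:R `^ s * (g k + g (N - k)%N))).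
  apply: ler_sum => -[[|k] hk] _ /=; last by apply: rou_gap => //; rewrite hk.
  rewrite /dist expr0 subrr abs0 invr0 powR0 ?gt_eqF //.
  by rewrite mulr_ge0 ?powR_ge0 // addr_ge0.
rewrite -mulr_sumr big_split /=.
have hg : \sum_(k < N) g k.+1 <= N%:R `^ (1 - s) / (1 - s).
  by rewrite ler_pdivlMr // mulrC; exact: sum_powR_le.
have h1 : \sum_(k < N) g k <= N%:R `^ (1 - s) / (1 - s).
  apply: le_trans hg; case: {+}N => [|n]; first by rewrite !big_ord0.
  rewrite big_ord_recl [leRHS]big_ord_recr /= addrC; apply: lerD => //.
  by rewrite /g invr0 powR0 ?gt_eqF // powR_ge0.
have h2 : \sum_(k < N) g (N - k)%N <= N%:R `^ (1 - s) / (1 - s).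
  apply: le_trans hg; rewrite (reindex_inj rev_ord_inj) /=.
  by rewrite le_eqVlt; apply/orP; left; apply/eqP; apply: eq_bigr => k _; congr (g _); have := ltn_ord k; lia.
apply: (@le_trans _ _ (N%:R `^ s * (N%:R `^ (1 - s) / (1 - s) + N%:R `^ (1 - s) / (1 - s)))).
  by rewrite ler_wpM2l ?powR_ge0 // lerD.
have e : N%:R `^ s * N%:R `^ (1 - s) = N%:R :> R.
  rewrite -powRD; last by rewrite (gt_eqF NR) implybT.
  by rewrite subrKC powRr1 // ltW.
have -> : N%:R `^ s * (N%:R `^ (1 - s) / (1 - s) + N%:R `^ (1 - s) / (1 - s)) =
   2 / (1 - s) * (N%:R `^ s * N%:R `^ (1 - s)) :> R by ring.
by rewrite e.
Qed.

Lemma sum_dist N s (i : 'I_N) : 0 < s < 1 ->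
  \sum_(j < N) dist s (rou R N ^+ i) (rou R N ^+ j) <= 2 / (1 - s) * N%:R.
Proof.
move=> hs; have N0 : (0 < N)%N by case: {+}N i => [[]|].
pose h (k : 'I_N) : 'I_N := Ordinal (ltn_pmod (i + k)%N N0).
have hh k : rou R N ^+ h k = rou R N ^+ i * rou R N ^+ k.
  by rewrite /= expr_mod ?rouN // exprD.
have hinj : injective h.
  move=> j k e; apply: (@rou_inj R) => //.
  by apply: (mulfI (expf_neq0 i (rou_neq0 R N))); rewrite -!hh e.
rewrite (reindex_inj hinj) /=; apply: le_trans (sum_dist1 N0 hs).
rewrite le_eqVlt; apply/orP; left; apply/eqP; apply: eq_bigr => k _.
have := hh k; rewrite /= => ->.
rewrite /dist -{1}[rou R N ^+ i]mulr1 -mulrBr absM absX abs_rou expr1n mul1r //.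
Qed.

Definition ravg N (f : C -> C -> C -> R) : R :=
  (N%:R ^+ 2)^-1 * \sum_(i < N) \sum_(j < N) f (rou R N ^+ i) (rou R N ^+ j) (gpt R i j).

Lemma ravg_le N f h : (forall i j : 'I_N, f (rou R N ^+ i) (rou R N ^+ j) (gpt R i j) <=
    h (rou R N ^+ i) (rou R N ^+ j) (gpt R i j)) -> ravg N f <= ravg N h.
Proof.
move=> le; rewrite ler_wpM2l ?invr_ge0 ?sqr_ge0 //.
by apply: ler_sum => i _; apply: ler_sum => j _.
Qed.

Lemma ravg_add N f h : ravg N (fun x y w => f x y w + h x y w) = ravg N f + ravg N h.
Proof.
rewrite /ravg -mulrDr; congr (_ * _); rewrite -big_split; apply: eq_bigr => i _.
by rewrite -big_split.
Qed.

Lemma ravg_scale N k f : ravg N (fun x y w => k * f x y w) = k * ravg N f.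
Proof.
rewrite /ravg mulrCA; congr (_ * _); rewrite mulr_sumr; apply: eq_bigr => i _.
by rewrite mulr_sumr.
Qed.

Lemma ravg_cst N k : (0 < N)%N -> ravg N (fun _ _ _ => k) = k.
Proof.
move=> N0; rewrite /ravg !sumr_const !card_ord -mulrnA -[k *+ _]mulr_natr natrM mulrCA.
by rewrite -expr2 mulVf ?mulr1 // expf_neq0 // pnatr_eq0 -lt0n.
Qed.

Lemma ravg_gridavg N f : gridavg N (fun x y w => ofreal (f x y w)) = ofreal (ravg N f).
Proof. exact: gridavg_ofreal. Qed.

Lemma ravg_dist N s : (0 < N)%N -> 0 < s < 1 ->
  [/\ ravg N (fun x y w => dist s x y) <= 2 / (1 - s), ravg N (fun x y w => dist s x w) <= 2 / (1 - s) &
   ravg N (fun x y w => dist s y w) <= 2 / (1 - s)].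
Proof.
move=> N0 hs.
have e1 : ravg N (fun x y w => dist s x w) = ravg N (fun x y w => dist s x y).
  by apply: (@ofreal_inj R); rewrite -!ravg_gridavg -[RHS](gridavg_swap23 N0).
have e2 : ravg N (fun x y w => dist s y w) = ravg N (fun x y w => dist s x w).
  by apply: (@ofreal_inj R); rewrite -!ravg_gridavg -[RHS](gridavg_swap12 N).
rewrite e2 e1; suff h : ravg N (fun x y w => dist s x y) <= 2 / (1 - s) by [].
have NR : 0 < N%:R :> R by rewrite ltr0n.
rewrite /ravg mulrC ler_pdivrMr ?exprn_gt0 //.
apply: (@le_trans _ _ (\sum_(i < N) 2 / (1 - s) * N%:R)).
  by apply: ler_sum => i _; exact: sum_dist.
by rewrite sumr_const card_ord -[_ *+ N]mulr_natr -mulrA expr2.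
Qed.

End Estimates.

Section PointwiseBounds.
Variable R : realType.
Local Notation C := (CC R).
Implicit Types (x y w z : C) (s t c : R).

Definition perimeter x y w : R := abs (x - y) + abs (x - w) + abs (y - w).

Lemma exprz_nat z (n : nat) : z ^ n%:Z = z ^+ n. Proof. by []. Qed.

(** Expanding along the exponent P leaves differences of Q-th powers, each at most Q times a
    distance between eigenvalues. *)
Lemma alternant_le_second x y w (P Q : nat) : torus3 x y w ->
  abs (alternant P%:Z Q%:Z 0 x y w) <= Q%:R * perimeter x y w.
Proof.
move=> [hx hy hw _].
have -> : alternant P%:Z Q%:Z 0 x y w =
    x ^+ P * (y ^+ Q - w ^+ Q) + (y ^+ P * (w ^+ Q - x ^+ Q) + w ^+ P * (x ^+ Q - y ^+ Q)).
  by rewrite /alternant /mono !expr0z !exprz_nat; ring.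
have b z z' z'' : abs z = 1 -> abs z' = 1 -> abs z'' = 1 ->
    abs (z ^+ P * (z' ^+ Q - z'' ^+ Q)) <= Q%:R * abs (z' - z'').
  by move=> h h' h''; rewrite absM absX h expr1n mul1r; exact: abs_sub_exp.
have := le_trans (absD _ _) (lerD (b x y w hx hy hw) (le_trans (absD _ _)
   (lerD (b y w x hy hw hx) (b w x y hw hx hy)))).
by move=> h; apply: le_trans h _; rewrite /perimeter (absC w x); lra.
Qed.

(** Determinant 1 allows Q to be subtracted from all exponents, giving (P, 0, -Q). Expanding along
    the exponent -Q then leaves differences of P-th powers. *)
Lemma alternant_le_difference x y w (P Q : nat) : torus3 x y w ->
  abs (alternant (Q + P)%N%:Z Q%:Z 0 x y w) <= P%:R * perimeter x y w.
Proof.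
move=> ht; have [hx hy hw _] := ht.
have -> : alternant (Q + P)%N%:Z Q%:Z 0 x y w = alternant P%:Z 0 (- Q%:Z) x y w.
  by rewrite -(alternant_shift P%:Z 0 (- Q%:Z) Q%:Z ht) PoszD add0r addNr addrC.
have -> : alternant P%:Z 0 (- Q%:Z) x y w =
    w ^- Q * (x ^+ P - y ^+ P) + (y ^- Q * (w ^+ P - x ^+ P) + x ^- Q * (y ^+ P - w ^+ P)).
  by rewrite /alternant /mono !expr0z -!exprnN !exprz_nat; ring.
have b z z' z'' : abs z = 1 -> abs z' = 1 -> abs z'' = 1 ->
    abs (z ^- Q * (z' ^+ P - z'' ^+ P)) <= P%:R * abs (z' - z'').
  by move=> h h' h''; rewrite absM absV absX h expr1n invr1 mul1r; exact: abs_sub_exp.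
have := le_trans (absD _ _) (lerD (b w x y hw hx hy) (le_trans (absD _ _)
   (lerD (b y w x hy hw hx) (b x y w hx hy hw)))).
by move=> h; apply: le_trans h _; rewrite /perimeter (absC w x); lra.
Qed.

Lemma powR_le1D (a s : R) : 0 <= a -> 0 < s < 1 -> a `^ s <= 1 + a.
Proof.
move=> a0 hs; apply: le_trans (powR_le_affine a0 hs) _.
have /andP[s0 s1] := hs.
suff : s * a <= a by lra.
by rewrite ler_piMl // ltW.
Qed.

(** In [product_bound], c^2 comes from the squared numerator bound, 1 + 16 c dominates (16 c)^s for
    every s in (0, 1), and 42 = 6^2 + 6 bounds S^2 + S for a perimeter S <= 6. *)
Definition bound_const c : R := c ^+ 2 * (1 + 16 * c) * 42.

Lemma bound_const_ge0 c : 0 <= c -> 0 <= bound_const c.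
Proof. by move=> c0; rewrite !mulr_ge0 ?sqr_ge0 ?addr_ge0 ?mulr_ge0. Qed.

(** With d1 the shortest side, the triangle inequalities give S <= 4 d2 and S <= 4 d3, so the
    hypothesis becomes X <= 16 c / (d1 S). The exponent is split as 2 + s: X^2 absorbs the squared
    Vandermonde product and leaves c^2 S^2, while X^s carries the only singularity, d1^(-s). *)
Lemma product_bound c s X d1 d2 d3 : 0 <= c -> 0 < s < 1 -> 0 <= X -> 0 < d1 ->
  d1 <= d2 -> d1 <= d3 -> d2 <= d1 + d3 -> d3 <= d1 + d2 -> d1 + d2 + d3 <= 6 ->
  X * (d1 * d2 * d3) <= c * (d1 + d2 + d3) ->
  X `^ (2 + s) * (d1 * d2 * d3) ^+ 2 <= bound_const c * d1^-1 `^ s.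
Proof.
move=> c0 hs X0 d10 d12 d13 t2 t3 S6 hX; have /andP[s0 s1] := hs.
pose S := d1 + d2 + d3; rewrite -/S in S6 hX.
have d20 : 0 < d2 by lra.
have d30 : 0 < d3 by lra.
have S0 : 0 < S by rewrite /S; lra.
have S1 : S <= 4 * d2 by rewrite /S; lra.
have S2 : S <= 4 * d3 by rewrite /S; lra.
have SS : S * S <= 16 * (d2 * d3).
  have -> : 16 * (d2 * d3) = (4 * d2) * (4 * d3) by ring.
  by apply: ler_pM => //; exact: ltW.
have hX2 : X <= 16 * c * d1^-1 * S^-1.
  rewrite !ler_pdivlMr //.
  have h : X * d1 * (S * S) <= 16 * c * S.
    apply: (@le_trans _ _ (16 * (X * (d1 * d2 * d3)))); last first.
      by rewrite -[16 * c * S]mulrA ler_wpM2l.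
    have -> : 16 * (X * (d1 * d2 * d3)) = X * d1 * (16 * (d2 * d3)) by ring.
    by rewrite ler_wpM2l // mulr_ge0 // ltW.
  rewrite -(ler_pM2r S0); apply: le_trans h; rewrite le_eqVlt; apply/orP; left; apply/eqP; ring.
have e : X `^ (2 + s) = X ^+ 2 * X `^ s.
  by rewrite powRD ?powR_mulrn //; apply/implyP => /eqP h; exfalso; lra.
have hs1 : X `^ s <= (1 + 16 * c) * d1^-1 `^ s * (1 + S^-1).
  apply: (@le_trans _ _ ((16 * c * d1^-1 * S^-1) `^ s)).
    apply: (ge0_ler_powR (ltW s0)); rewrite ?nnegrE // !mulr_ge0 // invr_ge0 ltW //.
  have c16 : 0 <= 16 * c by rewrite mulr_ge0.
  have i1 : 0 <= d1^-1 by rewrite invr_ge0 ltW.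
  have i2 : 0 <= S^-1 by rewrite invr_ge0 ltW.
  rewrite (powRM s (mulr_ge0 c16 i1) i2) (powRM s c16 i1); apply: ler_pM; rewrite ?mulr_ge0 ?powR_ge0 //.
    by rewrite ler_wpM2r ?powR_ge0 // powR_le1D.
  exact: powR_le1D.
have hsq : X ^+ 2 * (d1 * d2 * d3) ^+ 2 <= c ^+ 2 * S ^+ 2.
  by rewrite -!exprMn lerXn2r // ?nnegrE ?mulr_ge0 // ltW.
rewrite e mulrAC; apply: (@le_trans _ _ (c ^+ 2 * S ^+ 2 * ((1 + 16 * c) * d1^-1 `^ s * (1 + S^-1)))).
  exact: ler_pM (mulr_ge0 (sqr_ge0 _) (sqr_ge0 _)) (powR_ge0 _ _) hsq hs1.
have -> : c ^+ 2 * S ^+ 2 * ((1 + 16 * c) * d1^-1 `^ s * (1 + S^-1)) =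
   c ^+ 2 * (1 + 16 * c) * d1^-1 `^ s * (S ^+ 2 + S * (S * S^-1)) by ring.
have -> : bound_const c * d1^-1 `^ s = c ^+ 2 * (1 + 16 * c) * d1^-1 `^ s * 42 by rewrite /bound_const; ring.
apply: ler_wpM2l; first by rewrite !mulr_ge0 ?sqr_ge0 ?powR_ge0 ?addr_ge0 ?mulr_ge0.
rewrite mulfV ?gt_eqF // mulr1.
have : S ^+ 2 <= 6 ^+ 2 by rewrite lerXn2r // nnegrE // ltW.
lra.
Qed.

(** The cases sort the three distances so that [product_bound] is applied with the shortest one
    first. If some distance is 0, the left side vanishes. *)
Lemma pointwise_bound c s X x y w : 0 <= c -> 0 < s < 1 -> 0 <= X -> torus3 x y w ->
  X * abs (vdm x y w) <= c * perimeter x y w ->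
  X `^ (2 + s) * abs (vdm x y w) ^+ 2 <= bound_const c * (dist s x y + dist s x w + dist s y w).
Proof.
move=> c0 hs X0 [hx hy hw _]; rewrite /vdm !absM /perimeter /dist.
have B := bound_const_ge0 c0.
have tri a b d : abs (a - b : C) <= abs (a - d) + abs (d - b).
  by have := absD (a - d) (d - b); rewrite addrA subrK.
have le2 a b : abs a = 1 -> abs b = 1 -> abs (a - b : C) <= 2.
  by move=> ha hb; apply: le_trans (absD _ _) _; rewrite absN ha hb; lra.
have t1 := tri x y w; rewrite (absC w y) in t1.
have t2 := tri x w y; have t3 := tri y w x; rewrite (absC y x) in t3.
have l1 := le2 _ _ hx hy; have l2 := le2 _ _ hx hw; have l3 := le2 _ _ hy hw.
have := abs_ge0 (x - y); have := abs_ge0 (x - w); have := abs_ge0 (y - w).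
move: (abs (x - y)) (abs (x - w)) (abs (y - w)) t1 t2 t3 l1 l2 l3 => p q r.
move=> t1 t2 t3 l1 l2 l3 r0 q0 p0 hX.
have P a : 0 <= a^-1 `^ s by exact: powR_ge0.
have [z|nz] := eqVneq (p * q * r) 0.
  by rewrite z expr0n mulr0 mulr_ge0 // !addr_ge0.
have [[pp pq] pr] : (0 < p /\ 0 < q) /\ 0 < r.
  by move: nz; rewrite !mulf_eq0 !negb_or => /andP[/andP[a b] d]; rewrite !lt0r a b d.
have hpq : 0 <= p^-1 `^ s + q^-1 `^ s + r^-1 `^ s by rewrite !addr_ge0.
case: (leP p q) => h1; case: (leP p r) => h2; case: (leP q r) => h3; try (exfalso; lra).
- apply: le_trans (product_bound c0 hs X0 pp h1 h2 _ _ _ hX) _; try lra.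
  by rewrite ler_wpM2l // -addrA lerDl addr_ge0.
- apply: le_trans (product_bound c0 hs X0 pp h1 h2 _ _ _ hX) _; try lra.
  by rewrite ler_wpM2l // -addrA lerDl addr_ge0.
- have e1 : p * q * r = r * p * q by ring.
  have e2 : p + q + r = r + p + q by ring.
  rewrite e1 e2 in hX *.
  apply: le_trans (product_bound c0 hs X0 pr _ _ _ _ _ hX) _; try lra.
  by rewrite ler_wpM2l // lerDr addr_ge0.
- have e1 : p * q * r = q * p * r by ring.
  have e2 : p + q + r = q + p + r by ring.
  rewrite e1 e2 in hX *.
  apply: le_trans (product_bound c0 hs X0 pq _ _ _ _ _ hX) _; try lra.
  by rewrite ler_wpM2l // addrAC lerDr addr_ge0.
- have e1 : p * q * r = q * p * r by ring.
  have e2 : p + q + r = q + p + r by ring.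
  rewrite e1 e2 in hX *.
  apply: le_trans (product_bound c0 hs X0 pq _ _ _ _ _ hX) _; try lra.
  by rewrite ler_wpM2l // addrAC lerDr addr_ge0.
- have e1 : p * q * r = r * p * q by ring.
  have e2 : p + q + r = r + p + q by ring.
  rewrite e1 e2 in hX *.
  apply: le_trans (product_bound c0 hs X0 pr _ _ _ _ _ hX) _; try lra.
  by rewrite ler_wpM2l // lerDr addr_ge0.
Qed.

Lemma ravg_bound N c s (X : C -> C -> C -> R) : (0 < N)%N -> 0 <= c -> 0 < s < 1 ->
  (forall x y w, 0 <= X x y w) ->
  (forall i j : 'I_N, let x := rou R N ^+ i in let y := rou R N ^+ j in let w := gpt R i j in
     X x y w * abs (vdm x y w) <= c * perimeter x y w) ->
  ravg N (fun x y w => X x y w `^ (2 + s) * abs (vdm x y w) ^+ 2) <= bound_const c * (6 / (1 - s)).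
Proof.
move=> N0 c0 hs X0 hX.
apply: (@le_trans _ _ (ravg N (fun x y w => bound_const c * (dist s x y + dist s x w + dist s y w)))).
  apply: ravg_le => i j; apply: pointwise_bound => //; exact: grid_torus.
rewrite ravg_scale ler_wpM2l ?bound_const_ge0 // !ravg_add.
have [h1 h2 h3] := ravg_dist N0 hs.
have -> : 6 / (1 - s) = 2 / (1 - s) + 2 / (1 - s) + 2 / (1 - s) :> R by ring.
by rewrite !lerD.
Qed.

End PointwiseBounds.

(** * Integrals of powers of the character *)

Section Bernstein.

(* The recursion follows Pascal's rule: [bern n f x] is the Bernstein polynomial
   [\sum_k 'C(n, k) x^k (1 - x)^(n - k) f k], that is, the expectation of [f] at a
   binomial variable of parameters [n] and [x]. *)
Fixpoint bern (K : comNzRingType) (n : nat) (f : nat -> K) (x : K) : K :=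
  if n is n'.+1 then (1 - x) * bern n' f x + x * bern n' (fun k => f k.+1) x else f 0%N.

Variable R : realType.
Implicit Types (x : R) (f h : nat -> R).

Lemma bern_lin n (u v : R) f x : bern n (fun k => u + v * f k) x = u + v * bern n f x.
Proof. by elim: n f => [//|n IH] f /=; rewrite IH (IH (fun k => f k.+1)); ring. Qed.

Lemma bern_le n f h x : 0 <= x <= 1 -> (forall k, (k <= n)%N -> f k <= h k) ->
  bern n f x <= bern n h x.
Proof.
move=> /andP[x0 x1]; elim: n f h => [|n IH] f h le /=; first exact: le.
apply: lerD; apply: ler_wpM2l; rewrite ?subr_ge0 //; apply: IH => k kn; apply: le => //.
exact: leqW.
Qed.

(** Squared mean plus variance of a binomial variable. The shift a is kept general because the
    recursion replaces k by k + 1. *)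
Lemma bern_sq n (a x : R) :
  bern n (fun k => (k%:R + a) ^+ 2) x = (n%:R * x + a) ^+ 2 + n%:R * x * (1 - x).
Proof.
elim: n a => [|n IH] a /=; first by rewrite !mul0r addr0.
have -> : (fun k => (k.+1%:R + a) ^+ 2) = (fun k : nat => (k%:R + (1 + a)) ^+ 2 : R).
  by apply/funext => k; rewrite -natr1 addrA.
by rewrite !IH -natr1; ring.
Qed.

(** A second-moment argument: the deviation of h at k / n is at most 1/2 plus v G(k), and the
    binomial variance makes the mean of v G at most 1/2 once n is large. The scale v is chosen so
    that v G(k) = 2 L (L + 1) |k/n - x|^2. *)
Lemma bernstein_approx (h : R -> R) (L : R) n x : 0 <= L ->
  (forall a b, 0 <= a <= 1 -> 0 <= b <= 1 -> `|h a - h b| <= L * `|a - b|) ->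
  (0 < n)%N -> 4 * L * (L + 1) <= n%:R -> 0 <= x <= 1 ->
  `|bern n (fun k => h (k%:R / n%:R)) x - h x| <= 1.
Proof.
move=> L0 hL n0 nL x01; have n0R : 0 < n%:R :> R by rewrite ltr0n.
pose v := 2 * L * (L + 1) / n%:R ^+ 2.
have v0 : 0 <= v by rewrite divr_ge0 ?sqr_ge0 // !mulr_ge0 // addr_ge0.
pose G (k : nat) : R := (k%:R + - (n%:R * x)) ^+ 2.
have hG : v * bern n G x <= 2^-1.
  rewrite bern_sq subrr expr0n add0r.
  have -> : v * (n%:R * x * (1 - x)) = 2 * L * (L + 1) / n%:R * (x * (1 - x)).
    rewrite /v; field; exact: lt0r_neq0.
  have h1 : 2 * L * (L + 1) / n%:R <= 2^-1 by rewrite ler_pdivrMr //; lra.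
  have h0 : 0 <= 2 * L * (L + 1) / n%:R by rewrite divr_ge0 ?(ltW n0R) // !mulr_ge0 // addr_ge0.
  have h2 : x * (1 - x) <= 1 by nra.
  by apply: le_trans h1; rewrite ler_piMr.
have key k : (k <= n)%N -> `|h (k%:R / n%:R) - h x| <= 2^-1 + v * G k.
  move=> kn; apply: le_trans (hL _ _ _ x01) _.
    by rewrite divr_ge0 //= ler_pdivrMr // mul1r ler_nat.
  have -> : v * G k = 2 * L * (L + 1) * `|k%:R / n%:R - x| ^+ 2.
    rewrite real_normK ?num_real // /v /G; field; exact: lt0r_neq0.
  have : 0 <= `|k%:R / n%:R - x| by [].
  move: `|_ - x| => d d0.
  (* Either d is so small that L d <= 1/2, or 1 < 2 (L + 1) d, and multiplying this by L d bounds L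
     d by the quadratic term. *)
  have [dL|dL] := leP (2 * (L + 1) * d) 1; last by have := ler_wpM2l (mulr_ge0 L0 d0) (ltW dL); nra.
  have : 0 <= 2 * L * (L + 1) * d ^+ 2 by rewrite !mulr_ge0 ?sqr_ge0 // addr_ge0.
  have : L * d <= (L + 1) * d by rewrite ler_wpM2r // lerDl.
  lra.
rewrite ler_norml; apply/andP; split.
  have h1 : bern n (fun k => (h x - 2^-1) + (- v) * G k) x <= bern n (fun k => h (k%:R / n%:R)) x.
    by apply: bern_le => // k /key; rewrite ler_norml => /andP[]; lra.
  by move: h1; rewrite bern_lin; lra.
have h1 : bern n (fun k => h (k%:R / n%:R)) x <= bern n (fun k => (h x + 2^-1) + v * G k) x.
  by apply: bern_le => // k /key; rewrite ler_norml => /andP[]; lra.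
by move: h1; rewrite bern_lin; lra.
Qed.

(** For a <= b, Bernoulli's inequality at the ratio a / b, scaled by b^p, bounds the increment by
    b^p p (1 - a / b); then b^p <= b on [0, 1]. *)
Lemma powR_lipschitz (p a b : R) : 1 < p -> 0 <= a <= 1 -> 0 <= b <= 1 ->
  `|a `^ p - b `^ p| <= p * `|a - b|.
Proof.
move=> p1; have p0 : 0 < p by lra.
wlog ab : a b / a <= b.
  move=> H ha hb; have [ab|ba] := leP a b; first exact: H.
  by rewrite distrC [`|a - b|]distrC; apply: H => //; exact: ltW.
move=> /andP[a0 a1] /andP[b0 b1].
have mono : a `^ p <= b `^ p by apply: (ge0_ler_powR (ltW p0)); rewrite ?nnegrE.
rewrite distrC [`|a - b|]distrC !ger0_norm ?subr_ge0 //.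
have [bz|bn] := eqVneq b 0.
  have az : a = 0 by lra.
  by rewrite az bz subrr subrr mulr0.
have bp : 0 < b by rewrite lt0r bn.
have e : a = b * (a / b) by rewrite mulrCA mulfV // mulr1.
have r0 : 0 <= a / b by rewrite divr_ge0.
have := bernoulli_powR r0 p1 => hb.
have bb : b `^ p <= b.
  by apply: ge1r_powR; rewrite ?bp ?(ltW p1).
rewrite {1}e powRM //.
have r1 : a / b <= 1 by rewrite ler_pdivrMr // mul1r.
have h1 : b `^ p * (p * (a / b) - (p - 1)) <= b `^ p * (a / b) `^ p by rewrite ler_wpM2l ?powR_ge0.
have h2 : b `^ p * (p * (1 - a / b)) <= b * (p * (1 - a / b)).
  by rewrite ler_wpM2r // mulr_ge0 ?(ltW p0) // subr_ge0.
have h3 : b * (p * (1 - a / b)) = p * (b - a) by field.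
lra.
Qed.

End Bernstein.

Section BernsteinClass.
Variable R : realType.
Local Notation C := (CC R).
Local Notation M3 := 'M[C]_3.
Implicit Types (X : M3 -> C) (f : nat -> C).

Lemma bern_ofreal n (f : nat -> R) (x : R) :
  bern n (fun k => ofreal (f k) : C) (ofreal x) = ofreal (bern n f x).
Proof.
elim: n f => [//|n IH] f /=.
by rewrite IH (IH (fun k => f k.+1)) ofrealD !ofrealM ofrealD ofrealN ofreal1.
Qed.

Lemma contf_bern n f X : contf X -> contf (fun g => bern n f (X g)).
Proof.
move=> cX; elim: n f => [|n IH] f; first exact: contf_cst.
exact: (contf_add (contf_mul (contf_add (@contf_cst R 1) (contf_opp cX)) (IH f))
  (contf_mul cX (IH (fun k => f k.+1)))).
Qed.

Lemma classf_bern n f X : classf X -> classf (fun g => bern n f (X g)).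
Proof. by move=> cX u g hu hg; rewrite cX. Qed.

Lemma monosum_bern n f X : monosum X -> monosum (fun g => bern n f (X g)).
Proof.
move=> cX; elim: n f => [|n IH] f; first exact: monosum_cst.
have h : monosum (fun g => 1 - X g).
  have := monosum_add (monosum_cst 1) (monosum_mul (monosum_cst (-1)) cX).
  by have -> : (fun g => 1 + -1 * X g) = (fun g => 1 - X g) by apply/funext => g; rewrite mulN1r.
exact: (monosum_add (monosum_mul h (IH f)) (monosum_mul cX (IH (fun k => f k.+1)))).
Qed.

End BernsteinClass.

Section CharacterIntegral.
Variable R : realType.
Local Notation C := (CC R).
Local Notation M3 := 'M[C]_3.
Variable m : {measure set (borelM3 R) -> \bar R}.
Hypothesis haar_m : haar m.
Variable V : irrep R.
Local Notation n := (repdim V).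
Local Notation chi := (character V).
Variables (a b : 'I_n -> int) (k0 k1 : int).
Hypothesis hchi : forall x y w, torus3 x y w -> chi (dg3 x y w) = \sum_i mono (a i) (b i) 0 x y w.
Hypothesis hk : 0 <= k1 <= k0.
Hypothesis hdom : forall i, exists c1 c2 c3 : nat,
  k0 - a i = c1%:Z + c2%:Z + 2 * c3%:Z /\ k1 - b i = - c1%:Z + 2 * c2%:Z + c3%:Z.
Hypothesis htop : exists i, a i = k0 /\ b i = k1.

Lemma numerator_le (c : R) x y w : Num.min (k1%:~R + 1) (k0%:~R - k1%:~R + 1) <= c -> torus3 x y w ->
  abs (@alternant R (k0 + 2) (k1 + 1) 0 x y w) <= c * perimeter x y w.
Proof.
move=> hc ht; have S0 : 0 <= perimeter x y w by rewrite !addr_ge0 ?abs_ge0.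
have e1 : k1 + 1 = `|(k1 + 1)%R|%N%:Z by lia.
have e2 : k0 + 2 = (`|(k1 + 1)%R| + `|(k0 - k1 + 1)%R|)%N%:Z by lia.
have [h|h] : k1%:~R + 1 <= c \/ k0%:~R - k1%:~R + 1 <= c.
  by move: hc; rewrite ge_min => /orP[]; [left|right].
  rewrite e2 {2}e1; apply: le_trans (alternant_le_second _ _ ht) _.
  rewrite ler_wpM2r //; apply: le_trans h.
  by rewrite -[leLHS]/(`|(k1 + 1)%R|%N%:Z%:~R) -e1 intrD.
rewrite e2 {2}e1; apply: le_trans (alternant_le_difference _ _ ht) _.
rewrite ler_wpM2r //; apply: le_trans h.
have -> : `|(k0 - k1 + 1)%R|%N%:R = (k0 - k1 + 1)%:~R :> R.
  by rewrite -[LHS]/(`|(k0 - k1 + 1)%R|%N%:Z%:~R); congr (_%:~R); lia.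
by rewrite intrD intrB.
Qed.

(** [B] is a polynomial in |chi|^2, so its integral is an exact torsion average, where the character
    formula and [ravg_bound] apply. Its degree depends on the representation, the bound does not.
    The constant 11 exceeds 64 / 6, where 64 bounds the squared Vandermonde product that multiplies
    the error 1 and 1/6 is the weight of the integration formula. *)
Lemma character_bernstein_bound (c s : R) :
  Num.min (k1%:~R + 1) (k0%:~R - k1%:~R + 1) <= c -> 0 < s < 1 ->
  exists B : M3 -> R, [/\ {within (@SU3 R), continuous B},
    forall g, SU3 g -> abs (chi g) `^ (2 + s) <= B g + 1 &
    ERe m B <= 11 + bound_const c / (1 - s)].
Proof.
move=> hc hs; have /andP[s0 s1] := hs.
have c0 : 0 <= c.
  apply: le_trans hc; rewrite le_min; have /andP[h1 h2] := hk.
  by rewrite -intrB !addr_ge0 ?ler0z ?subr_ge0.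
have cc := @character_contf _ V; have hcl := @character_classf _ V.
have [M0 M00 hM0] := contf_bounded cc.
pose M := M0 ^+ 2; have Mp : 0 < M by exact: exprn_gt0.
(* The variable of the polynomial is |chi|^2 / M, which lies in [0, 1], so the exponent 2 + s is
   halved; it stays above 1, as the Lipschitz bound requires. *)
pose p := (2 + s) / 2; have p1 : 1 < p by rewrite /p; lra.
pose h (t : R) := M `^ p * t `^ p.
pose L := M `^ p * p.
have L0 : 0 <= L by rewrite mulr_ge0 ?powR_ge0 //; lra.
have hL u v : 0 <= u <= 1 -> 0 <= v <= 1 -> `|h u - h v| <= L * `|u - v|.
  move=> hu hv; rewrite /h -mulrBr normrM ger0_norm ?powR_ge0 // /L -mulrA.
  by rewrite ler_wpM2l ?powR_ge0 // powR_lipschitz.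
have [d hd] : exists d : nat, 4 * L * (L + 1) < d.+1%:R.
  by exists (Num.truncn (4 * L * (L + 1))); exact: truncnS_gt.
pose X g : C := ofreal M^-1 * (chi g * (chi g)^*%R).
pose t g : R := M^-1 * abs (chi g) ^+ 2.
have Xt g : X g = ofreal (t g) by rewrite /X mul_conj -ofrealM.
have t01 g : SU3 g -> 0 <= t g <= 1.
  move=> hg; rewrite /t mulr_ge0 ?invr_ge0 ?(ltW Mp) ?sqr_ge0 //=.
  by rewrite ler_pdivrMl // mulr1 lerXn2r ?nnegrE ?abs_ge0 ?(ltW M00) // hM0.
pose f (k : nat) : R := h (k%:R / d.+1%:R).
pose Y g : C := bern d.+1 (fun k => ofreal (f k)) (X g).
pose B g : R := bern d.+1 f (t g).
have YB g : Y g = ofreal (B g) by rewrite /Y Xt bern_ofreal.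
have cX : contf X by exact: (@contf_scale R (ofreal M^-1) (fun g => chi g * (chi g)^*%R) (contf_mul cc (contf_conj cc))).
have cY : contf Y by exact: contf_bern.
have clX : classf X by move=> u g hu hg; rewrite /X hcl.
have moX : monosum X.
  have mc := monosum_character hchi.
  exact: (monosum_mul (monosum_cst (ofreal M^-1)) (monosum_mul mc (monosum_conj mc))).
have moY : monosum Y by exact: monosum_bern.
have clY : classf Y by exact: classf_bern.
have hB g : SU3 g -> `|B g - abs (chi g) `^ (2 + s)| <= 1.
  move=> hg; have -> : abs (chi g) `^ (2 + s) = h (t g).
    rewrite /h -powRM ?(ltW Mp) //; last by have /andP[] := t01 _ hg.
    rewrite /t mulrA mulfV ?gt_eqF // mul1r -powR_mulrn ?abs_ge0 // -powRrM.
    by congr (_ `^ _); rewrite /p; field.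
  by apply: bernstein_approx (ltW hd) (t01 _ hg).
have contB : {within (@SU3 R), continuous B}.
  have := contf_re cY.
  by have -> : (fun g => re (Y g)) = B by apply/funext => g; rewrite YB re_ofreal.
exists B; split=> //.
  by move=> g hg; have := hB g hg; rewrite ler_norml => /andP[]; lra.
have [N1 hN1] := weyl_good_monosum haar_m cY clY moY.
have [N2 hN2] := weyl_character_formula haar_m hchi hk hdom htop.
pose N := (N1 + N2).+1.
have N0 : (0 < N)%N by [].
have eE : ERe m B = 6^-1 * ravg N (fun x y w => B (dg3 x y w) * abs (vdm x y w) ^+ 2).
  have -> : ERe m B = re (EE m Y).
    by rewrite re_EE; apply: ERe_ext => g _; rewrite YB re_ofreal.
  rewrite (hN1 N) ?ltnS ?leq_addr // /weyl_avg.
  transitivity (re (ofreal (6^-1 * ravg N (fun x y w => B (dg3 x y w) * abs (vdm x y w) ^+ 2)))).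
    rewrite ofrealM ofrealV ofreal_nat -ravg_gridavg; congr (re (_ * _)).
    by apply: gridavg_ext => x y w _; rewrite YB mul_conj -ofrealM.
  exact: re_ofreal.
pose X' (x y w : C) := abs (chi (dg3 x y w)).
have le1 : ravg N (fun x y w => B (dg3 x y w) * abs (vdm x y w) ^+ 2) <=
   ravg N (fun x y w => X' x y w `^ (2 + s) * abs (vdm x y w) ^+ 2 + 64).
  apply: ravg_le => i j; have ht := @grid_torus R N i j; have [hx hy hw _] := ht.
  have := hB _ (dg3_SU3 ht); rewrite ler_norml => /andP[_ h1].
  have v64 : abs (vdm (rou R N ^+ i) (rou R N ^+ j) (gpt R i j)) ^+ 2 <= 64.
    have le2 u v : abs u = 1 -> abs v = 1 -> abs (u - v : C) <= 2.
      by move=> hu hv; apply: le_trans (absD _ _) _; rewrite absN hu hv; lra.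
    have -> : 64 = (2 * 2 * 2) ^+ 2 :> R by ring.
    rewrite lerXn2r ?nnegrE ?abs_ge0 // /vdm !absM.
    by rewrite !ler_pM ?mulr_ge0 ?abs_ge0 ?le2.
  have := sqr_ge0 (abs (vdm (rou R N ^+ i) (rou R N ^+ j) (gpt R i j))).
  move: v64 h1; rewrite /X'; move: (abs (vdm _ _ _) ^+ 2) (B _) (_ `^ _) => v u z v1 uz v2.
  have : (u - z) * v <= 1 * v by rewrite ler_wpM2r.
  lra.
have le2 : ravg N (fun x y w => X' x y w `^ (2 + s) * abs (vdm x y w) ^+ 2 + 64) <=
   bound_const c * (6 / (1 - s)) + 64.
  rewrite ravg_add ravg_cst // lerD2r; apply: ravg_bound => //; first by move=> *; exact: abs_ge0.
  move=> i j /=; rewrite -absM hN2 ?ltnS ?leq_addl //.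
  exact: numerator_le hc (@grid_torus R N i j).
rewrite eE; have := le_trans le1 le2.
have -> : bound_const c * (6 / (1 - s)) = 6 * (bound_const c / (1 - s)) by ring.
move: (ravg _ _) (bound_const c / (1 - s)) => u v; lra.
Qed.

(** Pointwise |chi|^p <= 1 + |chi|^(2+s) <= B + 2, whether |chi| is below or above 1; the mean of B
    + 2 gives 13 = 11 + 2. *)
Lemma character_Lpnorm_le (c s p : R) :
  Num.min (k1%:~R + 1) (k0%:~R - k1%:~R + 1) <= c -> 0 < s < 1 -> 0 < p <= 2 + s ->
  (Lpnorm m p chi <= ((vol m * (13 + bound_const c / (1 - s))) `^ p^-1)%:E)%E.
Proof.
move=> hc hs /andP[p0 ps]; have [B [cB hB hE]] := character_bernstein_bound hc hs.
have mS := @measurable_SU3 R.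
have cabs : {within (@SU3 R), continuous (fun g => abs (chi g))}.
  apply/subspace_continuousP => g hg; apply: cvg_abs; exact: character_contf.
have cB2 : {within (@SU3 R), continuous (fun g => B g + 2)}.
  apply/subspace_continuousP => g hg; apply: cvgD; last exact: cvg_cst.
  by move/subspace_continuousP: cB; apply.
have hle : (\int[m]_(g in (@SU3 R : set (borelM3 R))) (abs (chi g) `^ p)%:E <=
    (vol m * (13 + bound_const c / (1 - s)))%:E)%E.
  apply: (@le_trans _ _ (\int[m]_(g in (@SU3 R : set (borelM3 R))) (B g + 2)%:E)%E).
    apply: ge0_le_integral => //.
    - by move=> g _; rewrite lee_fin powR_ge0.
    - apply/measurable_EFinP.
      apply: (measurableT_comp (measurable_powR p)).
      exact: continuous_borel_measurable.
    - by apply/measurable_EFinP; exact: continuous_borel_measurable.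
    move=> g hg; rewrite lee_fin; have := hB g hg => h.
    have [h1|h1] := leP (abs (chi g)) 1.
      have : abs (chi g) `^ p <= 1.
        have := @ge0_ler_powR R p (ltW p0) (abs (chi g)) 1; rewrite powR1; apply => //; rewrite ?nnegrE ?abs_ge0 //.
      have := powR_ge0 (abs (chi g)) (2 + s); lra.
    have := ler_powR (ltW h1) ps; lra.
  have iB := integrable_continuous haar_m cB2.
  have -> : (\int[m]_(g in (@SU3 R : set (borelM3 R))) (B g + 2)%:E)%E =
     (vol m * ERe m (fun g => B g + 2))%:E.
    rewrite /ERe mulrCA mulfV ?gt_eqF ?vol_gt0 // mulr1 /Rintegral fineK //.
    by apply: integrable_fin_num.
  rewrite lee_fin ler_wpM2l ?(ltW (vol_gt0 haar_m)) //.
  have -> : ERe m (fun g => B g + 2) = ERe m B + 2.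
    rewrite (@EReD _ _ haar_m B (fun=> 2)) ?(ERe_cst haar_m) //.
    by apply/subspace_continuousP => g hg; exact: cvg_cst.
  lra.
rewrite /Lpnorm -poweR_EFin; apply: gt0_ler_poweR => //.
- by rewrite invr_ge0 ltW.
- rewrite in_itv /= leey andbT; apply: integral_ge0 => g _; rewrite lee_fin; exact: powR_ge0.
rewrite in_itv /= leey andbT; apply: le_trans hle.
by apply: integral_ge0 => g _; rewrite lee_fin; exact: powR_ge0.
Qed.

End CharacterIntegral.

(** * Growth of the dimension *)

Section DimensionGrowth.
Variable R : realType.
Local Notation C := (CC R).
Local Notation M3 := 'M[C]_3.

Lemma sqr_abs_1_cis (t : R) : abs (1 - cis t : C) ^+ 2 = 2 - 2 * cos t.
Proof.
rewrite sqr_abs reD imD reN imN /= sub0r sqrrN.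
have := cos2Dsin2 t; move: (cos t) (sin t) => c d h.
have -> : d ^+ 2 = 1 - c ^+ 2 by rewrite -h; ring.
by ring.
Qed.

Lemma le_cos (t1 t2 : R) : 0 <= t1 -> t1 <= t2 -> t2 <= pi *+ 2 - t1 -> cos t2 <= cos t1.
Proof.
move=> h0 h1 h2; have hp := pi_gt0 R.
have hpi2 : pi *+ 2 = 2 * pi :> R by rewrite mulr_natl.
have base t : t1 <= t -> t <= pi -> cos t <= cos t1.
  move=> ht tp; have [->//|ne] := eqVneq t1 t.
  have lt : t1 < t by rewrite lt_neqAle ne.
  by apply: ltW; rewrite ltr_cos // in_itv /=; lra.
have [tp|tp] := leP t2 pi; first exact: base.
have -> : cos t2 = cos (pi *+ 2 - t2) by rewrite -[RHS]cosN opprB -(cosD2pi (t2 - pi *+ 2)) subrK.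
by apply: base; lra.
Qed.

Variable m : {measure set (borelM3 R) -> \bar R}.
Hypothesis haar_m : haar m.
Variable V : irrep R.
Local Notation n := (repdim V).
Local Notation chi := (character V).
Variables (a b : 'I_n -> int) (k0 k1 : int).
Hypothesis hchi : forall x y w, torus3 x y w -> chi (dg3 x y w) = \sum_i mono (a i) (b i) 0 x y w.
Hypothesis hk : 0 <= k1 <= k0.
Hypothesis hdom : forall i, exists c1 c2 c3 : nat,
  k0 - a i = c1%:Z + c2%:Z + 2 * c3%:Z /\ k1 - b i = - c1%:Z + 2 * c2%:Z + c3%:Z.
Hypothesis htop : exists i, a i = k0 /\ b i = k1.

Lemma abs_character_le x y w : torus3 x y w -> abs (chi (dg3 x y w)) <= n%:R.
Proof.
move=> ht; rewrite hchi //; apply: le_trans (abs_sum _ _ _) _.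
rewrite (eq_bigr (fun=> 1)) => [|i _]; last exact: abs_mono.
by rewrite sumr_const card_ord.
Qed.

(** Put P = [k0] + 2, Q = [k1] + 1 and s^P = -1. At diag(s, 1, s^-1) the alternant has modulus 2 |1
    - s^(2Q)| and the Vandermonde product |1 - s|^2 |1 - s^2|. Since 0 < Q < P, s^(2Q) is a P-th
    root of unity other than 1, hence no closer to 1 than s^2, and the factor |1 - s^2| cancels. *)
Lemma dimension_lower_bound :
  2 <= n%:R * abs (1 - cis (pi / (k0%:~R + 2)) : C) ^+ 2.
Proof.
have hp := pi_gt0 R.
pose P := `|(k0 + 2)%R|%N; pose Q := `|(k1 + 1)%R|%N.
have eP : k0 + 2 = P%:Z by rewrite /P; lia.
have eQ : k1 + 1 = Q%:Z by rewrite /Q; lia.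
have PR : k0%:~R + 2 = P%:R :> R by rewrite -[RHS]/(P%:Z%:~R) -eP intrD.
have P2 : (2 <= P)%N by rewrite /P; lia.
have Q0 : (0 < Q)%N by rewrite /Q; lia.
have QP : (Q < P)%N by rewrite /Q /P; lia.
have P0 : 0 < P%:R :> R by rewrite ltr0n; lia.
clearbody P Q.
rewrite PR; pose s : C := cis (pi / P%:R).
have sn : s != 0 by exact: cis_neq0.
have s1 : abs s = 1 by exact: abs_cis.
have sP : s ^+ P = -1.
  rewrite -cisMn -[_ *+ P]mulr_natr mulfVK ?gt_eqF //.
  by apply: complex_ext; rewrite /= ?cospi ?sinpi ?oppr0.
have p2 : 0 < pi *+ 2 :> R by rewrite mulr2n addr_gt0.
have [N2 hN2] := weyl_character_formula haar_m hchi hk hdom htop.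
(* N is a multiple of 2P, so s is the M-th power of the basic N-th root of unity, and it exceeds the
   threshold [N2] of the character formula. The second grid index 0 gives the middle eigenvalue
   1. *)
pose M := N2.+1; pose N := (2 * P * M)%N.
have NN : (N2 < N)%N by rewrite /N /M; nia.
have N0 : (0 < N)%N by lia.
have MN : (M < N)%N by rewrite /N; nia.
have es : rou R N ^+ M = s.
  rewrite /rou -cisMn; congr cis; rewrite -[pi *+ 2]mulr_natr -[_ *+ M]mulr_natr /N !natrM.
  have M0 : M%:R != 0 :> R by rewrite pnatr_eq0.
  by field; rewrite M0 gt_eqF.
have := hN2 N NN (Ordinal MN) (Ordinal N0); rewrite /gpt /= es expr0 mulr1 => key.
have ht : torus3 s 1 s^-1 by split; rewrite ?absV ?s1 ?abs1 ?invr1 // mulr1 mulfV.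
have eA : alternant (k0 + 2) (k1 + 1) 0 s 1 s^-1 = 2 * s ^- Q * (1 - s ^+ (2 * Q)).
  rewrite eP eQ /alternant /mono !expr0z !exp1rz !exprz_nat !exprVn sP invrN1.
  by rewrite mul2n -addnn exprD; field; rewrite expf_neq0.
have eV : vdm s 1 s^-1 = - s^-1 ^+ 2 * ((1 - s) ^+ 2 * (1 - s ^+ 2)).
  by rewrite /vdm; field.
have := congr1 (@abs R) key; rewrite absM eA eV !absM absN !absX absV s1 !invr1 !expr1n !mul1r.
have -> : abs (2 : C) = 2 by rewrite -ofreal_nat abs_ofreal normr_nat.
rewrite absV absX s1 expr1n invr1 mulr1 -expr2.
have hchi_le := abs_character_le ht.
move: (abs (chi _)) hchi_le => X hX e.
have s2 (k : nat) : s ^+ (2 * k) = cis (pi *+ 2 / P%:R *+ k).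
  have e2 (p q : R) : p / q *+ 2 = p *+ 2 / q by rewrite mulrnAl.
  by rewrite -cisMn mulrnA e2.
have pos : 0 < abs (1 - s ^+ 2).
  rewrite abs_gt0 subr_eq0 eq_sym; apply/eqP => h.
  have h' : cis (pi *+ 2 / P%:R) = 1 :> C by have := s2 1%N; rewrite muln1 mulr1n => <-.
  have : pi *+ 2 / P%:R = 0 :> R.
    apply: cis_eq1_small h'; rewrite ger0_norm; last exact: (divr_ge0 (ltW p2) (ltW P0)).
    by rewrite (ltr_pdivrMr _ _ P0) (ltr_pMr _ p2) ltr1n.
  by apply/eqP; rewrite mulf_neq0 ?invr_eq0 ?gt_eqF.
have le : abs (1 - s ^+ 2) <= abs (1 - s ^+ (2 * Q)).
  rewrite -ler_sqr ?nnegrE ?abs_ge0 //.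
  have -> : s ^+ 2 = s ^+ (2 * 1) by [].
  rewrite !s2 !sqr_abs_1_cis lerD2l lerN2 ler_pM2l // mulr1n.
  apply: le_cos.
  - exact: (divr_ge0 (ltW p2) (ltW P0)).
  - by rewrite -[leRHS]mulr_natr ler_peMr ?ler1n // (divr_ge0 (ltW p2) (ltW P0)).
  rewrite lerBrDr -mulrSr -[leLHS]mulr_natr mulrAC (ler_pdivrMr _ _ P0) (ler_pM2l p2).
  by rewrite ler_nat.
rewrite -(ler_pM2r pos).
apply: (@le_trans _ _ (2 * abs (1 - s ^+ (2 * Q)))); first by rewrite ler_wpM2l.
by rewrite -e mulrA ler_wpM2r ?abs_ge0 // ler_wpM2r ?sqr_ge0.
Qed.

End DimensionGrowth.

(** * From highest weights to the two conclusions *)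

Section Assembly.
Variable R : realType.
Local Notation C := (CC R).
Local Notation M3 := 'M[C]_3.
Variable m : {measure set (borelM3 R) -> \bar R}.
Hypothesis haar_m : haar m.

Lemma highest_weight_data (V : irrep R) (u : M3) (k0 k1 : int) : SU3 u ->
  highest_weight (conj_torus u) [set a | a = rt u o0 o1 \/ a = rt u o1 o2 \/ a = rt u o0 o2]
    V (lf u k0%:~R k1%:~R) ->
  exists a b : 'I_(repdim V) -> int,
  [/\ forall x y w, torus3 x y w -> character V (dg3 x y w) = \sum_i mono (a i) (b i) 0 x y w,
     exists i, a i = k0 /\ b i = k1 &
     forall i, exists c1 c2 c3 : nat,
      k0 - a i = c1%:Z + c2%:Z + 2 * c3%:Z /\ k1 - b i = - c1%:Z + 2 * c2%:Z + c3%:Z].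
Proof.
move=> hu /(highest_weight_expansion haar_m hu) [a [b [h1 h2 h3]]].
exists a, b; split=> // i; have [c1 [c2 [c3 [e1 e2]]]] := highest_weight_difference hu (h3 i).
exists c1, c2, c3; split; apply: (@intr_inj R).
  by rewrite rmorphB /= e1 !rmorphD rmorphM.
by rewrite rmorphB /= e2 !rmorphD rmorphM rmorphN.
Qed.

Lemma dimension_tends_to_infinity (d : nat -> nat) (q : nat -> R) :
  (forall n, 0 < q n) -> q n @[n --> \oo] --> +oo ->
  (forall n, 2 <= (d n)%:R * abs (1 - cis (pi / q n) : C) ^+ 2) ->
  d n @[n --> \oo] --> \oo.
Proof.
move=> q0 qoo hd; apply/cvgnyPge => A; have hp := pi_gt0 R.
pose e : R := (A.+1)%:R^-1; have e0 : 0 < e by rewrite invr_gt0 ltr0n.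
have [t0 t00 ht] : exists2 t0 : R, 0 < t0 & forall t, `|t| < t0 -> abs (cis t - 1 : C) < e.
  have h : cis t @[t --> (0 : R)] --> (cis 0 : C) by apply: cvg_cis; exact: cvg_id.
  have /cvg_absP/(_ e e0) := h; rewrite cis0 => /nbhs_ballP[t0 /= t00 ht].
  by exists t0 => // t tt; apply: ht; rewrite /ball /= sub0r normrN.
have /cvgryPge/(_ (pi / t0 + 1)) := qoo; apply: filterS => n hq.
have qt : pi / q n < t0 by rewrite ltr_pdivrMr // mulrC -ltr_pdivrMr //; lra.
have hs : abs (1 - cis (pi / q n) : C) < e.
  by rewrite absC; apply: ht; rewrite ger0_norm // divr_ge0 // ltW.
have : abs (1 - cis (pi / q n) : C) ^+ 2 <= e.
  have e1 : e <= 1 by rewrite invf_le1 ?ltr0n // ler1n.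
  by rewrite expr2; apply: le_trans (ler_pM (abs_ge0 _) (abs_ge0 _) (ltW hs) (ltW hs)) _; rewrite ler_piMl // ltW.
move=> h; have := le_trans (hd n) (ler_wpM2l (ler0n _ _) h).
rewrite -ler_pdivrMr // invrK -natrM ler_nat => h'; lia.
Qed.

End Assembly.

Theorem theorem1p6 (R : realType)
  (haar_measure : {measure set (borelM3 R) -> \bar R}) (T : set 'M[CC R]_3)
  (Phi : set ('M[CC R]_3 -> CC R))
  (ip : ('M[CC R]_3 -> CC R) -> ('M[CC R]_3 -> CC R) -> R) :
  haar haar_measure ->
  maximal_torus T ->
  positive_system T Phi ->
  weyl_invariant_inner_product T ip ->
  exists K : R -> R -> R,
  forall C : R, 0 < C ->
  forall (mu : nat -> 'M[CC R]_3 -> CC R) (V : nat -> irrep R),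
    (forall n, dominant T Phi ip (mu n)) ->
    (forall n, highest_weight T Phi (V n) (mu n)) ->
    max_pairing Phi ip (mu n) @[n --> \oo] --> +oo ->
    (forall n, min_pairing Phi ip (mu n) <= C) ->
    repdim (V n) @[n --> \oo] --> \oo /\
    forall p : R, 0 < p < 3 ->
    forall n, (Lpnorm haar_measure p (character (V n)) <= (K p C)%:E)%E.
Proof.
move=> haar_m hT hP hip.
have [u [hu eT eP]] := positive_system_normal hT hP; subst T Phi.
have [N N0 hN] := ip_coordinates hu hip.
have N20 : 0 < N / 2 by rewrite divr_gt0.
(* The exponent s = max(p, 5/2) - 2 lies in (0, 1) for every p < 3 and satisfies p <= 2 + s, so
   small p are covered as well. Dividing C by N / 2 converts the bound on the pairing into one on
   the smaller of [k1 + 1] and [k0 - k1 + 1]. *)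
exists (fun p C => (vol haar_measure *
  (13 + bound_const (C / (N / 2)) / (1 - (Num.max p (5 / 2) - 2)))) `^ p^-1).
move=> C C0 mu V hdom hhw hmax hmin.
have /boolp.choice[k hk] n : exists k : int * int,
    mu n = lf u k.1%:~R k.2%:~R /\ 0 <= k.2 <= k.1.
  have [hw hpos] := hdom n; have [k0 [k1 e]] := weight_lattice_int hu hw.
  exists (k0, k1); split=> //=; have [e1 e2 _] := hN k0%:~R k1%:~R.
  have := hpos (rt u o1 o2) (or_intror (or_introl erefl)).
  rewrite e e2 pmulr_rge0 // ler0z => -> /=.
  have := hpos (rt u o0 o1) (or_introl erefl).
  by rewrite e e1 pmulr_rge0 // subr_ge0 ler_int.
have hkR n : 0 <= ((k n).2%:~R : R) <= (k n).1%:~R by rewrite ler0z ler_int; exact: (hk n).2.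
have data n := highest_weight_data haar_m hu (eq_ind _ (highest_weight _ _ _) (hhw n) _ (hk n).1).
have bounds n := pairing_bounds hu N0 hN (hkR n).
split.
  apply: (@dimension_tends_to_infinity R _ (fun n => (k n).1%:~R + 2)).
  - by move=> n; have /andP[h1 h2] := hkR n; apply: ltr_wpDl => //; exact: le_trans h2.
  - apply/cvgryPge => A; have /cvgryPge/(_ (N / 2 * A)) := hmax; apply: filterS => n h.
    have [h1 _] := bounds n; rewrite (hk n).1 in h.
    by rewrite -(ler_pM2l N20); apply: le_trans h1.
  move=> n; have [a [b [h1 h2 h3]]] := data n.
  exact: (dimension_lower_bound haar_m h1 (hk n).2 h3 h2).
move=> p /andP[p0 p3] n; have [a [b [h1 h2 h3]]] := data n.
apply: (character_Lpnorm_le haar_m h1 (hk n).2 h3 h2).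
- have [_ hb] := bounds n; have := hmin n; rewrite (hk n).1 => hc.
  by rewrite ler_pdivlMr // mulrC; exact: le_trans hc.
- by rewrite subr_gt0 lt_max ltrBlDr gt_max p3 orbC; apply/andP; split; [apply/orP; left|]; lra.
by rewrite p0 /= subrKC le_max lexx.
Qed.
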